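(* Let $\mathcal{F}_1$ and $\mathcal{F}_5$ be the foliations of $\mathbb{P}^2(\mathbb{C})$ described in the affine chart $Z=1$ by 1. $\omega_1=x^2\,\mathrm{d}x+y^2(x\,\mathrm{d}y-y\,\mathrm{d}x)$; 2. $\omega_5=x^2\,\mathrm{d}y+y^2(x\,\mathrm{d}y-y\,\mathrm{d}x)$. Let $\mathcal{F}$ be an element of $\mathscr{F}(2;2)$ such that the Lie algebra $\mathfrak{iso}(\mathcal{F})$ has dimension $2$. Then, up to the action of an automorphism of $\mathbb{P}^2(\mathbb{C})$, $\mathcal{F}$ is $\mathcal{F}_1$ or $\mathcal{F}_5$. In other words, $\mathcal{O}(\mathcal{F}_1)$ and $\mathcal{O}(\mathcal{F}_5)$ are the only orbits of dimension $6$ in $\mathscr{F}(2;2)$. They are closed in $\mathscr{F}(2;2)$. Moreover, in the affine coordinates $(x,y)$, $\mathrm{Iso}(\mathcal{F}_1)$ is the group generated by the transformations $$(\alpha^3x,\alpha^2y),\qquad \left(\frac{x}{1+\beta x},\frac{y}{1+\beta x}\right),\qquad \alpha\in\mathbb{C}^*,\ \beta\in\mathbb{C},$$ and $\mathrm{Iso}(\mathcal{F}_5)$ is the group generated by the transformations $$(\alpha^2x,\alpha y),\qquad \left(\frac{x}{1+\beta y},\frac{y}{1+\beta y}\right),\qquad \alpha\in\mathbb{C}^*,\ \beta\in\mathbb{C};$$ these two groups are not conjugate in $\mathrm{Aut}(\mathbb{P}^2(\mathbb{C}))$.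
   Context: $\mathscr{F}(2;2)$ is the set of quadratic (degree $2$) foliations on $\mathbb{P}^2(\mathbb{C})$: a foliation of degree $N$ is given, up to a nonzero scalar, by a homogeneous $1$-form $\omega=a\,\mathrm{d}X+b\,\mathrm{d}Y+c\,\mathrm{d}Z$ with $a,b,c$ homogeneous of degree $N+1$ without common factor and $aX+bY+cZ=0$. Thus $\mathscr{F}(2;2)$ is a Zariski open subset of $\mathbb{P}^{14}(\mathbb{C})$. In the chart $Z=1$, $x=X/Z$, $y=Y/Z$, the foliation is described by the restriction of $\omega$. $\mathrm{Aut}(\mathbb{P}^2(\mathbb{C}))=\mathrm{PGL}_3(\mathbb{C})$ acts on $\mathscr{F}(2;2)$ by pullback; $\mathcal{O}(\mathcal{F})$ is the orbit of $\mathcal{F}$, $\mathrm{Iso}(\mathcal{F})$ is the (algebraic) subgroup of $\mathrm{Aut}(\mathbb{P}^2(\mathbb{C}))$ preserving $\mathcal{F}$, and $\mathfrak{iso}(\mathcal{F})$ is its Lie algebra. A pair $(f,g)$ denotes the transformation $(x,y)\mapsto(f(x,y),g(x,y))$. *)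

(* Defs.v *)
From HB Require Import structures.
From mathcomp Require Import all_boot all_order all_algebra.
From mathcomp Require Import reals complex mpoly.
Set Implicit Arguments.
Unset Strict Implicit.
Unset Printing Implicit Defensive.
Import GRing.Theory.
Local Open Scope ring_scope.

(* [w : oneform C n] is the polynomial 1-form \sum_i (w 0 i) dX_i on C^n. *)
Definition oneform (C : fieldType) (n : nat) : Type := 'rV[{mpoly C[n]}]_n.

Definition dX (C : fieldType) (n : nat) (i : 'I_n) : 'rV[{mpoly C[n]}]_n :=
  delta_mx 0 i.

(* sigma is the polynomial map C^k -> C^n with components sigma_i;
   the result is \sum_i (w_i o sigma) d(sigma_i). *)
Definition pullback (C : fieldType) (k n : nat)
    (sigma : n.-tuple {mpoly C[k]}) (w : oneform C n) : oneform C k :=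
  \row_(j < k) \sum_(i < n)
     comp_mpoly sigma (w 0 i) * (tnth sigma i)^`M(j).

(* The homogeneous coordinates X, Y, Z of P^2 have indices 0, 1, 2. *)
Definition affine_chart (C : fieldType) (w : oneform C 3) : oneform C 2 :=
  pullback [tuple 'X_0; 'X_1; 1] w.

Definition linear_map (C : fieldType) (M : 'M[C]_3) : 3.-tuple {mpoly C[3]} :=
  [tuple \sum_(j < 3) M i j *: 'X_j | i < 3].

(* [w] is a homogeneous 1-form defining a foliation of degree N on P^2.  A
   foliation is such a form up to [proportional]; sets of foliations are
   represented below by predicates on the forms defining them. *)
Definition foliation (C : fieldType) (N : nat) (w : oneform C 3) : Prop :=
  [/\ forall i : 'I_3, w 0 i \is N.+1.-homog,
      \sum_(i < 3) w 0 i * 'X_i = 0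
    & forall p : {mpoly C[3]},
        (forall i : 'I_3, exists q : {mpoly C[3]}, w 0 i = q * p) ->
        p \is a GRing.unit].

Definition proportional (C : fieldType) (w w' : oneform C 3) : Prop :=
  exists2 c : C, c != 0 & w' = (c%:MP : {mpoly C[3]}) *: (w : 'rV_3).

(* PGL_3 is GL_3 modulo scalars.  Elements of Aut(P^2) are represented by
   invertible matrices acting on column vectors, and subsets of Aut(P^2) by
   their inverse images in GL_3, as predicates on 'M[C]_3. *)
Definition PGL3_orbit (C : fieldType) (w w' : oneform C 3) : Prop :=
  exists2 M : 'M[C]_3, M \in unitmx
    & proportional (pullback (linear_map M) w) w'.

Definition Iso (C : fieldType) (w : oneform C 3) (M : 'M[C]_3) : Prop :=
  M \in unitmx /\ proportional w (pullback (linear_map M) w).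

(* Zariski tangent space at the identity of a subset G of GL_3: the matrices
   A killed by the differentials at 1 of all polynomials vanishing on G. *)
Definition tangent_at_1 (C : fieldType) (G : 'M[C]_3 -> Prop) (A : 'M[C]_3) :
    Prop :=
  forall P : {mpoly C[3 * 3]},
    (forall M : 'M[C]_3, G M -> P.@[fun k => mxvec M 0 k] = 0) ->
    \sum_(k < 3 * 3)
       mxvec A 0 k * (P^`M(k)).@[fun l => mxvec (1%:M : 'M[C]_3) 0 l] = 0.

(* iso(w), a subalgebra of pgl_3 = gl_3 / C.1, is the quotient by the scalar
   matrices of the Lie algebra of the inverse image of Iso(w) in GL_3. *)
Definition dim_iso (C : fieldType) (w : oneform C 3) (d : nat) : Prop :=
  exists U : {vspace 'M[C]_3},
    (forall A : 'M[C]_3, A \in U <-> tangent_at_1 (Iso w) A) /\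
    \dim U = (d + \dim <[(1%:M : 'M[C]_3)]>%VS)%N.

(* Indices for the coefficients of a form of degree N + 1: a component of the
   form and a monomial of degree at most N + 1.  Coefficients of lower degree
   vanish for homogeneous forms, so F(2;N) lies in a linear subspace of the
   projective space with these homogeneous coordinates (P^14 for N = 2). *)
Definition coef_index (N : nat) : finType := ('I_3 * 'X_{1..3 < N.+2})%type.

Definition form_coef (C : fieldType) (N : nat) (w : oneform C 3)
    (k : 'I_#|coef_index N|) : C :=
  (w 0 (enum_val k).1)@_((enum_val k).2 : 'X_{1..3}).

Definition zariski_closed (C : fieldType) (N : nat) (W : oneform C 3 -> Prop) :
    Prop :=
  exists S : {mpoly C[#|coef_index N|]} -> Prop,
    (forall P, S P -> exists d : nat, P \is d.-homog) /\
    (forall w : oneform C 3, foliation N w ->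
       (W w <-> forall P, S P -> P.@[form_coef w] = 0)).

Definition alg_independent_on (C : fieldType) (N : nat)
    (W : oneform C 3 -> Prop) (m : nat)
    (f : 'I_m -> {mpoly C[#|coef_index N|]}) : Prop :=
  forall Q : {mpoly C[m]},
    (forall w : oneform C 3, W w -> Q.@[fun k => (f k).@[form_coef w]] = 0) ->
    Q = 0.

(* Transcendence degree of the algebra of polynomial functions on W.  The
   projective dimension is one less, since W is a union of punctured lines. *)
Definition trdeg (C : fieldType) (N : nat) (W : oneform C 3 -> Prop) (m : nat) :
    Prop :=
  (exists f : 'I_m -> {mpoly C[#|coef_index N|]}, alg_independent_on W f) /\
  ~ (exists f : 'I_m.+1 -> {mpoly C[#|coef_index N|]}, alg_independent_on W f).

Definition proj_dim (C : fieldType) (N : nat) (W : oneform C 3 -> Prop)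
    (d : nat) : Prop :=
  trdeg N W d.+1.

(* [M] is an automorphism of P^2 given by f in the chart Z = 1, wherever the
   image of a point stays in this chart. *)
Definition represents (C : fieldType) (M : 'M[C]_3) (f : C -> C -> C * C) :
    Prop :=
  M \in unitmx /\
  forall x y : C,
    let den := M 2 0 * x + M 2 1 * y + M 2 2 in
    den != 0 ->
    f x y = ((M 0 0 * x + M 0 1 * y + M 0 2) / den,
             (M 1 0 * x + M 1 1 * y + M 1 2) / den).

(* The inverse image in GL_3 of the subgroup of PGL_3 generated by the classes
   of the elements of S, when S is nonempty and stable under nonzero scalars. *)
Inductive generated_by (C : fieldType) (S : 'M[C]_3 -> Prop) :
    'M[C]_3 -> Prop :=
| gen_base (M : 'M[C]_3) : S M -> generated_by S M
| gen_one : generated_by S 1%:M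
| gen_mul (M P : 'M[C]_3) :
    generated_by S M -> generated_by S P -> generated_by S (M *m P)
| gen_inv (M : 'M[C]_3) : generated_by S M -> generated_by S (invmx M).

Definition PGL3_conjugate (C : fieldType) (G H : 'M[C]_3 -> Prop) : Prop :=
  exists2 P : 'M[C]_3, P \in unitmx
    & forall M : 'M[C]_3, G M <-> H (P *m M *m invmx P).

Definition omega1 (C : fieldType) : oneform C 2 :=
  'X_0 ^+ 2 *: dX C 0 + 'X_1 ^+ 2 *: ('X_0 *: dX C 1 - 'X_1 *: dX C 0).

Definition omega5 (C : fieldType) : oneform C 2 :=
  'X_0 ^+ 2 *: dX C 1 + 'X_1 ^+ 2 *: ('X_0 *: dX C 1 - 'X_1 *: dX C 0).

Definition F1 (C : fieldType) : oneform C 3 :=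
  'X_0 ^+ 2 *: ('X_2 *: dX C 0 - 'X_0 *: dX C 2)
  + 'X_1 ^+ 2 *: ('X_0 *: dX C 1 - 'X_1 *: dX C 0).

Definition F5 (C : fieldType) : oneform C 3 :=
  'X_0 ^+ 2 *: ('X_2 *: dX C 1 - 'X_1 *: dX C 2)
  + 'X_1 ^+ 2 *: ('X_0 *: dX C 1 - 'X_1 *: dX C 0).

(* Main.v *)
Require Import Defs.
From HB Require Import structures.
From mathcomp Require Import all_boot all_order all_algebra.
From mathcomp Require Import reals complex mpoly ring zify.
Import Order.TTheory GRing.Theory Num.Theory.
Local Open Scope ring_scope.
Set Implicit Arguments.
Unset Strict Implicit.
Unset Printing Implicit Defensive.

(** A quadratic foliation is given by a form V x X, the cross product of a
homogeneous quadratic vector field V of C^3 with the radial field X.  Among the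
fields differing by a multiple of X there is one of divergence zero, so forms
correspond to tensors T, where V_i(x) = x^T T_i x with T_i symmetric and
\sum_i T_iik = 0 ([tens], [form_of_tens], [tens_form_of]).  Pullback by M is
the natural action, T_i |-> \sum_l adj(M)_il M^T T_l M ([pullback_form_of]), and
all computations take place on T.

Orbits.  Since the field of scalars has fourth roots, the orbit of w is the
image of GL_3 under M |-> M^* w, which is polynomial in the nine
entries of M: a polynomial vanishes on the orbit iff its composite with this map is zero
([vanishes_on_orbit]).  The differential of the map at 1 sends A to [dact A T];
if it has rank r, there are r independent functions on the orbit
([jacobian_criterion], [alg_independent_rank]).  Conversely n + 1 polynomials
in n variables are dependent ([mpoly_alg_dependent]), so that a family of
matrices depending on 7 parameters and meeting almost all cosets of the
isotropy group bounds the transcendence degree by 7 ([alg_dependent_slice]).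

Classification.  Let g be the Lie algebra of the matrices A preserving T up to
a factor; it contains the scalars.  Each of the two hypotheses (isotropy
algebra of dimension 2, orbit of dimension 6) gives dim g >= 3.  On the
trace-free part of g, of dimension at least 2, the quadratic form tr(N^2) has
a zero N <> 0, and then N^3 is a scalar.  If N^3 <> 0, then N is conjugate to a
multiple of diag(1, j, j^2) with j a primitive cube root of unity; any two monomial fields
of the same weight have a common variable, so that V is divisible by a variable
([diagonal_isotropy_not_foliation]).  If N^3 = 0 <> N^2, then V belongs to an
explicit family and g is spanned by 1 and N
([regular_nilpotent_not_foliation]).  If N^2 = 0, then
V = (0, q(X, Y), r(X, Y)) modulo the radial field, and an element of g outside
the span of 1 and N forces one of the two models ([rank_one_classification]).

Closedness.  A foliation in the closure of one of the two orbits satisfies the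
same algebraic relations, hence by the classification it lies in one of the two
orbits ([closure_classification]).  The quadratic polynomial of
[separating_form] vanishes on the orbit of F1 and not at F5, so F5 is not in
the closure of the orbit of F1; as it cuts out a proper closed subset of the
closure of the orbit of F5, an orbit on which it vanishes can be in this closure
only if its dimension is smaller ([closure_dimension]), and the orbit of F1 has
dimension 6 as well.

Isotropy groups.  The equations for M preserving T up to a factor are solved
directly ([Iso_F1P], [Iso_F5P]): M is a diagonal matrix times a shear.  The
groups are not conjugate because diag(8, 4, 1), which preserves F1, has
eigenvalues that are not proportional to a^2, a, 1. *)

(** * Polynomials as functions, algebraic dependence *)

Section PolynomialRings.

Lemma mpoly_ring_ind (n : nat) (R : nzRingType) (P : {mpoly R[n]} -> Prop) :
  (forall c, P c%:MP) -> (forall i, P 'X_i) ->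
  (forall p q, P p -> P q -> P (p + q)) ->
  (forall p q, P p -> P q -> P (p * q)) -> forall p, P p.
Proof.
move=> PC PX PD PM; apply: mpolyind; first by rewrite -(mpolyC0 n); apply: PC.
move=> c m p _ _ Pp; apply: PD => //.
rewrite -mul_mpolyC; apply: (PM) => //.
rewrite mpolyXE_id; elim/big_ind: _ => [|x y|i _]; [exact: (PC 1)|exact: (PM)|].
by elim: (m i) => [|k IHk]; rewrite ?exprS; [exact: (PC 1)|exact: (PM)].
Qed.

(** Separates the last variable, for inductions on the number of variables. *)
Lemma muni_coef (n : nat) (R : nzRingType) (p : {mpoly R[n.+1]}) (k : nat)
    (m : 'X_{1..n}) :
  (muni p)`_k@_m = p@_[multinom of rcons m k].
Proof.
rewrite muniE coef_sum raddf_sum /= [in RHS](mpolyE p) raddf_sum /=.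
apply: eq_bigr => u _; rewrite coefZ coefXn !mcoeffZ mcoeffX.
case: eqP => [Ek|Nk]; last first.
  rewrite mulr0 mcoeff0; case: eqP => [Eu|]; last by rewrite mulr0.
  by case: Nk; rewrite Eu (mnm_nth 0%N) /= nth_rcons size_tuple ltnn eqxx.
rewrite mulr1 mcoeffZ mcoeffX; congr (_ * (nat_of_bool _)%:R).
apply/eqP/eqP => [Em|Eu].
  apply/mnmP => i; rewrite [in RHS](mnm_nth 0%N) /= nth_rcons size_tuple.
  case: ltnP => Hi; last first.
    have Ei: i = ord_max.
      by apply/val_inj/eqP => /=; rewrite eqn_leq Hi -ltnS ltn_ord.
    by rewrite Ei eqxx -Ek.
  have /mnmP/(_ (Ordinal Hi)) := Em; rewrite mnmE [X in _ = X](mnm_nth 0%N) /=.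
  by move=> <-; congr (u _); apply/val_inj.
apply/mnmP => i; rewrite mnmE Eu (mnm_nth 0%N) /= nth_rcons size_tuple.
by rewrite ltn_ord -(mnm_nth 0%N).
Qed.

Lemma muni_horner (n : nat) (R : comNzRingType) (p : {mpoly R[n.+1]})
    (v : 'I_n.+1 -> R) :
  p.@[v] = (map_poly (meval (v \o widen_ord (leqnSn n))) (muni p)).[v ord_max].
Proof.
rewrite mevalE muniE !raddf_sum horner_sum; apply: eq_bigr => m _ /=.
rewrite map_polyZ map_polyXn hornerZ hornerXn [in RHS]/= mevalZ mevalX.
rewrite big_ord_recr /=.
rewrite mulrA; congr (_ * _ * _); apply: eq_bigr => i _; rewrite mnmE.
by congr (v _ ^+ m _).
Qed.

Variable C : numFieldType.

Lemma poly_eval_eq0 (p : {poly C}) : (forall x, p.[x] = 0) -> p = 0.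
Proof.
move=> p0; apply: (@roots_geq_poly_eq0 _ _ [seq i%:R | i <- iota 0 (size p)]).
- by apply/allP => x _; apply/rootP.
- by rewrite map_inj_uniq ?iota_uniq // => i j /eqP; rewrite eqr_nat => /eqP.
- by rewrite size_map size_iota.
Qed.

(** C is infinite, so the last variable can be separated from the others. *)
Lemma mpoly_eval_eq0 (n : nat) (p : {mpoly C[n]}) :
  (forall v, p.@[v] = 0) -> p = 0.
Proof.
elim: n p => [|n IHn] p p0.
  rewrite (nvar0_mpolyC p); have := p0 (fun=> 0).
  by rewrite {1}(nvar0_mpolyC p) mevalC => ->; rewrite mpolyC0.
have muni0 k : (muni p)`_k = 0.
  apply: IHn => v; pose w x (i : 'I_n.+1) := oapp v x (unlift ord_max i).
  have /polyP/(_ k) : map_poly (meval v) (muni p) = 0.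
    apply: poly_eval_eq0 => x; rewrite -[RHS](p0 (w x)) muni_horner.
    rewrite {2}/w unlift_none /=; congr (_.[_]); apply: eq_map_poly => q.
    apply: meval_eq => i /=; rewrite /w.
    have -> : widen_ord (leqnSn n) i = lift ord_max i.
      by apply/val_inj; rewrite /= /bump leqNgt ltn_ord.
    by rewrite liftK.
  by rewrite coef_map coef0.
apply/mpolyP => m; rewrite mcoeff0.
have -> : m = [multinom of rcons [multinom m (widen_ord (leqnSn n) i) | i < n]
                  (m ord_max)].
  apply/mnmP => i; rewrite [in RHS](mnm_nth 0%N) /= nth_rcons size_tuple.
  rewrite card_ord; case: ltnP => Hi.
    rewrite (_ : nth _ _ _ = tnth [multinom m (widen_ord (leqnSn n) j) | j < n]
               (Ordinal Hi)); last by rewrite (tnth_nth 0%N).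
    rewrite -[tnth _ _]/(([multinom _ | j < n])%MM (Ordinal Hi)) mnmE.
    by congr (m _); apply/val_inj.
  have Ei: i = ord_max.
    by apply/val_inj/eqP => /=; rewrite eqn_leq Hi -ltnS ltn_ord.
  by rewrite Ei eqxx.
by rewrite -muni_coef muni0 mcoeff0.
Qed.

Lemma mpoly_eval_eq (n : nat) (p q : {mpoly C[n]}) :
  (forall v, p.@[v] = q.@[v]) -> p = q.
Proof.
move=> pq; apply/eqP; rewrite -subr_eq0; apply/eqP/mpoly_eval_eq0 => v.
by rewrite mevalB pq subrr.
Qed.

(** Nonempty Zariski open sets are dense: [h * p] vanishes everywhere. *)
Lemma mpoly_eval_dense (n : nat) (h p : {mpoly C[n]}) :
  h != 0 -> (forall v, h.@[v] != 0 -> p.@[v] = 0) -> p = 0.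
Proof.
move=> h0 hp; have /eqP : h * p = 0.
  apply: mpoly_eval_eq0 => v; rewrite mevalM.
  by have [->|/hp->] := eqVneq h.@[v] 0; rewrite ?mul0r ?mulr0.
by rewrite mulf_eq0 (negPf h0) => /eqP.
Qed.

End PolynomialRings.

Section AlgebraicDependence.

Lemma chain_rule (R : comNzRingType) (n m : nat) (t : m.-tuple {mpoly R[n]})
    (Q : {mpoly R[m]}) (j : 'I_n) :
  (Q \mPo t)^`M(j) = \sum_(k < m) (Q^`M(k) \mPo t) * (tnth t k)^`M(j).
Proof.
elim/mpoly_ring_ind: Q => [c|i|p q IHp IHq|p q IHp IHq].
- rewrite comp_mpolyC mderivC big1 // => k _.
  by rewrite mderivC comp_mpoly0 mul0r.
- rewrite comp_mpolyXU -tnth_nth (bigD1 i) //= big1 ?addr0 => [|k ki].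
    rewrite mderivX mnmE eqxx scale1r (_ : (U_(i) - U_(i))%MM = 0%MM).
      by rewrite mpolyX0 comp_mpoly1 mul1r.
    by apply/mnmP => l; rewrite !mnmE subnn.
  by rewrite mderivX mnmE eq_sym (negPf ki) scale0r comp_mpoly0 mul0r.
- rewrite comp_mpolyD mderivD IHp IHq -big_split /=; apply: eq_bigr => k _.
  by rewrite mderivD comp_mpolyD mulrDl.
- rewrite rmorphM mderivM IHp IHq mulr_suml mulr_sumr -big_split /=.
  apply: eq_bigr => k _; rewrite mderivM rmorphD !rmorphM /=; ring.
Qed.

Lemma msizeM_bound (R : idomainType) (n d e : nat) (p q : {mpoly R[n]}) :
  (msize p <= d.+1 -> msize q <= e.+1 -> msize (p * q) <= (d + e).+1)%N.
Proof.
have [->|p0] := eqVneq p 0; first by rewrite mul0r msize0.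
have [->|q0] := eqVneq q 0; first by rewrite mulr0 msize0.
by rewrite msizeM //; lia.
Qed.

(** Counting of monomials: the products of powers of the [g i] with exponents
    less than K number K^m, while their degrees are O(K), so that they live in a
    space of dimension O(K^n). *)
Lemma mpoly_alg_dependent (F : fieldType) (n m : nat)
    (g : 'I_m -> {mpoly F[n]}) :
  (n < m)%N -> exists2 Q : {mpoly F[m]}, Q != 0 & Q \mPo [tuple g i | i < m] = 0.
Proof.
move=> nm; pose d := (\max_(i < m) msize (g i))%N.
(* The products have degree less than B <= (m d + 1) K, and
   B^n <= (m d + 1)^n K^n < K^(n + 1) <= K^m. *)
pose K := ((m * d + 1) ^ n).+1; pose B := (m * (K * d)).+1.
have gd i : (msize (g i) <= d.+1)%N.
  by apply: leqW; rewrite /d (bigD1 i) //= leq_maxl.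
pose X (a : {ffun 'I_m -> 'I_K}) := [multinom (a i : nat) | i < m].
pose Y (b : {ffun 'I_n -> 'I_B}) := [multinom (b i : nat) | i < n].
pose G (a : {ffun 'I_m -> 'I_K}) := \prod_i g i ^+ a i.
have GB a : (msize (G a) <= B)%N.
  have -> : B = (\sum_(i < m) K * d).+1 by rewrite sum_nat_const card_ord.
  rewrite /G -!(big_enum _ _ predT) /=.
  elim: (enum _) => [|i s IHs]; first by rewrite !big_nil msize1.
  rewrite !big_cons; apply: msizeM_bound IHs.
  apply: (@leq_trans (a i * d).+1); last first.
    by rewrite ltnS leq_mul2r ltnW ?orbT.
  elim: (a i : nat) => [|k IHk]; first by rewrite expr0 msize1.
  by rewrite exprS mulSn; apply: msizeM_bound.
pose A := \matrix_(a < #|{ffun 'I_m -> 'I_K}|, b < #|{ffun 'I_n -> 'I_B}|)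
  (G (enum_val a))@_(Y (enum_val b)).
have BK : (#|{ffun 'I_n -> 'I_B}| < #|{ffun 'I_m -> 'I_K}|)%N.
  rewrite !card_ffun !card_ord.
  apply: (@leq_ltn_trans (((m * d + 1) * K) ^ n)).
    have BK : (B <= (m * d + 1) * K)%N.
      by rewrite /B mulnDl mul1n mulnCA mulnC -addn1 leq_add.
    by elim: (n) => // k IHk; rewrite !expnS leq_mul.
  rewrite expnMn; apply: (@leq_trans (K * K ^ n)%N).
    by rewrite ltn_pmul2r ?expn_gt0 // ltnS.
  by rewrite -expnS leq_exp2l // ltnS expn_gt0 addn1.
have /rowV0Pn[u uA u0] : kermx A != 0.
  rewrite kermx_eq0 /row_free neq_ltn; apply/orP; left.
  by apply: leq_ltn_trans (rank_leq_col A) BK.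
exists (\sum_a u 0 a *: 'X_[X (enum_val a)]).
  apply: contraNneq u0 => Q0; apply/eqP/rowP => a; rewrite mxE.
  rewrite -(mcoeff0 F (X (enum_val a))) -Q0 raddf_sum (bigD1 a) //=.
  rewrite big1 => [|b ba]; rewrite mcoeffZ mcoeffX ?eqxx ?mulr1 ?addr0 //.
  case: eqP => [E|]; rewrite ?mulr0 //; case/eqP: ba; apply: enum_val_inj.
  apply/ffunP => i; apply/val_inj; have /mnmP/(_ i) := E.
  by rewrite !mnmE.
rewrite raddf_sum /=; apply/mpolyP => k; rewrite mcoeff0 raddf_sum /=.
have XG a : 'X_[X a] \mPo [tuple g i | i < m] = G a.
  by rewrite comp_mpolyX; apply: eq_bigr => i _; rewrite tnth_mktuple mnmE.
transitivity (\sum_a u 0 a * (G (enum_val a))@_k).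
  by apply: eq_bigr => a _; rewrite comp_mpolyZ mcoeffZ XG.
have [kB|Bk] := ltnP (mdeg k) B; last first.
  rewrite big1 // => a _; rewrite memN_msupp_eq0 ?mulr0 //.
  exact: msize_mdeg_ge (leq_trans (GB _) Bk).
have ki i : (k i < B)%N.
  by apply: leq_ltn_trans kB; rewrite mdegE (bigD1 i) //= leq_addr.
pose b := enum_rank [ffun i => Ordinal (ki i)].
have -> : k = Y (enum_val b).
  by apply/mnmP => i; rewrite mnmE enum_rankK ffunE.
have /rowP/(_ b) := sub_kermxP uA; rewrite [LHS]mxE [RHS]mxE => uAb.
by rewrite -[RHS]uAb; apply: eq_bigr => a _; rewrite [A _ _]mxE.
Qed.

Lemma mpoly_const_mderiv (F : numFieldType) (n : nat) (p : {mpoly F[n]}) :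
  (forall i, p^`M(i) = 0) -> p = (p@_0)%:MP.
Proof.
move=> p0; apply/mpolyP => m; rewrite mcoeffC.
have [->|/eqP m0] := eqVneq m 0%MM; first by rewrite mulr1.
rewrite mulr0; have [i mi] : exists i, (0 < m i)%N.
  apply/existsP; apply: contra_notT m0; rewrite negb_exists => /forallP m0.
  by apply/mnmP => i; rewrite mnm0E; apply/eqP; rewrite eqn0Ngt m0.
have /mpolyP/(_ (m - U_(i))%MM) := p0 i.
rewrite mcoeff_deriv mcoeff0 submK; last first.
  by apply/mnm_lepP => j; rewrite mnmE; case: eqP => // <-.
by move/eqP; rewrite mulrn_eq0 => /eqP.
Qed.

Lemma msize_mderiv (R : nzRingType) (n : nat) (p : {mpoly R[n]}) (i : 'I_n) :
  (msize p^`M(i) <= (msize p).-1)%N.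
Proof.
rewrite msizeE; apply/bigmax_leqP_seq => m; rewrite mcoeff_msupp => pm _.
have : (m + U_(i))%MM \in msupp p.
  apply: contraNT pm; rewrite mcoeff_deriv => /memN_msupp_eq0->.
  by rewrite mul0rn.
by move/msize_mdeg_lt; rewrite mdegD mdeg1 addn1; case: (msize p).
Qed.

(** [E] is a right inverse of the Jacobian matrix of [g] at [v], which
    makes the determinant J below nonzero.  The derivatives of a relation of
    minimal degree are, by the chain rule, in the kernel of J, hence they are
    relations of smaller degree. *)
Lemma jacobian_criterion (F : numFieldType) (n m : nat)
    (g : 'I_m -> {mpoly F[n]}) (v : 'I_n -> F) (E : 'M[F]_(n, m)) :
  (forall k i, \sum_j ((g k)^`M(j)).@[v] * E j i = (k == i)%:R) ->
  forall Q : {mpoly F[m]}, Q \mPo [tuple g k | k < m] = 0 -> Q = 0.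
Proof.
move=> gE Q; set t := [tuple _ | _ < _].
pose J := \matrix_(k < m, i < m) \sum_j (g k)^`M(j) * (E j i)%:MP.
have J0 : \det J != 0.
  apply/eqP => /(congr1 (meval v)); rewrite -det_map_mx (_ : map_mx _ _ = 1%:M).
    by rewrite det1 meval0 => /eqP; rewrite oner_eq0.
  apply/matrixP => k i; rewrite !mxE raddf_sum -gE; apply: eq_bigr => j _.
  by rewrite /= mevalM mevalC.
have [d] := ubnP (msize Q); elim: d Q => // d IHd Q Qd Qt.
have dQ k : Q^`M(k) = 0.
  have [Q0|Q0] := eqVneq Q 0; first by rewrite Q0 mderiv0.
  apply: IHd.
    apply: leq_ltn_trans (msize_mderiv _ _) _.
    by move: Qd; rewrite ltnS [msize Q]mpolySpred.
  pose r := \row_k (Q^`M(k) \mPo t).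
  have rJ : r *m J = 0.
    apply/rowP => i; rewrite !mxE.
    under eq_bigr => l _ do rewrite !mxE mulr_sumr.
    rewrite exchange_big big1 //= => j _.
    under eq_bigr => l _ do rewrite mulrA.
    rewrite -mulr_suml; apply/eqP; rewrite mulf_eq0; apply/orP; left.
    have := congr1 (mderiv j) Qt; rewrite chain_rule mderiv0 => Qj.
    by rewrite -[X in _ == X]Qj; apply/eqP/eq_bigr => l _; rewrite tnth_mktuple.
  have : r *m J *m \adj J = 0 by rewrite rJ mul0mx.
  rewrite -mulmxA mul_mx_adj => /rowP/(_ k); rewrite mul_mx_scalar !mxE.
  by move/eqP; rewrite mulf_eq0 (negPf J0) => /eqP.
have QC := mpoly_const_mderiv dQ.
by move/eqP: Qt; rewrite QC comp_mpolyC mpolyC_eq0 => /eqP->; rewrite mpolyC0.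
Qed.

End AlgebraicDependence.

(** * Quadratic vector fields and forms *)

Section Coordinates.

(** Vectors of C^3 as functions; a nested use gives a 3 x 3 matrix by rows. *)
Definition t3 (S : Type) (a b c : S) (i : 'I_3) : S := nth a [:: a; b; c] i.

Lemma t3_0 (S : Type) (a b c : S) : t3 a b c 0 = a. Proof. by []. Qed.
Lemma t3_1 (S : Type) (a b c : S) : t3 a b c 1 = b. Proof. by []. Qed.
Lemma t3_2 (S : Type) (a b c : S) : t3 a b c 2 = c. Proof. by []. Qed.
Definition t3E := (t3_0, t3_1, t3_2).

Lemma ord3P (P : 'I_3 -> Prop) : P 0 -> P 1 -> P 2 -> forall i, P i.
Proof.
move=> P0 P1 P2 [[|[|[|//]]] Hi]; [move: P0|move: P1|move: P2];
  by congr P; apply/val_inj.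
Qed.

Lemma sum3 (S : nmodType) (F : 'I_3 -> S) : \sum_i F i = F 0 + F 1 + F 2.
Proof.
rewrite !big_ord_recl big_ord0 addr0 addrA.
by congr (F _ + F _ + F _); apply/val_inj.
Qed.

Section Ring.
Variable S : comNzRingType.
Implicit Types (u v x : 'I_3 -> S) (M N : 'M[S]_3) (T : 'I_3 -> 'M[S]_3).

Definition cross u v : 'I_3 -> S :=
  t3 (u 1 * v 2 - u 2 * v 1) (u 2 * v 0 - u 0 * v 2) (u 0 * v 1 - u 1 * v 0).

Lemma cross_eq u u' v v' i : u =1 u' -> v =1 v' -> cross u v i = cross u' v' i.
Proof. by move=> uu vv; rewrite /cross !uu !vv. Qed.

Definition mapv M x i := \sum_j M i j * x j.

(** The adjugate as the matrix of cross products of columns, which makes its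
    entries explicit polynomials. *)
Definition adj3 M : 'M[S]_3 :=
  \matrix_(i, j) cross (M^~ (i + 1)) (M^~ (i + 2)) j.

Definition det3 M := \sum_j adj3 M 0 j * M j 0.

(** The quadratic vector field x |-> (x^T T_i x)_i of a tensor T. *)
Definition vf T x i := \sum_j \sum_k T i j k * x j * x k.

(** The value at x of the form obtained from V = [vf T] by contracting the volume
    form with V and with the radial field. *)
Definition fm T x := cross (vf T x) x.

Definition act M T i := \sum_l adj3 M i l *: (M^T *m T l *m M).

Lemma ordE : (1 + 1 = 2 :> 'I_3) * (1 + 2 = 0 :> 'I_3) * (2 + 1 = 0 :> 'I_3) *
  (2 + 2 = 1 :> 'I_3) * (0 + 1 = 1 :> 'I_3) * (0 + 2 = 2 :> 'I_3).
Proof. by do !split; apply/val_inj. Qed.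

Lemma adj3_mapv M x i : mapv (adj3 M) (mapv M x) i = det3 M * x i.
Proof.
elim/ord3P: i; rewrite /mapv /det3 !sum3 !mxE /cross !t3E !ordE; ring.
Qed.

Lemma mapv_adj3 M x i : mapv M (mapv (adj3 M) x) i = det3 M * x i.
Proof.
elim/ord3P: i; rewrite /mapv /det3 !sum3 !mxE /cross !t3E !ordE; ring.
Qed.

Lemma cross_dot u x : \sum_i cross u x i * x i = 0.
Proof. rewrite sum3 /cross !t3E; ring. Qed.

(** Equivariance of the cross product, M^T (u x Mv) = (adj(M) u) x v. *)
Lemma cross_mapv M u v j :
  \sum_i cross u (mapv M v) i * M i j = cross (mapv (adj3 M) u) v j.
Proof.
by elim/ord3P: j; rewrite !sum3 /cross !t3E /mapv !sum3 !mxE /cross !t3E !ordE;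
  ring.
Qed.

Lemma mapv_mul M N x i : mapv M (mapv N x) i = mapv (M *m N) x i.
Proof.
rewrite /mapv; under eq_bigr => j _ do rewrite mulr_sumr.
rewrite exchange_big; apply: eq_bigr => k _; rewrite mxE mulr_suml.
by apply: eq_bigr => j _; rewrite mulrA.
Qed.

Lemma mapv1 x i : mapv 1%:M x i = x i.
Proof.
by rewrite /mapv (bigD1 i) //= big1 ?addr0 => [|j /negPf ji];
   rewrite mxE ?eqxx ?mul1r // eq_sym ji mul0r.
Qed.

Lemma adj3_mul M : adj3 M *m M = (det3 M)%:M.
Proof.
apply/matrixP => i j; have := adj3_mapv M (fun k => (k == j)%:R) i.
rewrite mapv_mul /mapv (bigD1 j) //= eqxx mulr1 big1 ?addr0 => [->|k /negPf->].
  by rewrite mxE mulr_natr.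
by rewrite mulr0.
Qed.

Lemma mul_adj3 M : M *m adj3 M = (det3 M)%:M.
Proof.
apply/matrixP => i j; have := mapv_adj3 M (fun k => (k == j)%:R) i.
rewrite mapv_mul /mapv (bigD1 j) //= eqxx mulr1 big1 ?addr0 => [->|k /negPf->].
  by rewrite mxE mulr_natr.
by rewrite mulr0.
Qed.

Lemma det_mx22 (A : 'M[S]_2) : \det A = A 0 0 * A 1 1 - A 0 1 * A 1 0.
Proof.
rewrite (expand_det_row _ 0) !big_ord_recl big_ord0 addr0 /cofactor !det_mx11.
rewrite !mxE /= expr0 mul1r expr1 mulN1r mulrN.
by congr (A _ _ * A _ _ - A _ _ * A _ _); apply/val_inj.
Qed.

Lemma det3E M : det3 M = \det M.
Proof.
rewrite (expand_det_row _ 0) sum3 /cofactor !det_mx22 /det3 sum3 !mxE /cross !t3E.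
rewrite !ordE /=.
have -> : lift 0 0 = 1 :> 'I_3 by apply/val_inj.
have -> : lift 0 1 = 2 :> 'I_3 by apply/val_inj.
have -> : lift 1 0 = 0 :> 'I_3 by apply/val_inj.
have -> : lift 1 1 = 2 :> 'I_3 by apply/val_inj.
have -> : lift 2 0 = 0 :> 'I_3 by apply/val_inj.
have -> : lift 2 1 = 1 :> 'I_3 by apply/val_inj.
ring.
Qed.

Lemma actE M T i j k :
  act M T i j k = \sum_l adj3 M i l * \sum_m \sum_n M m j * T l m n * M n k.
Proof.
rewrite /act summxE; apply: eq_bigr => l _; rewrite mxE; congr (_ * _).
rewrite mxE exchange_big; apply: eq_bigr => n _ /=; rewrite mxE mulr_suml.
by apply: eq_bigr => m _; rewrite mxE.
Qed.

Lemma vf_act M T x i : vf (act M T) x i = mapv (adj3 M) (vf T (mapv M x)) i.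
Proof.
transitivity (\sum_l adj3 M i l *
    \sum_j \sum_k (\sum_m \sum_n M m j * T l m n * M n k) * x j * x k).
  under [RHS]eq_bigr => l _ do rewrite mulr_sumr.
  rewrite exchange_big; apply: eq_bigr => j _ /=.
  under [RHS]eq_bigr => l _ do rewrite mulr_sumr.
  rewrite exchange_big; apply: eq_bigr => k _ /=.
  by rewrite actE !mulr_suml; apply: eq_bigr => l _; rewrite !mulrA.
apply: eq_bigr => l _; congr (_ * _).
under eq_bigr => j _ do under eq_bigr => k _ do rewrite !mulr_suml.
under eq_bigr => j _ do rewrite exchange_big.
rewrite exchange_big; apply: eq_bigr => m _ /=.
under eq_bigr => j _ do under eq_bigr => k _ do rewrite !mulr_suml.
under eq_bigr => j _ do rewrite exchange_big.
rewrite exchange_big; apply: eq_bigr => n _ /=.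
rewrite /mapv -mulrA mulr_suml mulr_sumr; apply: eq_bigr => j _.
by rewrite !mulr_sumr; apply: eq_bigr => k _; ring.
Qed.

Lemma fm_act M T x j : fm (act M T) x j = \sum_i fm T (mapv M x) i * M i j.
Proof.
by rewrite /fm cross_mapv; apply: cross_eq => // i; apply: vf_act.
Qed.

End Ring.

Section Morphism.
Variables (S S' : comNzRingType) (f : {rmorphism S -> S'}).

Lemma map_cross u v i : f (cross u v i) = cross (f \o u) (f \o v) i.
Proof.
by elim/ord3P: i; rewrite /cross !t3E rmorphB !rmorphM.
Qed.

Lemma map_adj3 (M : 'M[S]_3) : map_mx f (adj3 M) = adj3 (map_mx f M).
Proof.
apply/matrixP => i j; rewrite !mxE map_cross.
by rewrite /cross; elim/ord3P: j; rewrite !t3E !mxE.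
Qed.

Lemma map_act (M : 'M[S]_3) T i :
  map_mx f (act M T i) = act (map_mx f M) (fun l => map_mx f (T l)) i.
Proof.
apply/matrixP => j k; rewrite mxE !actE raddf_sum; apply: eq_bigr => l _ /=.
rewrite rmorphM; congr (_ * _); first by rewrite -map_adj3 [RHS]mxE.
rewrite raddf_sum; apply: eq_bigr => m _ /=.
by rewrite raddf_sum; apply: eq_bigr => n _; rewrite !mxE /= !rmorphM.
Qed.

Lemma map_vf T x i : f (vf T x i) = vf (fun l => map_mx f (T l)) (f \o x) i.
Proof.
rewrite /vf raddf_sum; apply: eq_bigr => j _; rewrite raddf_sum.
by apply: eq_bigr => k _; rewrite /= !rmorphM mxE.
Qed.

Lemma map_fm T x i : f (fm T x i) = fm (fun l => map_mx f (T l)) (f \o x) i.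
Proof.
by rewrite /fm map_cross; apply: cross_eq => // j; apply: map_vf.
Qed.

End Morphism.

End Coordinates.

Section Forms.
Variable C : numClosedFieldType.
Implicit Types (w : oneform C 3) (M N : 'M[C]_3) (T : 'I_3 -> 'M[C]_3).
Implicit Types (x : 'I_3 -> C).

Definition ev w x i := (w 0 i).@[x].

Lemma ev_inj w w' : (forall x i, ev w x i = ev w' x i) -> w = w'.
Proof.
by move=> ww'; apply/rowP => i; apply: mpoly_eval_eq => x; apply: ww'.
Qed.

Lemma linear_map_eval M x i : (tnth (linear_map M) i).@[x] = mapv M x i.
Proof.
rewrite tnth_mktuple raddf_sum; apply: eq_bigr => j _ /=.
by rewrite mevalZ mevalXU.
Qed.

Lemma linear_map_deriv M i j : (tnth (linear_map M) i)^`M(j) = (M i j)%:MP.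
Proof.
rewrite tnth_mktuple raddf_sum (bigD1 j) //= big1 ?addr0 => [|k /negPf kj].
  rewrite mderivZ mderivX mnmE eqxx scale1r (_ : (U_(j) - U_(j))%MM = 0%MM).
    by rewrite mpolyX0 -mul_mpolyC mulr1.
  by apply/mnmP => l; rewrite !mnmE subnn.
by rewrite mderivZ mderivX mnmE kj scale0r scaler0.
Qed.

Lemma ev_pullback M w x j :
  ev (pullback (linear_map M) w) x j = \sum_i ev w (mapv M x) i * M i j.
Proof.
rewrite /ev mxE raddf_sum; apply: eq_bigr => i _ /=.
rewrite mevalM comp_mpoly_meval linear_map_deriv mevalC; congr (_ * _).
by apply: meval_eq => k; rewrite linear_map_eval.
Qed.

Lemma ev_eq w x y i : x =1 y -> ev w x i = ev w y i.
Proof. by move=> xy; apply: meval_eq. Qed.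

Lemma pullback_comp M N w :
  pullback (linear_map N) (pullback (linear_map M) w)
    = pullback (linear_map (M *m N)) w.
Proof.
apply: ev_inj => x k; rewrite !ev_pullback.
under eq_bigr => j _ do rewrite ev_pullback mulr_suml.
rewrite exchange_big; apply: eq_bigr => i _ /=.
under eq_bigr => j _ do rewrite -mulrA.
rewrite -mulr_sumr mxE; congr (_ * _); apply: ev_eq => l; exact: mapv_mul.
Qed.

Lemma pullback1 w : pullback (linear_map 1%:M) w = w.
Proof.
apply: ev_inj => x j; rewrite ev_pullback (bigD1 j) //= big1 => [|i /negPf ij].
  rewrite mxE eqxx mulr1 addr0; apply: ev_eq => i; exact: mapv1.
by rewrite mxE ij mulr0.
Qed.

Definition form_of T : oneform C 3 :=
  \row_i fm (fun l => map_mx (@mpolyC 3 C) (T l)) (fun k => 'X_k) i.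

Lemma ev_form_of T x i : ev (form_of T) x i = fm T x i.
Proof.
rewrite /ev mxE map_fm /fm /cross /vf.
by elim/ord3P: i; rewrite !t3E !sum3 /= !mevalXU !mxE !mevalC.
Qed.

Lemma pullback_form_of M T :
  pullback (linear_map M) (form_of T) = form_of (act M T).
Proof.
apply: ev_inj => x j.
transitivity (fm (act M T) x j); last by rewrite ev_form_of.
rewrite ev_pullback fm_act.
by apply: eq_bigr => i _; rewrite ev_form_of.
Qed.

Definition is_form w :=
  (forall i, w 0 i \is 3.-homog) /\ \sum_i w 0 i * 'X_i = 0.

Lemma foliation_is_form w : foliation 2 w -> is_form w.
Proof. by case. Qed.

Lemma dhomogXU (i : 'I_3) : 'X_i \is [in C[3], 1.-homog].
Proof. by rewrite dhomogX /= mdeg1. Qed.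

Lemma form_of_is_form T : is_form (form_of T).
Proof.
split=> [i|].
  have hv l : vf (fun l => map_mx (@mpolyC 3 C) (T l)) (fun k => 'X_k) l
              \is 2.-homog.
    rewrite rpred_sum // => j _; rewrite rpred_sum // => k _.
    by rewrite mxE mul_mpolyC -scalerAl rpredZ // (@dhomogM _ _ _ 1 _ 1) ?dhomogXU.
  rewrite mxE /fm /cross; elim/ord3P: i; rewrite !t3E rpredB //;
  by rewrite (@dhomogM _ _ _ 2 _ 1) ?dhomogXU.
under eq_bigr => i _ do rewrite mxE.
exact: cross_dot.
Qed.

Lemma euler (n d : nat) (p : {mpoly C[n]}) :
  p \is d.-homog -> \sum_i 'X_i * p^`M(i) = d%:R *: p.
Proof.
move=> /dhomogP hp; rewrite (mpolyE p).
transitivity (\sum_(m <- msupp p) p@_m *: \sum_i 'X_i * ('X_[m] : {mpoly C[n]})^`M(i)).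
  under [RHS]eq_bigr => m _ do rewrite scaler_sumr.
  rewrite exchange_big /=; apply: eq_bigr => i _.
  rewrite raddf_sum mulr_sumr; apply: eq_bigr => m _ /=.
  by rewrite mderivZ scalerAr.
rewrite scaler_sumr; apply: eq_big_seq => m /hp dm.
rewrite scalerA mulrC -scalerA; congr (_ *: _).
transitivity (\sum_i (m i)%:R *: ('X_[m] : {mpoly C[n]})).
  apply: eq_bigr => i _; rewrite mderivX -scalerAr.
  have [->|mi] := posnP (m i); first by rewrite !scale0r.
  rewrite -mpolyXD; congr (_ *: 'X_[_]).
  apply/mnmP => j; rewrite !mnmE; case: eqP => [<-|_]; lia.
by rewrite -scaler_suml -dm /= mdegE natr_sum.
Qed.

Lemma dhomog_mderiv (n d : nat) (p : {mpoly C[n]}) i :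
  p \is d.+1.-homog -> p^`M(i) \is d.-homog.
Proof.
move=> /dhomogP hp; apply/dhomogP => m; rewrite mcoeff_msupp mcoeff_deriv => pm.
have /hp : (m + U_(i))%MM \in msupp p.
  by apply: contraNT pm => /memN_msupp_eq0->; rewrite mul0rn.
by rewrite /= mdegD mdeg1 addn1 => -[].
Qed.

Lemma dhomog0C (n : nat) (p : {mpoly C[n]}) : p \is 0.-homog -> p = (p@_0)%:MP.
Proof.
move=> hp; apply/mpolyP => m; rewrite mcoeffC.
have [->|m0] := eqVneq m 0%MM; first by rewrite mulr1.
by rewrite mulr0 (dhomog_nemf_coeff hp) // mdeg_eq0.
Qed.

Definition curl w : 'I_3 -> {mpoly C[3]} :=
  t3 ((w 0 2)^`M(1) - (w 0 1)^`M(2)) ((w 0 0)^`M(2) - (w 0 2)^`M(0))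
     ((w 0 1)^`M(0) - (w 0 0)^`M(1)).

(** The factor 1/8 is 1/4 * 1/2: a divergence-free quadratic V satisfies
    curl (V x X) = 4 V (with the sign conventions used here), and the Hessian of
    a quadratic form is twice its matrix. *)
Definition tens w i : 'M[C]_3 :=
  \matrix_(j, k) (8^-1 * ((curl w i)^`M(j)^`M(k))@_0).

Lemma curl_homog w i : is_form w -> curl w i \is 2.-homog.
Proof.
by case=> hw _; elim/ord3P: i; rewrite /curl !t3E rpredB // dhomog_mderiv.
Qed.

Lemma vf_tens w i : is_form w ->
  vf (fun l => map_mx (@mpolyC 3 C) (tens w l)) (fun k => 'X_k) i
    = 4^-1 *: curl w i.
Proof.
move=> fw; have hc := curl_homog i fw.
have E2 : \sum_j \sum_k 'X_j * 'X_k * (curl w i)^`M(j)^`M(k) = 2 *: curl w i.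
  rewrite -(euler hc); apply: eq_bigr => j _.
  rewrite -[RHS]scale1r -[1]/(1%:R) scalerAr -(euler (dhomog_mderiv j hc)).
  by rewrite mulr_sumr; apply: eq_bigr => k _; rewrite mulrA.
have -> : 4^-1 = 8^-1 * 2 :> C by field.
rewrite -scalerA -E2 scaler_sumr /vf; apply: eq_bigr => j _.
rewrite scaler_sumr; apply: eq_bigr => k _; rewrite !mxE.
rewrite [in RHS](dhomog0C (dhomog_mderiv k (dhomog_mderiv j hc))).
by rewrite -!mul_mpolyC mpolyCM; ring.
Qed.

(** The coefficients of w are recovered from curl w x X by Euler's identity and
    by the derivatives of the relation \sum_i w_i X_i = 0. *)
Lemma form_of_tens w : is_form w -> form_of (tens w) = w.
Proof.
move=> fw; have [hw w0] := fw.
suff E i : cross (curl w) (fun k => 'X_k) i = 4 *: w 0 i.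
  apply/rowP => i; rewrite mxE.
  have -> : w 0 i = 4^-1 *: (4 *: w 0 i).
    by rewrite scalerA mulVf ?scale1r // pnatr_eq0.
  rewrite -E /fm /cross; elim/ord3P: i; rewrite !t3E !vf_tens //;
    by rewrite -!scalerAl -scalerBr.
have E3 j : \sum_i 'X_i * (w 0 i)^`M(j) = - w 0 j.
  apply/eqP; rewrite -addr_eq0; apply/eqP.
  have := congr1 (mderiv j) w0; rewrite raddf_sum mderiv0 => w0j.
  rewrite -[RHS]w0j; have -> : w 0 j = \sum_i w 0 i * ('X_i : {mpoly C[3]})^`M(j).
    rewrite (bigD1 j) //= big1 ?addr0 => [|k /negPf kj].
      rewrite mderivX mnmE eqxx scale1r (_ : (U_(j) - U_(j))%MM = 0%MM).
        by rewrite mpolyX0 mulr1.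
      by apply/mnmP => l; rewrite !mnmE subnn.
    by rewrite mderivX mnmE kj scale0r mulr0.
  rewrite -big_split; apply: eq_bigr => l _ /=.
  by rewrite mderivM; congr (_ + _); rewrite mulrC.
have := euler (hw i); have := E3 i; rewrite !sum3 /cross /curl.
move=> E3i Ei; have -> : 4 *: w 0 i = 3%:R *: w 0 i - (- w 0 i).
  by rewrite opprK -[X in _ + X]scale1r -scalerDl; congr (_ *: _); ring.
rewrite -E3i -Ei; elim/ord3P: i {E3i Ei}; rewrite !t3E; ring.
Qed.

(** Symmetry, and vanishing divergence of [vf T]. *)
Definition normal T :=
  (forall i j k, T i j k = T i k j) /\ (forall k, \sum_i T i i k = 0).

Lemma tens_normal w : normal (tens w).
Proof.
split=> [i j k|k]; first by rewrite !mxE mderiv_comm.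
under eq_bigr => i _ do rewrite mxE.
rewrite -mulr_sumr; apply/eqP; rewrite mulf_eq0; apply/orP; right; apply/eqP.
have E : \sum_i (curl w i)^`M(i) = 0.
  rewrite sum3 /curl !t3E !mderivB.
  rewrite (mderiv_comm 1 0) (mderiv_comm 2 0) (mderiv_comm 2 1); ring.
have := congr1 (mderiv k) E; rewrite raddf_sum mderiv0.
by move/(congr1 (mcoeff 0%MM)); rewrite raddf_sum mcoeff0.
Qed.

End Forms.

(** * The trace-free tensor of a form, and orbits *)

Section LinearCombination.
Variable R : pzRingType.
Implicit Types a b l r : R.

Lemma eqD l r l' r' : l = r -> l' = r' -> l + l' = r + r'.
Proof. by move=> -> ->. Qed.

Lemma eqZ k l r : l = r -> k * l = k * r. Proof. by move=> ->. Qed.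

(** Proves [a = b] by exhibiting it as a linear combination [l = r], built with
    [eqD] and [eqZ], of known equations; what remains is a polynomial identity. *)
Lemma by_eq a b l r : l = r -> a - b = l - r -> a = b.
Proof. by move=> ->; rewrite subrr => /eqP; rewrite subr_eq0 => /eqP. Qed.

End LinearCombination.

Section Tensors.
Variable C : numClosedFieldType.
Implicit Types (w : oneform C 3) (M N A : 'M[C]_3) (T : 'I_3 -> 'M[C]_3).
Implicit Types (x : 'I_3 -> C).

Lemma nat_neq0 (n : nat) : n.+1%:R != 0 :> C.
Proof. by rewrite pnatr_eq0. Qed.

Lemma mulf_natI (n : nat) (a b : C) : n.+1%:R * a = n.+1%:R * b -> a = b.
Proof. exact: (mulfI (nat_neq0 n)). Qed.

Definition symmetric T := forall i j k, T i j k = T i k j.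

Lemma vfE T x i : symmetric T ->
  vf T x i = T i 0 0 * x 0 ^+ 2 + T i 1 1 * x 1 ^+ 2 + T i 2 2 * x 2 ^+ 2
    + 2 * (T i 0 1 * (x 0 * x 1) + T i 0 2 * (x 0 * x 2) + T i 1 2 * (x 1 * x 2)).
Proof.
move=> sT; rewrite /vf !sum3 (sT i 1 0) (sT i 2 0) (sT i 2 1); ring.
Qed.

(** If V x X = 0, then V is a multiple f X of the radial field; its divergence
    is 4 f, hence f = 0.  The multiple is read off from values at a few points. *)
Lemma fm_inj T :
  normal T -> (forall x i, fm T x i = 0) -> forall i j k, T i j k = 0.
Proof.
move=> [sT tT] T0.
pose q i a b c := T i 0 0 * a ^+ 2 + T i 1 1 * b ^+ 2 + T i 2 2 * c ^+ 2
  + 2 * (T i 0 1 * (a * b) + T i 0 2 * (a * c) + T i 1 2 * (b * c)).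
have E0 a b c : q 1 a b c * c - q 2 a b c * b = 0.
  by have := T0 (t3 a b c) 0; rewrite /fm /cross !vfE // !t3E.
have E1 a b c : q 2 a b c * a - q 0 a b c * c = 0.
  by have := T0 (t3 a b c) 1; rewrite /fm /cross !vfE // !t3E.
have E2 a b c : q 0 a b c * b - q 1 a b c * a = 0.
  by have := T0 (t3 a b c) 2; rewrite /fm /cross !vfE // !t3E.
have t0 := tT 0; have t1 := tT 1; have t2 := tT 2; rewrite !sum3 in t0 t1 t2.
rewrite (sT 1 1 0) (sT 2 2 0) in t0; rewrite (sT 2 2 1) in t1.
have T122 : T 1 2 2 = 0 by apply: (by_eq (E0 0 0 1)); rewrite /q; ring.
have T022 : T 0 2 2 = 0.
  by apply: (by_eq (eqZ (-1) (E1 0 0 1))); rewrite /q; ring.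
have T011 : T 0 1 1 = 0 by apply: (by_eq (E2 0 1 0)); rewrite /q; ring.
have T211 : T 2 1 1 = 0.
  by apply: (by_eq (eqZ (-1) (E0 0 1 0))); rewrite /q; ring.
have T200 : T 2 0 0 = 0 by apply: (by_eq (E1 1 0 0)); rewrite /q; ring.
have T100 : T 1 0 0 = 0.
  by apply: (by_eq (eqZ (-1) (E2 1 0 0))); rewrite /q; ring.
have T012 : T 0 1 2 = 0.
  apply: (@mulf_natI 1); have := E1 0 1 1; rewrite /q T011 T022 => e.
  by apply: (by_eq (eqZ (-1) e)); ring.
have T102 : T 1 0 2 = 0.
  apply: (@mulf_natI 1); have := E0 1 0 1; rewrite /q T122 T100 => e.
  by apply: (by_eq e); ring.
have T201 : T 2 0 1 = 0.
  apply: (@mulf_natI 1); have := E1 1 1 0; rewrite /q T200 T211 => e.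
  by apply: (by_eq e); ring.
have d01 : T 0 0 0 = 2 * T 1 0 1 /\ T 1 1 1 = 2 * T 0 0 1.
  have := E2 1 1 0; have := E2 1 (-1) 0; rewrite /q T100 T011 => e f.
  split; apply: (@mulf_natI 1).
    by apply: (by_eq (eqD f (eqZ (-1) e))); ring.
  by apply: (by_eq (eqD (eqZ (-1) f) (eqZ (-1) e))); ring.
have d02 : T 0 0 0 = 2 * T 2 0 2 /\ T 2 2 2 = 2 * T 0 0 2.
  have := E1 1 0 1; have := E1 1 0 (-1); rewrite /q T200 T022 => e f.
  split; apply: (@mulf_natI 1).
    by apply: (by_eq (eqD e (eqZ (-1) f))); ring.
  by apply: (by_eq (eqD f e)); ring.
have d12 : T 1 1 1 = 2 * T 2 1 2 /\ T 2 2 2 = 2 * T 1 1 2.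
  have := E0 0 1 1; have := E0 0 1 (-1); rewrite /q T122 T211 => e f.
  split; apply: (@mulf_natI 1).
    by apply: (by_eq (eqD f (eqZ (-1) e))); ring.
  by apply: (by_eq (eqD (eqZ (-1) f) (eqZ (-1) e))); ring.
have T000 : T 0 0 0 = 0.
  apply: (@mulf_natI 1).
  by apply: (by_eq (eqD t0 (eqD (eqZ (1/2) d01.1) (eqZ (1/2) d02.1)))); field.
have T111 : T 1 1 1 = 0.
  apply: (@mulf_natI 1).
  by apply: (by_eq (eqD t1 (eqD (eqZ (1/2) d01.2) (eqZ (1/2) d12.1)))); field.
have T222 : T 2 2 2 = 0.
  apply: (@mulf_natI 1).
  by apply: (by_eq (eqD t2 (eqD (eqZ (1/2) d02.2) (eqZ (1/2) d12.2)))); field.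
have half (a b : C) : b = 0 -> b = 2 * a -> a = 0.
  by move=> -> e; apply: (@mulf_natI 1); rewrite mulr0.
move: (d01.1) (d01.2) (d02.1) (d02.2) (d12.1) (d12.2).
move=> /(half _ _ T000) T101 /(half _ _ T111) T001 /(half _ _ T000) T202.
move=> /(half _ _ T222) T002 /(half _ _ T111) T212 /(half _ _ T222) T112.
by do 3!elim/ord3P; rewrite // sT.
Qed.

Lemma fm_eq T x y i : x =1 y -> fm T x i = fm T y i.
Proof.
move=> xy; apply: cross_eq => // l; rewrite /vf.
by apply: eq_bigr => j _; apply: eq_bigr => k _; rewrite !xy.
Qed.

Lemma vf_scale T t x i : vf T (fun l => t * x l) i = t ^+ 2 * vf T x i.
Proof.
rewrite /vf mulr_sumr; apply: eq_bigr => j _; rewrite mulr_sumr.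
by apply: eq_bigr => k _; ring.
Qed.

Lemma fm_scale T t x i : fm T (fun l => t * x l) i = t ^+ 3 * fm T x i.
Proof.
rewrite /fm (cross_eq _ (vf_scale T t x) (frefl _)).
by elim/ord3P: i; rewrite /cross !t3E; ring.
Qed.

Lemma vf_lin (I : finType) (a : I -> C) (F : I -> 'I_3 -> 'M[C]_3) T x i :
  (forall l, T l = \sum_s a s *: F s l) ->
  vf T x i = \sum_s a s * vf (F s) x i.
Proof.
move=> ET; rewrite /vf; under [RHS]eq_bigr => s _ do rewrite mulr_sumr.
rewrite [RHS]exchange_big; apply: eq_bigr => j _ /=.
under [RHS]eq_bigr => s _ do rewrite mulr_sumr.
rewrite [RHS]exchange_big; apply: eq_bigr => k _ /=.
by rewrite ET summxE !mulr_suml; apply: eq_bigr => s _; rewrite mxE !mulrA.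
Qed.

Lemma fm_lin (I : finType) (a : I -> C) (F : I -> 'I_3 -> 'M[C]_3) T x i :
  (forall l, T l = \sum_s a s *: F s l) ->
  fm T x i = \sum_s a s * fm (F s) x i.
Proof.
move=> ET; rewrite /fm (cross_eq _ (fun l => vf_lin x l ET) (frefl x)).
elim/ord3P: i; rewrite /cross !t3E !mulr_suml -sumrB;
  by apply: eq_bigr => s _; rewrite ?t3E; ring.
Qed.

Lemma tens_form_of T : normal T -> forall i, tens (form_of T) i = T i.
Proof.
move=> nT i; apply/matrixP => j k; apply/eqP; rewrite -subr_eq0; apply/eqP.
pose D l := tens (form_of T) l - T l.
suff /(_ i j k) : forall i j k, D i j k = 0 by rewrite !mxE.
have [sS tS] := tens_normal (form_of T); have [sT tT] := nT.
apply: fm_inj => [|x l].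
  split=> [a b c|c]; first by rewrite !mxE [T a b c]sT mderiv_comm.
  transitivity (\sum_a (tens (form_of T) a a c - T a a c)).
    by apply: eq_bigr => a _; rewrite !mxE.
  by rewrite sumrB tS tT subrr.
pose a (b : bool) : C := if b then 1 else -1.
pose F (b : bool) := if b then tens (form_of T) else T.
rewrite (@fm_lin _ a F) => [|b]; last by rewrite big_bool scale1r scaleN1r.
rewrite big_bool /= mul1r mulN1r -!ev_form_of.
by rewrite form_of_tens ?subrr //; apply: form_of_is_form.
Qed.

Lemma act_normal M T : normal T -> normal (act M T).
Proof.
move=> [sT tT]; split=> [i j k|k].
  rewrite !actE; apply: eq_bigr => l _; congr (_ * _); rewrite exchange_big.
  by apply: eq_bigr => m _; apply: eq_bigr => n _; rewrite sT; ring.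
under eq_bigr => i _ do rewrite actE.
rewrite exchange_big /=.
transitivity (\sum_l \sum_m (M *m adj3 M) m l * \sum_n T l m n * M n k).
  apply: eq_bigr => l _; under eq_bigr => i _ do rewrite mulr_sumr.
  rewrite exchange_big; apply: eq_bigr => m _ /=.
  rewrite mxE mulr_suml; apply: eq_bigr => i _.
  by rewrite !mulr_sumr; apply: eq_bigr => n _; ring.
rewrite mul_adj3.
transitivity (det3 M * \sum_l \sum_n T l l n * M n k).
  rewrite mulr_sumr; apply: eq_bigr => l _; rewrite (bigD1 l) //= [X in _ + X]big1 => [|m ml].
    by rewrite addr0 mxE eqxx mulr1n.
  by rewrite mxE (negPf ml) mulr0n mul0r.
rewrite exchange_big big1 ?mulr0 //= => n _.
by rewrite -mulr_suml tT mul0r.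
Qed.

Lemma tens_pullback M w i :
  is_form w -> tens (pullback (linear_map M) w) i = act M (tens w) i.
Proof.
move=> fw; rewrite -{1}(form_of_tens fw) pullback_form_of tens_form_of //.
exact/act_normal/tens_normal.
Qed.

Lemma is_form_pullback M w : is_form w -> is_form (pullback (linear_map M) w).
Proof.
move=> fw; rewrite -(form_of_tens fw) pullback_form_of; exact: form_of_is_form.
Qed.

(** The components of [w] have degree 3, and each dX_i contributes one more
    factor. *)
Lemma pullback_scalar (t : C) w : is_form w ->
  pullback (linear_map t%:M) w = (t ^+ 4)%:MP *: (w : 'rV_3).
Proof.
move=> fw; apply: ev_inj => x j; rewrite ev_pullback.
transitivity (t ^+ 4 * ev w x j); last by rewrite /ev mxE mevalM mevalC.
rewrite -(form_of_tens fw) (bigD1 j) //= big1 => [|i /negPf ij].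
  rewrite mxE eqxx mulr1n addr0 !ev_form_of.
  have E l : mapv t%:M x l = t * x l.
    rewrite /mapv (bigD1 l) //= big1 => [|i /negPf il].
      by rewrite mxE eqxx mulr1n addr0.
    by rewrite mxE eq_sym il mulr0n mul0r.
  by rewrite (fm_eq _ _ E) fm_scale mulrAC -exprSr.
by rewrite mxE ij mulr0n mulr0.
Qed.

Lemma pullback_scale M (c : C) w :
  pullback (linear_map M) (c%:MP *: (w : 'rV_3)) =
  c%:MP *: (pullback (linear_map M) w : 'rV_3).
Proof.
apply: ev_inj => x j.
transitivity (c * ev (pullback (linear_map M) w) x j).
  rewrite !ev_pullback mulr_sumr; apply: eq_bigr => i _.
  by rewrite /ev mxE mevalM mevalC mulrA.
by rewrite /ev [in RHS]mxE mevalM mevalC.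
Qed.

(** A scalar c is absorbed by pulling back by a fourth root of c. *)
Lemma PGL3_orbitE w w' : is_form w ->
  PGL3_orbit w w' <-> exists2 M, M \in unitmx & w' = pullback (linear_map M) w.
Proof.
move=> fw; split=> [[M uM [c c0 ->]]|[M uM ->]]; last first.
  by exists M => //; exists 1; rewrite ?oner_eq0 // mpolyC1 scale1r.
pose t := 4.-root c; have t4 : t ^+ 4 = c by rewrite rootCK.
have t0 : t != 0 by apply: contraNneq c0 => t0; rewrite -t4 t0 expr0n.
exists (M *m t%:M).
  by rewrite unitmx_mul uM unitmxE det_scalar unitfE expf_neq0.
by rewrite -pullback_comp pullback_scalar ?t4 //; apply: is_form_pullback.
Qed.

Lemma orbit_refl w : PGL3_orbit w w.
Proof.
exists 1%:M; first exact: unitmx1.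
by exists 1; rewrite ?oner_eq0 // mpolyC1 scale1r pullback1.
Qed.

Lemma orbit_pullback M w : M \in unitmx ->
  PGL3_orbit w (pullback (linear_map M) w).
Proof.
by exists M => //; exists 1; rewrite ?oner_eq0 // mpolyC1 scale1r.
Qed.

Lemma orbit_trans w w' w'' : is_form w ->
  PGL3_orbit w w' -> PGL3_orbit w' w'' -> PGL3_orbit w w''.
Proof.
move=> fw /(PGL3_orbitE _ fw)[M uM ->].
move=> /(PGL3_orbitE _ (is_form_pullback M fw))[N uN ->].
by rewrite pullback_comp; apply: orbit_pullback; rewrite unitmx_mul uM.
Qed.

Lemma orbit_sym w w' : is_form w -> PGL3_orbit w w' -> PGL3_orbit w' w.
Proof.
move=> fw /(PGL3_orbitE _ fw)[M uM ->].
rewrite -[X in PGL3_orbit _ X]pullback1 -(mulmxV uM) -pullback_comp.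
by apply: orbit_pullback; rewrite unitmx_inv.
Qed.

Lemma orbit_is_form w w' : is_form w -> PGL3_orbit w w' -> is_form w'.
Proof.
by move=> fw /(PGL3_orbitE _ fw)[M uM ->]; apply: is_form_pullback.
Qed.

Lemma orbit_eqP w w' : is_form w -> PGL3_orbit w w' ->
  forall G, PGL3_orbit w' G <-> PGL3_orbit w G.
Proof.
move=> fw ww' G; split=> [|wG]; first exact: orbit_trans ww'.
apply: orbit_trans wG; first exact: orbit_is_form ww'.
exact: orbit_sym.
Qed.

Lemma foliation_pullback M w :
  M \in unitmx -> foliation 2 w -> foliation 2 (pullback (linear_map M) w).
Proof.
move=> uM fw; have [h1 h2] := is_form_pullback M (foliation_is_form fw).
split=> // p dp; have [_ _ ndw] := fw.
pose N := invmx M; pose s := linear_map N.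
have Mw i : w 0 i = \sum_j comp_mpoly s (pullback (linear_map M) w 0 j)
                      * (N j i)%:MP.
  rewrite -{1}(pullback1 w) -(mulmxV uM) -pullback_comp mxE.
  by apply: eq_bigr => j _; rewrite linear_map_deriv.
have sM : comp_mpoly (linear_map M) (comp_mpoly s p) = p.
  apply: mpoly_eval_eq => v; rewrite !comp_mpoly_meval; apply: meval_eq => i.
  rewrite linear_map_eval -[RHS]mapv1 -(mulVmx uM) -mapv_mul.
  by apply: eq_bigr => j _; rewrite linear_map_eval.
have : comp_mpoly s p \is a GRing.unit.
  apply: ndw => i.
  have /fin_all_exists[q Eq] := dp.
  exists (\sum_j comp_mpoly s (q j) * (N j i)%:MP).
  rewrite Mw mulr_suml; apply: eq_bigr => j _.
  by rewrite Eq rmorphM /= mulrAC.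
by move=> us; rewrite -sM; apply: rmorph_unit.
Qed.

End Tensors.

(** * The orbit map and its differential *)

Section OrbitPolynomials.
Variable C : numClosedFieldType.
Implicit Types (w : oneform C 3) (M N A : 'M[C]_3) (T : 'I_3 -> 'M[C]_3).
Implicit Types (x : 'I_3 -> C).

Local Notation Nc := #|coef_index 2|.
Local Notation coefs w := (@form_coef C 2 w).

Lemma form_msize w i : is_form w -> (msize (w 0%R i) <= 4)%N.
Proof.
move=> [hw _]; rewrite msizeE; apply/bigmax_leqP_seq => m mi _.
by have /dhomogP/(_ _ mi)/= -> := hw i.
Qed.

Lemma big_enum_val_fin (I : finType) (F : I -> C) :
  \sum_(k < #|I|) F (enum_val k) = \sum_s F s.
Proof.
rewrite (reindex (@enum_rank I)); last exact/onW_bij/enum_rank_bij.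
by apply: eq_bigr => s _; rewrite enum_rankK.
Qed.

(** Forms of degree 3 have no coefficients outside [coef_index 2], so that these
    coefficients express every linear functional. *)
Lemma linear_coord (L : 'I_3 -> {mpoly C[3]} -> C) :
  (forall i p q, L i (p + q) = L i p + L i q) ->
  (forall i c p, L i (c *: p) = c * L i p) ->
  exists p : {mpoly C[Nc]},
    forall w, is_form w -> p.@[coefs w] = \sum_i L i (w 0 i).
Proof.
move=> LD LZ.
pose F (s : coef_index 2) := L s.1 'X_[(s.2 : 'X_{1..3 < 4})].
exists (\sum_(k < Nc) F (enum_val k) *: 'X_k) => w fw; rewrite raddf_sum /=.
under eq_bigr => k _ do rewrite mevalZ mevalXU /form_coef.
rewrite (big_enum_val_fin (fun s : coef_index 2 =>
  F s * (w 0 s.1)@_(s.2 : 'X_{1..3 < 4}))).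
rewrite -(pair_bigA _ (fun i (m : 'X_{1..3 < 4}) => L i 'X_[m] * (w 0 i)@_m)) /=.
apply: eq_bigr => i _; rewrite [in RHS](mpolywE (form_msize i fw)).
have L0 : L i 0 = 0 by rewrite -(scale0r 0) LZ mul0r.
rewrite (big_morph _ (LD i) L0); apply: eq_bigr => m _.
by rewrite LZ mulrC.
Qed.

Lemma tensD w w' i j k : tens (w + w' : 'rV_3) i j k = tens w i j k + tens w' i j k.
Proof.
rewrite !mxE -mulrDr -raddfD -!mderivD; congr (8^-1 * (mderiv _ (mderiv _ _))@_0).
by elim/ord3P: i; rewrite /curl !t3E !mxE !mderivD; ring.
Qed.

Lemma tensZ c w i j k :
  tens (c%:MP *: (w : 'rV_3)) i j k = c * tens w i j k.
Proof.
have curlZ : curl (c%:MP *: (w : 'rV_3)) i = c *: curl w i.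
  by elim/ord3P: i; rewrite /curl !t3E !mxE !mul_mpolyC !mderivZ scalerBr.
by rewrite !mxE curlZ !mderivZ mcoeffZ mulrCA.
Qed.

Lemma tens_coord : exists p : 'I_3 -> 'I_3 -> 'I_3 -> {mpoly C[Nc]},
  forall w i j k, is_form w -> (p i j k).@[coefs w] = tens w i j k.
Proof.
pose L i j k l (p : {mpoly C[3]}) := tens (p *: delta_mx 0 l) i j k.
have /fin_all_exists[p Ep] : forall s : 'I_3 * 'I_3 * 'I_3,
    exists p : {mpoly C[Nc]}, forall w, is_form w ->
      p.@[coefs w] = tens w s.1.1 s.1.2 s.2.
  case=> -[i j] k; have [||p Ep] := @linear_coord (L i j k).
  - by move=> l p q; rewrite -[RHS]tensD -scalerDl.
  - move=> l c p; rewrite -[RHS]tensZ /L; congr (tens _ i j k).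
    by rewrite scalerA mul_mpolyC.
  exists p => w fw; rewrite Ep // sum3 /L -!tensD.
  by congr (tens _ i j k); rewrite [RHS](row_sum_delta w) sum3.
exists (fun i j k => p (i, j, k)) => w i j k fw.
exact: (Ep (i, j, k)).
Qed.

Definition delta3 (s : 'I_3 * 'I_3 * 'I_3) (l : 'I_3) : 'M[C]_3 :=
  (l == s.1.1)%:R *: delta_mx s.1.2 s.2.

Lemma delta3_sum T l : T l = \sum_s T s.1.1 s.1.2 s.2 *: delta3 s l.
Proof.
apply/matrixP => j k; rewrite summxE (bigD1 (l, j, k)) //= big1 ?addr0.
  by rewrite !mxE !eqxx !mulr1.
case=> -[l' j'] k' /=; rewrite !xpair_eqE !mxE /=.
by rewrite [l == _]eq_sym [j == _]eq_sym [k == _]eq_sym;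
  case: (l' == l); case: (j' == j); case: (k' == k) => //= _;
  rewrite ?(mulr0, mul0r).
Qed.

Lemma coefs_form_of T k :
  coefs (form_of T) k =
  \sum_s T s.1.1 s.1.2 s.2 * coefs (form_of (delta3 s)) k.
Proof.
have E x i : ev (form_of T) x i =
    \sum_s T s.1.1 s.1.2 s.2 * ev (form_of (delta3 s)) x i.
  transitivity (fm T x i); first exact: ev_form_of.
  rewrite (fm_lin x i (delta3_sum T)); apply: eq_bigr => s _.
  by congr (_ * _); rewrite ev_form_of.
rewrite /form_coef; move: (enum_val k) => {k} [i m] /=.
transitivity ((\sum_s T s.1.1 s.1.2 s.2 *: form_of (delta3 s) 0 i)@_m).
  congr (_@_m); apply: mpoly_eval_eq => x; rewrite raddf_sum.
  apply: etrans (E x i) _; apply: eq_bigr => s _.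
  by symmetry; apply: mevalZ.
by rewrite raddf_sum; apply: eq_bigr => s _; apply: mcoeffZ.
Qed.

Definition generic_mx : 'M[{mpoly C[3 * 3]}]_3 :=
  \matrix_(i, j) 'X_(mxvec_index i j).

Definition generic_act T i : 'M[{mpoly C[3 * 3]}]_3 :=
  act generic_mx (fun l => map_mx (@mpolyC (3 * 3) C) (T l)) i.

(** A matrix as a point of affine space, in the coordinates that define the
    tangent space of a subgroup of GL_3. *)
Definition pt M : 'I_(3 * 3) -> C := fun k => mxvec M 0 k.

Lemma pt_surj (v : 'I_(3 * 3) -> C) : exists M, v =1 pt M.
Proof.
by exists (vec_mx (\row_k v k)) => k; rewrite /pt vec_mxK mxE.
Qed.

Lemma generic_mx_eval M : map_mx (meval (pt M)) generic_mx = M.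
Proof. by apply/matrixP => i j; rewrite !mxE mevalXU /pt mxvecE. Qed.

Lemma generic_act_eval T M i j k :
  (generic_act T i j k).@[pt M] = act M T i j k.
Proof.
have := map_act (meval (pt M)) generic_mx (fun l => map_mx (@mpolyC (3 * 3) C) (T l)) i.
rewrite generic_mx_eval => /matrixP/(_ j k); rewrite [LHS]mxE => ->.
rewrite !actE; apply: eq_bigr => l _; congr (_ * _).
by apply: eq_bigr => m _; apply: eq_bigr => n _; rewrite !mxE /= mevalC.
Qed.

Lemma generic_det_neq0 : det3 generic_mx != 0.
Proof.
apply/eqP => /(congr1 (meval (pt 1%:M))); rewrite det3E -det_map_mx.
by rewrite generic_mx_eval det1 meval0 => /eqP; rewrite oner_eq0.
Qed.

Lemma generic_det_eval M : (det3 generic_mx).@[pt M] = \det M.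
Proof. by rewrite det3E -det_map_mx generic_mx_eval. Qed.

(** The polynomial map whose values on invertible matrices are the coefficients
    of the forms of the orbit. *)
Definition orbit_coefs w : Nc.-tuple {mpoly C[3 * 3]} :=
  [tuple \sum_s coefs (form_of (delta3 s)) k
           *: generic_act (tens w) s.1.1 s.1.2 s.2 | k < Nc].

Lemma orbit_coefs_eval w M k : is_form w ->
  (tnth (orbit_coefs w) k).@[pt M] = coefs (pullback (linear_map M) w) k.
Proof.
move=> fw; rewrite tnth_mktuple raddf_sum.
transitivity (coefs (form_of (act M (tens w))) k); last first.
  by rewrite -pullback_form_of form_of_tens.
apply/esym; apply: (etrans (coefs_form_of (act M (tens w)) k)).
apply: eq_bigr => s _.
rewrite -generic_act_eval.
rewrite mulrC.
apply/esym.
exact: mevalZ.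
Qed.

Definition vanishes_on (W : oneform C 3 -> Prop) (P : {mpoly C[Nc]}) :=
  forall w, W w -> P.@[coefs w] = 0.

Lemma comp_orbit_coefs_eval w M (P : {mpoly C[Nc]}) : is_form w ->
  (P \mPo orbit_coefs w).@[pt M] = P.@[coefs (pullback (linear_map M) w)].
Proof.
move=> fw; rewrite comp_mpoly_meval; apply: meval_eq => k.
exact: orbit_coefs_eval.
Qed.

(** Invertible matrices are Zariski dense. *)
Lemma vanishes_on_orbit w P : is_form w ->
  vanishes_on (PGL3_orbit w) P <-> P \mPo orbit_coefs w = 0.
Proof.
move=> fw; split=> [P0|P0 w' /(PGL3_orbitE _ fw)[M uM ->]]; last first.
  by rewrite -comp_orbit_coefs_eval // P0 meval0.
apply: (mpoly_eval_dense generic_det_neq0) => v; have [M /meval_eq vM] := pt_surj v.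
rewrite !vM generic_det_eval comp_orbit_coefs_eval // => dM.
by apply: P0; apply: orbit_pullback; rewrite unitmxE unitfE.
Qed.

Definition dder A (p : {mpoly C[3 * 3]}) : C :=
  \sum_k mxvec A 0 k * (p^`M(k)).@[pt 1%:M].

Lemma dderD A p q : dder A (p + q) = dder A p + dder A q.
Proof.
by rewrite -big_split; apply: eq_bigr => k _; rewrite mderivD mevalD mulrDr.
Qed.

Lemma dderC A c : dder A c%:MP = 0.
Proof. by rewrite /dder big1 // => k _; rewrite mderivC meval0 mulr0. Qed.

Lemma dderM A p q :
  dder A (p * q) = dder A p * q.@[pt 1%:M] + p.@[pt 1%:M] * dder A q.
Proof.
rewrite mulr_suml mulr_sumr -big_split; apply: eq_bigr => k _ /=.
by rewrite mderivM mevalD !mevalM; ring.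
Qed.

Lemma dderCM A c q : dder A (c%:MP * q) = c * dder A q.
Proof. by rewrite dderM dderC mevalC mul0r add0r. Qed.

Lemma dderB A p q : dder A (p - q) = dder A p - dder A q.
Proof. by rewrite dderD -mulN1r -mpolyC1 -mpolyCN dderCM mulN1r. Qed.

Lemma dder_sum (I : finType) A (F : I -> {mpoly C[3 * 3]}) :
  dder A (\sum_i F i) = \sum_i dder A (F i).
Proof.
apply: (big_morph (dder A) (dderD A)).
by rewrite -(mpolyC0 (3 * 3)) dderC.
Qed.

Lemma dder_generic A i j : dder A (generic_mx i j) = A i j.
Proof.
rewrite mxE /dder (bigD1 (mxvec_index i j)) //= big1 ?addr0 => [|k ki].
  rewrite mxvecE mderivX mnmE eqxx scale1r.
  rewrite (_ : (U_(mxvec_index i j) - U_(mxvec_index i j))%MM = 0%MM).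
    by rewrite mpolyX0 meval1 mulr1.
  by apply/mnmP => l; rewrite !mnmE subnn.
by rewrite mderivX mnmE eq_sym (negPf ki) scale0r meval0 mulr0.
Qed.

Lemma eval_generic1 i j : (generic_mx i j).@[pt 1%:M] = (i == j)%:R.
Proof.
have /matrixP/(_ i j) := generic_mx_eval 1%:M.
by rewrite [LHS]mxE [RHS]mxE => ->.
Qed.

Lemma dder_adj3 A i j : dder A (adj3 generic_mx i j) = (i == j)%:R * \tr A - A i j.
Proof.
rewrite /mxtrace sum3 mxE.
elim/ord3P: i; elim/ord3P: j; rewrite /cross !t3E ?ordE dderB !dderM;
  by rewrite !eval_generic1 !dder_generic /=; ring.
Qed.

Lemma eval_adj3_1 i j : (adj3 generic_mx i j).@[pt 1%:M] = (i == j)%:R.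
Proof.
rewrite mxE; elim/ord3P: i; elim/ord3P: j; rewrite /cross !t3E ?ordE mevalB !mevalM;
  by rewrite !eval_generic1 /=; ring.
Qed.

Lemma sum_deltal (F : 'I_3 -> C) i : \sum_l (i == l)%:R * F l = F i.
Proof.
rewrite (bigD1 i) //= big1 ?addr0 ?eqxx ?mul1r // => l /negPf li.
by rewrite eq_sym li mul0r.
Qed.

(** The infinitesimal action; the term in the trace comes from adj(M) =
    det(M) M^-1. *)
Definition dact A T i j k := \tr A * T i j k + (\sum_m A m j * T i m k
  + \sum_n T i j n * A n k - \sum_l A i l * T l j k).

Lemma dder_act A T i j k : dder A (generic_act T i j k) = dact A T i j k.
Proof.
rewrite /generic_act actE dder_sum.
under eq_bigr => l _ do rewrite dderM dder_adj3 eval_adj3_1.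
rewrite big_split sum_deltal /=.
transitivity (\sum_l ((i == l)%:R * \tr A - A i l) * T l j k +
  (\sum_m A m j * T i m k + \sum_n T i j n * A n k)); last first.
  rewrite /dact; under eq_bigr => l _ do rewrite mulrBl -mulrA.
  by rewrite sumrB sum_deltal; ring.
congr (_ + _).
  apply: eq_bigr => l _; congr (_ * _); rewrite raddf_sum /=.
  under eq_bigr => m _ do rewrite raddf_sum /=.
  transitivity (\sum_m \sum_n (j == m)%:R * (T l m n * (k == n)%:R)).
    apply: eq_bigr => m _; apply: eq_bigr => n _.
    by rewrite !mevalM !eval_generic1 [map_mx _ _ _ _]mxE mevalC mulrA !(eq_sym _ j) !(eq_sym _ k).
  under eq_bigr => m _ do rewrite -mulr_sumr.
  rewrite sum_deltal; under eq_bigr => n _ do rewrite mulrC.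
  by rewrite sum_deltal.
rewrite dder_sum; under eq_bigr => m _ do rewrite dder_sum.
transitivity (\sum_m \sum_n (A m j * (T i m n * (k == n)%:R)
                             + (j == m)%:R * (T i m n * A n k))).
  apply: eq_bigr => m _; apply: eq_bigr => n _.
  rewrite !dderM !mevalM !eval_generic1 !dder_generic [map_mx _ _ _ _]mxE mevalC dderC.
  by rewrite (eq_sym m j) (eq_sym n k); ring.
under eq_bigr => m _ do rewrite big_split -!mulr_sumr.
rewrite big_split sum_deltal /=; congr (_ + _).
apply: eq_bigr => m _; congr (_ * _).
by under eq_bigr => n _ do rewrite mulrC; rewrite sum_deltal.
Qed.

End OrbitPolynomials.

(** * Closures and dimension of orbits *)

Section Closure.
Variable C : numClosedFieldType.
Implicit Types (w u : oneform C 3) (M N A B : 'M[C]_3) (T : 'I_3 -> 'M[C]_3).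

Local Notation Nc := #|coef_index 2|.
Local Notation coefs w := (@form_coef C 2 w).

(** Modulo [l] the substitution [s] is the identity. *)
Lemma subst_divides (n : nat) (l : {mpoly C[n]}) (s : n.-tuple {mpoly C[n]}) :
  (forall i, exists q, 'X_i - tnth s i = q * l) ->
  forall p, exists q, p - (p \mPo s) = q * l.
Proof.
move=> hs p; elim/mpoly_ring_ind: p => [c|i|p q [a Ha] [b Hb]|p q [a Ha] [b Hb]].
- by exists 0; rewrite comp_mpolyC subrr mul0r.
- by have [q Hq] := hs i; exists q; rewrite comp_mpolyXU -tnth_nth.
- by exists (a + b); rewrite comp_mpolyD mulrDl -Ha -Hb opprD addrACA.
exists (a * q + (p \mPo s) * b); rewrite rmorphM /=.
by apply: (by_eq (eqD (eqZ q Ha) (eqZ (p \mPo s) Hb))); ring.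
Qed.

Lemma meval_homog (n d : nat) (p : {mpoly C[n]}) (t : C) (v : 'I_n -> C) :
  p \is d.-homog -> p.@[fun i => t * v i] = t ^+ d * p.@[v].
Proof.
move=> /dhomogP hp; rewrite !mevalE mulr_sumr; apply: eq_big_seq => m /hp /= <-.
under eq_bigr => i _ do rewrite exprMn.
by rewrite big_split /= prodrXr -mdegE mulrCA.
Qed.

Definition in_closure w w' :=
  forall P, vanishes_on (PGL3_orbit w) P -> P.@[coefs w'] = 0.

Lemma coefs_scale (c : C) w k :
  coefs (c%:MP *: (w : 'rV_3)) k = c * coefs w k.
Proof. by rewrite /form_coef mxE mul_mpolyC mcoeffZ. Qed.

Lemma orbit_scale (c : C) w w' :
  c != 0 -> PGL3_orbit w w' -> PGL3_orbit w (c%:MP *: (w' : 'rV_3)).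
Proof.
move=> c0 [M uM [d d0 ->]]; exists M => //; exists (c * d).
  by rewrite mulf_neq0.
by rewrite scalerA mpolyCM.
Qed.

(** An orbit is a cone, so the homogeneous components of a polynomial vanishing
    on it vanish on it too. *)
Lemma homog_in_closure w w' :
  (forall P, (exists d, P \is d.-homog) -> vanishes_on (PGL3_orbit w) P ->
     P.@[coefs w'] = 0) -> in_closure w w'.
Proof.
move=> hw P P0; rewrite (pihomog_partitionE (leqnn (msize P))) raddf_sum.
rewrite big1 // => d _ /=; apply: hw => [|u wu].
  by exists d; apply: pihomogP.
(* The value of P at t u is q(t), which vanishes for t <> 0. *)
pose q := \poly_(e < msize P) (pihomog mdeg e P).@[coefs u].
have q0 : 'X * q = 0.
  apply: poly_eval_eq0 => t; rewrite hornerM hornerX.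
  have [->|t0] := eqVneq t 0; first by rewrite mul0r.
  rewrite horner_poly -[X in t * X]/(\sum_(e < _) _); apply/eqP.
  rewrite mulf_eq0; apply/orP; right; apply/eqP.
  rewrite -[RHS](P0 _ (orbit_scale t0 wu)).
  rewrite (meval_eq _ (coefs_scale t u)).
  rewrite [in RHS](pihomog_partitionE (leqnn (msize P))) raddf_sum.
  apply: eq_bigr => e _; rewrite /= (meval_homog _ _ (pihomogP _ _ _)) mulrC //.
move/eqP: q0; rewrite mulf_eq0 polyX_eq0 /= => /eqP/polyP/(_ d).
by rewrite coef_poly coef0 ltn_ord.
Qed.

(** GL_3 acts by polynomial (indeed linear) maps on coefficients. *)
Lemma pullback_coefs M : exists s : Nc.-tuple {mpoly C[Nc]},
  forall w k, is_form w ->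
    (tnth s k).@[coefs w] = coefs (pullback (linear_map M) w) k.
Proof.
have [p Ep] := tens_coord C.
pose Tp l : 'M[{mpoly C[Nc]}]_3 := \matrix_(j, k) p l j k.
exists [tuple \sum_s coefs (form_of (delta3 C s)) k
           *: act (map_mx (@mpolyC Nc C) M) Tp s.1.1 s.1.2 s.2 | k < Nc].
move=> w k fw; rewrite tnth_mktuple raddf_sum.
transitivity (coefs (form_of (act M (tens w))) k); last first.
  by rewrite -pullback_form_of form_of_tens.
apply/esym/(etrans (coefs_form_of (act M (tens w)) k)).
apply: eq_bigr => -[[i j] l] _; apply/esym/(etrans (mevalZ _ _ _)).
rewrite mulrC; congr (_ * _) => /=.
have /matrixP/(_ j l) := map_act (meval (coefs w)) (map_mx (@mpolyC Nc C) M) Tp i.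
rewrite [LHS]mxE => ->.
have -> : map_mx (meval (coefs w)) (map_mx (@mpolyC Nc C) M) = M.
  by apply/matrixP => a b; rewrite !mxE /= mevalC.
rewrite !actE; apply: eq_bigr => a _; congr (_ * _).
apply: eq_bigr => m _; apply: eq_bigr => n _; congr (_ * _ * _).
by rewrite mxE [Tp _ _ _]mxE; apply: Ep.
Qed.

(** The closure of an orbit is invariant. *)
Lemma in_closure_orbit w w' w'' : is_form w -> is_form w' ->
  in_closure w w' -> PGL3_orbit w' w'' -> in_closure w w''.
Proof.
move=> fw fw' cl /(PGL3_orbitE _ fw')[M uM ->] P P0.
have [s Es] := pullback_coefs M.
have /cl : vanishes_on (PGL3_orbit w) (P \mPo s).
  move=> u wu; have fu := orbit_is_form fw wu.
  rewrite comp_mpoly_meval (meval_eq _ (Es u ^~ fu)).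
  apply: P0; apply: orbit_trans wu _ => //; exact: orbit_pullback.
by rewrite comp_mpoly_meval (meval_eq _ (Es w' ^~ fw')).
Qed.

Definition alg_dependent_on (W : oneform C 3 -> Prop) (m : nat) :=
  forall f : 'I_m -> {mpoly C[Nc]}, exists2 Q : {mpoly C[m]}, Q != 0 &
    forall u, W u -> Q.@[fun k => (f k).@[coefs u]] = 0.

Lemma alg_dependent_not_independent W m f : alg_dependent_on W m ->
  ~ @alg_independent_on C 2 W m f.
Proof. by move=> /(_ f)[Q Q0 dQ] /(_ Q dQ) E; rewrite E eqxx in Q0. Qed.

Lemma comp_tuple_eval m (f : 'I_m -> {mpoly C[Nc]}) (Q : {mpoly C[m]}) u :
  (Q \mPo [tuple f k | k < m]).@[coefs u] = Q.@[fun k => (f k).@[coefs u]].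
Proof.
by rewrite comp_mpoly_meval; apply: meval_eq => k; rewrite tnth_mktuple.
Qed.

(** A relation valid on a set is valid on its closure. *)
Lemma alg_dependent_closure w w' m : is_form w -> is_form w' ->
  in_closure w w' -> alg_dependent_on (PGL3_orbit w) m ->
  alg_dependent_on (PGL3_orbit w') m.
Proof.
move=> fw fw' cl dep f; have [Q Q0 dQ] := dep f; exists Q; first exact: Q0.
move=> u wu.
rewrite -comp_tuple_eval; apply: (in_closure_orbit fw fw' cl wu) => v wv.
by rewrite comp_tuple_eval dQ.
Qed.

(** [t] parametrizes by n < m variables a family of matrices N such that
    almost every form of the orbit of [w] is the pullback of [w] by one of them;
    m functions on the orbit then become m polynomials in n variables. *)
Lemma alg_dependent_slice w (n m : nat) (t : (3 * 3).-tuple {mpoly C[n]})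
    (h : {mpoly C[3 * 3]}) : is_form w -> (n < m)%N -> h != 0 ->
  (forall M, M \in unitmx -> h.@[pt M] != 0 -> exists v N,
     pullback (linear_map M) w = pullback (linear_map N) w /\
     forall k, (tnth t k).@[v] = pt N k) ->
  alg_dependent_on (PGL3_orbit w) m.
Proof.
move=> fw nm h0 hM f.
have [Q Q0 QG] := mpoly_alg_dependent (fun k => (f k \mPo orbit_coefs w) \mPo t) nm.
exists Q; first exact: Q0.
move=> u wu; rewrite -comp_tuple_eval; move: u wu.
rewrite -/(vanishes_on _ _) (vanishes_on_orbit _ fw).
have hd0 : h * det3 (generic_mx C) != 0 by rewrite mulf_neq0 ?generic_det_neq0.
apply: (mpoly_eval_dense hd0) => v; have [M /meval_eq vM] := pt_surj v.
rewrite mevalM mulf_eq0 negb_or !vM generic_det_eval => /andP[hM0 dM0].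
rewrite comp_orbit_coefs_eval //.
have [|x [N [-> tN]]] := hM M _ hM0; first by rewrite unitmxE unitfE.
rewrite comp_tuple_eval -[RHS](meval0 x) -QG comp_mpoly_meval.
apply: meval_eq => k; rewrite tnth_mktuple -comp_orbit_coefs_eval //.
by rewrite [in RHS]comp_mpoly_meval; apply: meval_eq => l; rewrite tN.
Qed.

(** The orbit of [w] is irreducible, so a proper closed subset of its closure
    has smaller transcendence degree.  Given m functions f independent on the
    orbit of [w'], take a relation on the orbit of [w] between f and h, of
    minimal degree.  Restricting it to the orbit of [w'], where h is zero, shows
    that it is divisible by the variable standing for h; as h is not zero on the
    orbit of [w], the quotient is a smaller relation. *)
Lemma closure_dimension w w' m (h : {mpoly C[Nc]}) : is_form w -> is_form w' ->
  in_closure w w' -> vanishes_on (PGL3_orbit w') h ->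
  ~ vanishes_on (PGL3_orbit w) h ->
  alg_dependent_on (PGL3_orbit w) m.+1 ->
  forall f, ~ @alg_independent_on C 2 (PGL3_orbit w') m f.
Proof.
move=> fw fw' cl h0 hn0 dep f ind.
(* The m functions f, followed by h. *)
pose g (k : 'I_m.+1) := oapp f h (unlift ord_max k).
have [Q Q0 dQ] := dep g.
have [d] := ubnP (msize Q); elim: d Q Q0 dQ => [Q _ _|d IHd Q Q0 dQ Qd].
  by rewrite ltn0.
pose s : m.+1.-tuple {mpoly C[m.+1]} :=
  [tuple if k == ord_max then 0 else 'X_k | k < m.+1].
(* The last variable stands for h, and [s] sets it to zero. *)
have [k|Q1 EQ] := @subst_divides _ ('X_ord_max) s _ Q.
  rewrite tnth_mktuple; case: eqP => [->|_].
    by exists 1; rewrite subr0 mul1r.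
  by exists 0; rewrite subrr mul0r.
pose r : m.+1.-tuple {mpoly C[m]} :=
  [tuple oapp (fun j => 'X_j) 0 (unlift ord_max k) | k < m.+1].
pose r' : m.-tuple {mpoly C[m.+1]} := [tuple 'X_(lift ord_max j) | j < m].
have Qr0 : Q \mPo r = 0.
  apply: ind => u wu; rewrite comp_mpoly_meval.
  have cu := in_closure_orbit fw fw' cl wu.
  have := cu (Q \mPo [tuple g k | k < m.+1]) _.
  rewrite comp_tuple_eval => <- => [|v wv]; last by rewrite comp_tuple_eval dQ.
  apply: meval_eq => k; rewrite tnth_mktuple /g.
  case: unliftP => [j _|_].
    exact: mevalXU.
  exact: (etrans (meval0 _) (esym (h0 u wu))).
have Qs0 : Q \mPo s = 0.
  rewrite -(comp_mpoly0 r') -Qr0; apply: mpoly_eval_eq => v.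
  rewrite !comp_mpoly_meval; apply: meval_eq => k; rewrite !tnth_mktuple.
  case: unliftP => [j ->|->] /=; last by rewrite eqxx !meval0.
  by rewrite eq_sym (negPf (neq_lift _ _)) !mevalXU tnth_mktuple mevalXU.
rewrite Qs0 subr0 in EQ.
have Q10 : Q1 != 0 by apply: contraNneq Q0 => Q10; rewrite EQ Q10 mul0r.
apply: (IHd Q1 Q10).
  move=> u wu; rewrite -comp_tuple_eval; move: u wu.
  rewrite -/(vanishes_on _ _) (vanishes_on_orbit _ fw).
  have hw : h \mPo orbit_coefs w != 0.
    by apply/eqP; rewrite -(vanishes_on_orbit _ fw).
  apply/eqP; rewrite -(mulIr_eq0 _ (mulIf hw)) -rmorphM /=.
  apply/eqP/(vanishes_on_orbit _ fw) => u wu.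
  rewrite mevalM comp_tuple_eval -[RHS](dQ u wu) EQ mevalM mevalXU /g.
  by rewrite unlift_none.
have X0 : 'X_ord_max != 0 :> {mpoly C[m.+1]} by rewrite -msize_poly_eq0 msizeX.
by move: Qd; rewrite EQ (msizeM Q10 X0) msizeX mdeg1 addn2 ltnS.
Qed.

End Closure.

(** * Infinitesimal isotropy *)

Section Infinitesimal.
Variable C : numClosedFieldType.
Implicit Types (w u : oneform C 3) (M N A B : 'M[C]_3) (T : 'I_3 -> 'M[C]_3).

Local Notation Nc := #|coef_index 2|.
Local Notation coefs w := (@form_coef C 2 w).

(** The matrices of the Lie algebra of the group preserving [T] up to a factor,
    with the trace term of [dact] absorbed in the factor. *)
Definition inf_iso T A := exists c, forall i j k,
  \sum_m A m j * T i m k + \sum_n T i j n * A n k - \sum_l A i l * T l j k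
    = c * T i j k.

Lemma dact_inf_iso T A c :
  (forall i j k, dact A T i j k = c * T i j k) -> inf_iso T A.
Proof.
move=> AT; exists (c - \tr A) => i j k; rewrite mulrBl -AT /dact; ring.
Qed.

Lemma inf_isoD T A B : inf_iso T A -> inf_iso T B -> inf_iso T (A + B).
Proof.
move=> [c Ac] [d Bd]; exists (c + d) => i j k; rewrite mulrDl -Ac -Bd !sum3 !mxE.
ring.
Qed.

Lemma inf_isoZ T A b : inf_iso T A -> inf_iso T (b *: A).
Proof.
move=> [c Ac]; exists (b * c) => i j k; rewrite -mulrA -Ac !sum3 !mxE; ring.
Qed.

Lemma inf_iso_scalar T a : inf_iso T a%:M.
Proof.
exists a => i j k.
have -> : a%:M = a *: 1%:M :> 'M[C]_3 by rewrite scalemx1.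
have E (F : 'I_3 -> C) l : \sum_m (a *: 1%:M : 'M[C]_3) l m * F m = a * F l.
  rewrite -(sum_deltal F l) mulr_sumr; apply: eq_bigr => m _.
  by rewrite !mxE mulrA.
have E' (F : 'I_3 -> C) l : \sum_m F m * (a *: 1%:M : 'M[C]_3) m l = a * F l.
  rewrite -(sum_deltal F l) mulr_sumr; apply: eq_bigr => m _.
  by rewrite !mxE eq_sym; ring.
under eq_bigr => m _ do rewrite mulrC.
by rewrite (E' (fun m => T i m k)) (E' (T i j)) (E (fun l => T l j k)) addrK.
Qed.

(** Says, without a basis, that these matrices, the scalars among them, span a
    space of dimension at least 3. *)
Definition big_iso T := forall A, exists B,
  inf_iso T B /\ forall a b, B <> a%:M + b *: A.

Lemma tens_neq0 w : foliation 2 w -> exists i j k, tens w i j k != 0.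
Proof.
move=> fw.
have [/existsP[i /existsP[j /existsP[k Tn0]]]|T0] :=
    boolP [exists i, exists j, exists k, tens w i j k != 0].
  by exists i, j, k.
have {}T0 i j k : tens w i j k = 0.
  apply: contraNeq T0 => Tn0.
  by apply/existsP; exists i; apply/existsP; exists j; apply/existsP; exists k.
have [_ _ ndw] := fw.
suff /(ndw 0) : forall i, exists q, w 0 i = q * 0.
  by rewrite unitr0.
move=> i; exists 0; rewrite mulr0 -(form_of_tens (foliation_is_form fw)).
apply: mpoly_eval_eq0 => x; apply: (etrans (ev_form_of _ _ _)).
have V0 l : vf (tens w) x l = 0.
  rewrite /vf big1 // => j _; rewrite big1 // => k _.
  by rewrite T0 !mul0r.
by elim/ord3P: i; rewrite /fm /cross !t3E !V0; ring.
Qed.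

(** The 2 x 2 minors of the pair (action of M on T, T) vanish on the
    isotropy group; their differentials at 1 say that [dact A T] is proportional
    to T. *)
Lemma tangent_inf_iso w A : foliation 2 w -> tangent_at_1 (Iso w) A -> inf_iso (tens w) A.
Proof.
move=> fol tA; have fw := foliation_is_form fol; pose T := tens w.
have [i [j [k Tn0]]] := tens_neq0 fol.
apply: (@dact_inf_iso _ _ (dact A T i j k / T i j k)) => i' j' k'.
have := tA (generic_act T i' j' k' * (T i j k)%:MP
            - generic_act T i j k * (T i' j' k')%:MP) _.
rewrite -[X in X = 0]/(dder A _) dderB !dderM !dderC !mulr0 !addr0 !mevalC.
rewrite !dder_act => dA.
rewrite mulrAC; apply: (mulIf Tn0); rewrite divfK //.
apply/eqP; rewrite -subr_eq0; apply/eqP/dA => M [uM [c c0 Mw]].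
have act_c a b d : act M T a b d = c * T a b d.
  by rewrite -tens_pullback // Mw tensZ.
rewrite mevalB !mevalM !mevalC !generic_act_eval !act_c; ring.
Qed.

Lemma big_iso_dim_iso w : foliation 2 w -> dim_iso w 2 -> big_iso (tens w).
Proof.
move=> fol [U [UT dU]] A.
have d1 : \dim <[(1%:M : 'M[C]_3)]>%VS = 1%N.
  by rewrite dim_vline oner_neq0.
have /subvPn[B UB nB] : ~~ (U <= <[(1%:M : 'M[C]_3)]> + <[A]>)%VS.
  apply/negP => /dimvS; rewrite dU d1; apply/negP; rewrite -ltnNge.
  apply: leq_ltn_trans (leq_of_leqif (dimv_add_leqif _ _)) _; rewrite d1.
  by rewrite dim_vline; case: (A != 0).
exists B; split=> [|a b EB]; first by apply: tangent_inf_iso => //; apply/UT.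
case/negP: nB; rewrite EB memv_add //; apply/vlineP; [exists a|by exists b].
by rewrite scalemx1.
Qed.

Local Notation K := #|{: 'I_3 * 'I_3 * 'I_3}|.

(** The Jacobian matrix at 1 of the orbit map in the coordinates T_ijk. *)
Definition jac T : 'M[C]_(3 * 3, K) := \matrix_(r, s)
  ((generic_act T (enum_val s).1.1 (enum_val s).1.2 (enum_val s).2)^`M(r)).@[pt 1%:M].

Lemma jacE T A s :
  (mxvec A *m jac T) 0 s
    = dact A T (enum_val s).1.1 (enum_val s).1.2 (enum_val s).2.
Proof.
rewrite -dder_act mxE; apply: eq_bigr => r _; congr (_ * _); exact: mxE.
Qed.

Lemma jac_ker T A :
  (mxvec A <= kermx (jac T))%MS <-> forall i j k, dact A T i j k = 0.
Proof.
split=> [/sub_kermxP A0 i j k|A0].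
  have := jacE T A (enum_rank (i, j, k)).
  by rewrite A0 enum_rankK mxE => <-.
by apply/sub_kermxP/rowP => s; rewrite jacE A0 mxE.
Qed.

Lemma rank_select (m n r : nat) (J : 'M[C]_(m, n)) : (r <= \rank J)%N ->
  exists (L : 'M[C]_(r, m)) (R : 'M[C]_(n, r)), L *m J *m R = 1%:M.
Proof.
move=> rJ; exists (pid_mx r *m invmx (col_ebase J)).
exists (invmx (row_ebase J) *m pid_mx r).
rewrite -{2}(mulmx_ebase J) !mulmxA mulmxKV ?col_ebase_unit //.
rewrite -!mulmxA (mulmxA (row_ebase J)) mulmxV ?row_ebase_unit // mul1mx.
rewrite !mul_pid_mx [X in pid_mx X](_ : _ = r) ?pid_mx_1 //.
have := rank_leq_row J; have := rank_leq_col J; lia.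
Qed.

(** The differential at 1 is enough: suitable linear combinations of the T_ijk
    have an invertible Jacobian matrix in suitable directions. *)
Lemma alg_independent_rank w r : is_form w -> (r <= \rank (jac (tens w)))%N ->
  exists f : 'I_r -> {mpoly C[Nc]}, @alg_independent_on C 2 (PGL3_orbit w) r f.
Proof.
move=> fw /rank_select[L [R LJR]].
have [p Ep] := tens_coord C; pose J := jac (tens w).
pose f (k : 'I_r) := \sum_(s < K)
  R s k *: p (enum_val s).1.1 (enum_val s).1.2 (enum_val s).2.
exists f => Q dQ.
pose g (k : 'I_r) : {mpoly C[3 * 3]} := \sum_(s < K) R s k *:
  generic_act (tens w) (enum_val s).1.1 (enum_val s).1.2 (enum_val s).2.
have fg k : f k \mPo orbit_coefs w = g k.
  apply: mpoly_eval_eq => v; have [M /meval_eq vM] := pt_surj v.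
  rewrite !vM comp_orbit_coefs_eval // !raddf_sum; apply: eq_bigr => s _ /=.
  apply: etrans (mevalZ _ _ _) _; apply: etrans _ (esym (mevalZ _ _ _)).
  congr (_ * _); rewrite generic_act_eval Ep ?tens_pullback //.
  exact: is_form_pullback.
apply: (@jacobian_criterion _ _ _ g (pt 1%:M) L^T).
  move=> k i; rewrite eq_sym; have /matrixP/(_ i k) := LJR.
  rewrite [RHS]mxE => <-; rewrite -mulmxA mxE; apply: eq_bigr => j _.
  rewrite [L^T _ _]mxE mulrC; congr (_ * _); rewrite mxE /g.
  rewrite (big_morph _ (mderivD j) (mderiv0 _ j)).
  rewrite (big_morph _ (mevalD (pt 1%:M)) (meval0 (pt 1%:M))).
  apply: eq_bigr => s _; rewrite mderivZ mulrC [jac _ _ _]mxE.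
  exact: mevalZ.
have /(vanishes_on_orbit _ fw) Qf : vanishes_on (PGL3_orbit w) (Q \mPo [tuple f k | k < r]).
  by move=> u wu; rewrite comp_tuple_eval dQ.
rewrite -Qf; apply: mpoly_eval_eq => v; rewrite !comp_mpoly_meval.
apply: meval_eq => k; rewrite !tnth_mktuple -fg.
exact: comp_mpoly_meval.
Qed.

(** The kernel of the Jacobian matrix has dimension at least 9 - 7 = 2, and
    it does not contain the identity, on which [dact] is multiplication by 4. *)
Lemma big_iso_rank T : (exists i j k, T i j k != 0) ->
  (\rank (jac T) <= 7)%N -> big_iso T.
Proof.
move=> [i [j [k Tn0]]] r7 A; pose e := mxvec (1%:M : 'M[C]_3).
have rK : (2 <= \rank (kermx (jac T)))%N by rewrite mxrank_ker; lia.
have eK : ~~ (e <= kermx (jac T))%MS.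
  apply/negP => /jac_ker/(_ i j k)/eqP; rewrite /dact mxtrace1.
  under eq_bigr => m _ do rewrite mxE mulrC -mulr_natr mul1r eq_sym mulrC.
  rewrite sum_deltal.
  under eq_bigr => m _ do rewrite mxE mulrC eq_sym.
  rewrite sum_deltal.
  under eq_bigr => m _ do rewrite mxE.
  rewrite sum_deltal addrK -[X in _ + X]mul1r -mulrDl mulf_eq0 (negPf Tn0) orbF.
  by rewrite -(natrD _ 3 1) pnatr_eq0.
have e1 : (\rank e <= 1)%N := rank_leq_row e.
have cap0 : \rank (kermx (jac T) :&: e)%MS = 0%N.
  have := capmxSr (kermx (jac T)) e => /mxrank_leqif_sup[].
  rewrite leq_eqVlt => /orP[/eqP->|]; last by lia.
  rewrite eqxx => /esym; rewrite sub_capmx (negPf eK) //.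
have rS : (\rank e + \rank (kermx (jac T)) = \rank (kermx (jac T) + e)%MS)%N.
  by have := mxrank_sum_cap (kermx (jac T)) e; rewrite cap0 addn0 addnC.
have re : \rank e = 1%N.
  apply/eqP; rewrite eqn_leq e1 lt0n mxrank_eq0.
  by apply: contraNneq eK => ->; rewrite sub0mx.
have /row_subPn[r nr] : ~~ (kermx (jac T) <= e + mxvec A)%MS.
  apply/negP => KA; have : (kermx (jac T) + e <= e + mxvec A)%MS.
    by rewrite addsmx_sub KA addsmxSl.
  move/mxrankS; rewrite -rS re.
  have := (mxrank_adds_leqif e (mxvec A)).1; have := rank_leq_row (mxvec A); lia.
exists (vec_mx (row r (kermx (jac T)))); split.
  have /jac_ker B0 : (mxvec (vec_mx (row r (kermx (jac T)))) <= kermx (jac T))%MS.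
    by rewrite vec_mxK row_sub.
  by apply: (@dact_inf_iso _ _ 0) => a b c; rewrite B0 mul0r.
move=> a b EB; case/negP: nr.
rewrite -[row r _]vec_mxK EB -scalemx1 linearD !linearZ /=.
by rewrite addmx_sub_adds // scalemx_sub.
Qed.

Lemma rank_jac_ge T A1 A2 :
  (forall A, (forall i j k, dact A T i j k = 0) ->
     exists a b, A = a *: A1 + b *: A2) ->
  (7 <= \rank (jac T))%N.
Proof.
move=> ker2; have : (kermx (jac T) <= mxvec A1 + mxvec A2)%MS.
  apply/row_subP => r; pose A := vec_mx (row r (kermx (jac T))).
  have rA : row r (kermx (jac T)) = mxvec A by rewrite vec_mxK.
  have [|a [b EA]] := ker2 A; first by apply/jac_ker; rewrite -rA row_sub.
  by rewrite rA EA linearD !linearZ /= addmx_sub_adds // scalemx_sub.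
move/mxrankS; rewrite mxrank_ker.
have := (mxrank_adds_leqif (mxvec A1) (mxvec A2)).1.
have := rank_leq_row (mxvec A1); have := rank_leq_row (mxvec A2); lia.
Qed.

End Infinitesimal.

(** * Isotropic elements of the isotropy algebra *)

Section Isotropic.
Variable C : numClosedFieldType.
Implicit Types (w u : oneform C 3) (M N A B P : 'M[C]_3) (T : 'I_3 -> 'M[C]_3).

Lemma inf_isoP T A : inf_iso T A <-> exists c, forall i,
  A^T *m T i + T i *m A - \sum_l A i l *: T l = c *: T i.
Proof.
split=> -[c Ac]; exists c => i.
  apply/matrixP => j k; rewrite !mxE -Ac summxE; congr (_ + _ - _).
  - by apply: eq_bigr => m _; rewrite mxE.
  - by apply: eq_bigr => l _; rewrite mxE.
move=> j k; have /matrixP/(_ j k) := Ac i.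
rewrite !mxE => <-; rewrite summxE; congr (_ + _ - _).
- by apply: eq_bigr => m _; rewrite mxE.
- by apply: eq_bigr => l _; rewrite mxE.
Qed.

Lemma adj3_unit P : P \in unitmx -> adj3 P = det3 P *: invmx P.
Proof.
move=> uP; rewrite -[LHS]mulmx1 -(mulmxV uP) mulmxA adj3_mul.
by rewrite mul_scalar_mx.
Qed.

Lemma inf_iso_conj T A P :
  P \in unitmx -> inf_iso T A -> inf_iso (act P T) (invmx P *m A *m P).
Proof.
move=> uP /inf_isoP[c Ac]; apply/inf_isoP; exists c => i; pose B := invmx P *m A *m P.
have PB : P *m B = A *m P by rewrite /B !mulmxA mulmxV // mul1mx.
have Badj : B *m adj3 P = adj3 P *m A.
  by rewrite adj3_unit // -scalemxAr -scalemxAl /B mulmxK.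
rewrite -/B /act mulmx_sumr mulmx_suml.
transitivity (\sum_l adj3 P i l *:
    (P^T *m (A^T *m T l + T l *m A - \sum_m A l m *: T m) *m P)); last first.
  rewrite scaler_sumr; apply: eq_bigr => l _.
  by rewrite Ac -scalemxAr -scalemxAl scalerA mulrC -scalerA.
have -> : \sum_l B i l *: (\sum_m adj3 P l m *: (P^T *m T m *m P)) =
    \sum_l adj3 P i l *: (P^T *m (\sum_m A l m *: T m) *m P).
  under eq_bigr => l _ do rewrite scaler_sumr.
  rewrite exchange_big /=.
  transitivity (\sum_m (B *m adj3 P) i m *: (P^T *m T m *m P)).
    apply: eq_bigr => m _; rewrite mxE scaler_suml.
    by apply: eq_bigr => l _; rewrite scalerA.
  rewrite Badj; under [RHS]eq_bigr => l _ do
    rewrite mulmx_sumr mulmx_suml scaler_sumr.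
  rewrite exchange_big; apply: eq_bigr => m _ /=; rewrite mxE scaler_suml.
  by apply: eq_bigr => l _; rewrite -scalemxAr -scalemxAl scalerA.
rewrite -big_split -sumrB; apply: eq_bigr => l _ /=.
rewrite -scalemxAr -scalemxAl -scalerDr -scalerBr; congr (_ *: _).
rewrite mulmxBr mulmxDr mulmxBl mulmxDl; congr (_ + _ - _).
  by rewrite !mulmxA -!trmx_mul PB.
by rewrite -!mulmxA PB.
Qed.

(** On a plane of trace-free matrices the quadratic form tr(N^2) has a nontrivial
    zero. *)
Lemma big_iso_isotropic T : big_iso T ->
  exists N, [/\ inf_iso T N, N != 0, \tr N = 0 & \tr (N *m N) = 0].
Proof.
move=> gT; pose tf (A : 'M[C]_3) := A - (\tr A / 3)%:M.
have trtf A : \tr (tf A) = 0.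
  by rewrite /tf linearB /= mxtrace_scalar; field.
have inftf A : inf_iso T A -> inf_iso T (tf A).
  by move=> iA; rewrite /tf -scaleN1r; apply: inf_isoD => //; apply/inf_isoZ/inf_iso_scalar.
have [B0 [iB0 nB0]] := gT 0; have [B1 [iB1 nB1]] := gT B0.
pose X := tf B0; pose Y := tf B1.
have X0 : X != 0.
  apply/eqP => /eqP; rewrite subr_eq0 => /eqP EB.
  by apply: (nB0 (\tr B0 / 3) 0); rewrite scale0r addr0.
have [XX0|XX0] := eqVneq (\tr (X *m X)) 0.
  by exists X; split=> //; [exact: inftf|exact: trtf].
have XY s : s *: X + Y != 0.
  apply/eqP => E; apply: (nB1 (\tr B1 / 3 + s * (\tr B0 / 3)) (- s)).
  have EY : Y = - s *: X by rewrite scaleNr; apply/eqP; rewrite -addr_eq0 addrC E.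
  have EB : B1 = Y + (\tr B1 / 3)%:M by rewrite /Y /tf subrK.
  rewrite {1}EB EY /X /tf scalerBr scale_scalar_mx mulNr raddfN opprK raddfD /=.
  by rewrite -addrA addrC [_ + (\tr B1 / 3)%:M]addrC.
have iX : inf_iso T X := inftf _ iB0; have iY : inf_iso T Y := inftf _ iB1.
have tX : \tr X = 0 := trtf _; have tY : \tr Y = 0 := trtf _.
clearbody X Y; pose a := \tr (X *m X); pose b := \tr (X *m Y); pose c := \tr (Y *m Y).
have YX : \tr (Y *m X) = b by rewrite mxtrace_mulC.
(* A root of a s^2 + 2 b s + c = tr((s X + Y)^2). *)
pose s := (- b + sqrtC (b ^+ 2 - a * c)) / a.
exists (s *: X + Y); split=> //.
- by apply: inf_isoD => //; apply/inf_isoZ.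
- by rewrite mxtraceD mxtraceZ tX tY mulr0 addr0.
rewrite mulmxDl !mulmxDr -!scalemxAl -!scalemxAr scalerA.
rewrite !mxtraceD !mxtraceZ YX -/a -/b -/c.
have sq := sqrtCK (b ^+ 2 - a * c).
have as_ : a * s = - b + sqrtC (b ^+ 2 - a * c) by rewrite /s mulrC divfK.
apply: (mulfI XX0); rewrite -/a mulr0.
transitivity ((a * s + b) ^+ 2 - (b ^+ 2 - a * c)); first by ring.
by rewrite as_ addrAC addNr add0r sq subrr.
Qed.

(** By Cayley-Hamilton, as the first two symmetric functions of the eigenvalues
    of [N] vanish; hence N^3 = det N. *)
Lemma isotropic_sqr N : \tr N = 0 -> \tr (N *m N) = 0 ->
  N *m N = adj3 N.
Proof.
rewrite /mxtrace !sum3 !mxE !sum3 => t1 t2; apply/matrixP => i j.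
apply: (@mulf_natI C 1); move: i j.
do 2![elim/ord3P]; rewrite !mxE sum3 /cross !t3E ?ordE;
set a := N 0 0 in t1 t2 *; set b := N 0 1 in t1 t2 *; set c := N 0 2 in t1 t2 *;
set d := N 1 0 in t1 t2 *; set e := N 1 1 in t1 t2 *; set f := N 1 2 in t1 t2 *;
set g := N 2 0 in t1 t2 *; set h := N 2 1 in t1 t2 *; set l := N 2 2 in t1 t2 *.
- apply: (by_eq (eqD (eqZ (a - e - l) t1) t2)); ring.
- apply: (by_eq (eqZ (2 * b) t1)); ring.
- apply: (by_eq (eqZ (2 * c) t1)); ring.
- apply: (by_eq (eqZ (2 * d) t1)); ring.
- apply: (by_eq (eqD (eqZ (e - a - l) t1) t2)); ring.
- apply: (by_eq (eqZ (2 * f) t1)); ring.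
- apply: (by_eq (eqZ (2 * g) t1)); ring.
- apply: (by_eq (eqZ (2 * h) t1)); ring.
- apply: (by_eq (eqD (eqZ (l - a - e) t1) t2)); ring.
Qed.

Definition rows3 (a b c : 'rV[C]_3) : 'M[C]_3 := \matrix_i t3 a b c i.

Lemma mul_rows3 (u a b c : 'rV[C]_3) :
  u *m rows3 a b c = u 0 0 *: a + u 0 1 *: b + u 0 2 *: c.
Proof. by rewrite mulmx_sum_row sum3 !rowK !t3E. Qed.

(** Conjugation into the matrix J of [N] in a basis of row vectors. *)
Lemma rows3_conj (a b c : 'rV[C]_3) N (J : 'M[C]_3) :
  (forall u : 'rV[C]_3, u 0 0 *: a + u 0 1 *: b + u 0 2 *: c = 0 -> u = 0) ->
  (forall i, t3 a b c i *m N = row i J *m rows3 a b c) ->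
  exists2 P, P \in unitmx & invmx P *m N *m P = J.
Proof.
move=> free EJ; pose Q := rows3 a b c.
have uQ : Q \in unitmx.
  rewrite -row_free_unit; apply: inj_row_free => u uQ0; apply: free.
  by rewrite -mul_rows3.
exists (invmx Q); first by rewrite unitmx_inv.
rewrite invmxK; suff -> : Q *m N = J *m Q by rewrite -mulmxA mulmxV // mulmx1.
by apply/row_matrixP => i; rewrite !row_mul rowK EJ.
Qed.

Lemma row_neq0 (A : 'M[C]_3) : A != 0 -> exists v : 'rV[C]_3, v *m A != 0.
Proof.
move=> A0; have [/existsP[i Ai]|nA] := boolP [exists i, row i A != 0].
  by exists (delta_mx 0 i); rewrite -rowE.
case/eqP: A0; apply/row_matrixP => i; rewrite row0; apply/eqP.
by apply: contraNT nA => Ai; apply/existsP; exists i.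
Qed.

Lemma scale_row_eq0 (k : C) (v : 'rV[C]_3) : v != 0 -> k *: v = 0 -> k = 0.
Proof. by move=> v0 /eqP; rewrite scaler_eq0 (negPf v0) orbF => /eqP. Qed.

(** The polynomial X^3 - d has three distinct roots. *)
Lemma cube_root_diagonalizable N d : N *m N *m N = d%:M -> d != 0 ->
  diagonalizable N.
Proof.
move=> N3 d0; pose m := 3.-root d.
have m3 : m ^+ 3 = d by rewrite rootCK.
have m0 : m != 0 by apply: contraNneq d0 => m0; rewrite -m3 m0 expr0n.
(* A primitive cube root of unity. *)
pose z : C := (-1 + sqrtC (-3)) / 2.
have z2 : z ^+ 2 = - z - 1.
  have s3 : sqrtC (-3) ^+ 2 = -3 :> C by rewrite sqrtCK.
  apply: (by_eq (eqZ (1 / 4) s3)); rewrite /z; by field.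
clearbody z; have z1 : z != 1.
  apply/eqP => Ez; have : 3 = 0 :> C by move: z2; rewrite Ez => z2; apply: (by_eq z2); ring.
  by move/eqP; rewrite pnatr_eq0.
have zz1 : - z - 1 != 1.
  apply/eqP => Ez; have Ez' : z = - 2 by apply: (by_eq (eqZ (-1) Ez)); ring.
  have : 3 = 0 :> C by move: z2; rewrite Ez' => z2; apply: (by_eq z2); ring.
  by move/eqP; rewrite pnatr_eq0.
have zzz : - z - 1 != z.
  apply/eqP => Ez; have Ez' : 2 * z = -1 by apply: (by_eq (eqZ (-1) Ez)); ring.
  have : 3 = 0 :> C.
    by apply: (by_eq (eqD (eqZ 4 z2) (eqZ (-2 * z - 1) Ez'))); ring.
  by move/eqP; rewrite pnatr_eq0.
have neq x y : y != x -> m * x != m * y by rewrite (inj_eq (mulfI m0)) eq_sym.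
apply/diagonalizableP; exists [:: m * 1; m * z; m * (- z - 1)].
  by rewrite /= !inE !negb_or !neq.
apply: mxminpoly_min; rewrite !big_cons big_nil !mulr1.
have -> : ('X - m%:P) * (('X - (m * z)%:P) * ('X - (m * (- z - 1))%:P))
    = 'X^3 - d%:P :> {poly C}.
  rewrite -m3; have zP : z%:P ^+ 2 = - z%:P - 1 :> {poly C}.
    by rewrite -polyC_exp z2 polyCB polyCN polyC1.
  rewrite polyC_exp !polyCM polyCB polyCN polyC1.
  apply: (by_eq (eqZ (m%:P ^+ 2 * (m%:P - 'X)) zP)); ring.
by rewrite rmorphB rmorphXn /= horner_mx_X horner_mx_C exprSr expr2 -N3 subrr.
Qed.

(** N^3 = det N by [isotropic_sqr]; the three cases are det N <> 0,
    N nilpotent of order 3, and N of order 2. *)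
Lemma isotropic_normal_form N : N != 0 -> \tr N = 0 -> \tr (N *m N) = 0 ->
  exists2 P, P \in unitmx &
    [\/ exists d : 'rV[C]_3, [/\ invmx P *m N *m P = diag_mx d,
          d 0 0 + d 0 1 + d 0 2 = 0,
          d 0 0 ^+ 2 + d 0 1 ^+ 2 + d 0 2 ^+ 2 = 0 & d 0 0 != 0],
        invmx P *m N *m P = delta_mx 1 0 + delta_mx 2 1
      | invmx P *m N *m P = delta_mx 2 0].
Proof.
move=> N0 t1 t2; have NN := isotropic_sqr t1 t2.
have N3 : N *m N *m N = (det3 N)%:M by rewrite NN adj3_mul.
have [d0|d0] := eqVneq (det3 N) 0; last first.
  have [Q uQ /(diagonalizable_forP _ uQ) HQ] := cube_root_diagonalizable N3 d0.
  pose d := \row_i (Q *m N *m invmx Q) i i.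
  have Ed : Q *m N *m invmx Q = diag_mx d.
    apply/matrixP => i j; rewrite [RHS]mxE; have [->|ij] := eqVneq i j.
      by rewrite mulr1n [RHS]mxE.
    by rewrite (HQ i j ij) mulr0n.
  clearbody d; exists (invmx Q); first by rewrite unitmx_inv.
  apply: Or31; exists d; rewrite invmxK; split=> //.
  - by rewrite -sum3 -mxtrace_diag -Ed -mulmxA mxtrace_mulC mulmxKV.
  - transitivity (\tr (diag_mx d *m diag_mx d)).
      by rewrite mulmx_diag mxtrace_diag sum3 !mxE.
    have -> : diag_mx d *m diag_mx d = Q *m (N *m N) *m invmx Q.
      by rewrite -Ed !mulmxA mulmxKV.
    by rewrite mxtrace_mulC mulKmx.
  apply: contraNneq d0 => d00; rewrite det3E.
  have : \det (diag_mx d) = 0 by rewrite det_diag (bigD1 0) //= d00 mul0r.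
  rewrite -Ed !det_mulmx => /eqP; rewrite !mulf_eq0 det_inv invr_eq0.
  by rewrite unitmxE unitfE in uQ; rewrite (negPf uQ) orbF /=.
rewrite d0 (_ : 0%:M = 0) in N3; last exact: raddf0.
have [NN0|NN0] := eqVneq (N *m N) 0.
  (* v N, a vector b of the kernel independent of v N, and v form a basis: the
     kernel has dimension 2 since rank N <= 3 / 2. *)
  have [v vN] := row_neq0 N0.
  have rN : (\rank N + \rank N <= 3)%N by apply: mulmx0_rank_max.
  have /row_subPn[r nr] : ~~ (kermx N <= v *m N)%MS.
    apply/negP => /mxrankS; rewrite mxrank_ker.
    by have := rank_leq_row (v *m N); lia.
  have bN : row r (kermx N) *m N = 0 by apply/sub_kermxP/row_sub.
  set b := row r (kermx N) in nr bN.
  have vNN : v *m N *m N = 0 by rewrite -mulmxA NN0 mulmx0.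
  have [u u0|i|P uP EP] := @rows3_conj (v *m N) b v N (delta_mx 2 0).
  - have := congr1 (mulmxr N) u0.
    rewrite /= !mulmxDl -!scalemxAl vNN bN !scaler0 !add0r mul0mx.
    move/(scale_row_eq0 vN) => u2; rewrite u2 scale0r addr0 in u0.
    have u1 : u 0 1 = 0.
      apply: contraNeq nr => u1; rewrite -(scalerK u1 b).
      have -> : u 0 1 *: b = - (u 0 0 *: (v *m N)).
        by apply/eqP; rewrite -addr_eq0 addrC u0.
      by rewrite scalemx_sub // eqmx_opp scalemx_sub.
    rewrite u1 scale0r addr0 in u0; move/(scale_row_eq0 vN): u0 => u0.
    by apply/rowP; elim/ord3P; rewrite mxE.
  - rewrite mul_rows3; elim/ord3P: i; rewrite !t3E !mxE /= ?vNN ?bN.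
    + by rewrite !scale0r !addr0.
    + by rewrite !scale0r !addr0.
    + by rewrite scale1r !scale0r !addr0.
  by exists P => //; apply: Or33.
have [v vN] := row_neq0 NN0; rewrite mulmxA in vN.
have vN3 : v *m N *m N *m N = 0 by rewrite -!mulmxA (mulmxA N) N3 mulmx0.
have [u u0|i|P uP EP] := @rows3_conj (v *m N *m N) (v *m N) v N
  (delta_mx 1 0 + delta_mx 2 1).
- have := congr1 (mulmxr N) u0.
  rewrite /= !mulmxDl -!scalemxAl vN3 scaler0 add0r mul0mx => u1.
  have := congr1 (mulmxr N) u1.
  rewrite /= !mulmxDl -!scalemxAl vN3 scaler0 add0r mul0mx.
  move/(scale_row_eq0 vN) => u2; rewrite u2 scale0r addr0 in u1 u0.
  move/(scale_row_eq0 vN): u1 => u1; rewrite u1 !scale0r !addr0 in u0.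
  move/(scale_row_eq0 vN): u0 => u0.
  by apply/rowP; elim/ord3P; rewrite mxE.
- rewrite mul_rows3; elim/ord3P: i; rewrite !t3E !mxE /= ?vN3.
  + by rewrite !addr0 !scale0r !addr0.
  + by rewrite !addr0 scale1r !scale0r !addr0.
  + by rewrite !add0r scale1r !scale0r add0r addr0.
by exists P => //; apply: Or32.
Qed.

End Isotropic.

(** * Semisimple isotropic elements *)

Section Semisimple.
Variable C : numClosedFieldType.
Implicit Types (w u : oneform C 3) (M N A B P : 'M[C]_3) (T S : 'I_3 -> 'M[C]_3).
Implicit Types (x : 'I_3 -> C).

Lemma mpoly_unit_eval (n : nat) (p : {mpoly C[n]}) v :
  p \is a GRing.unit -> p.@[v] != 0.
Proof. by move=> /(rmorph_unit (meval v)); rewrite unitfE. Qed.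

Lemma foliation_no_factor w q v :
  foliation 2 w -> q.@[v] = 0 -> (forall i, exists g, w 0 i = g * q) -> False.
Proof.
by move=> [_ _ nd] q0 /(nd q)/(mpoly_unit_eval v); rewrite q0 eqxx.
Qed.

(** A form vanishing on a plane is divisible by its equation: eliminate the
    variable x_k. *)
Lemma foliation_no_line w (l : 'I_3 -> C) k :
  foliation 2 w -> l k != 0 ->
  (forall x, \sum_i l i * x i = 0 -> forall i, ev w x i = 0) -> False.
Proof.
move=> fol lk0 lw; pose L : {mpoly C[3]} := \sum_i l i *: 'X_i.
pose s : 3.-tuple {mpoly C[3]} :=
  [tuple 'X_i - (i == k)%:R *: ((l k)^-1 *: L) | i < 3].
have Lv v : L.@[v] = \sum_i l i * v i.
  rewrite raddf_sum; apply: eq_bigr => i _.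
  by apply: etrans (mevalZ _ _ _) _; rewrite mevalXU.
apply: (@foliation_no_factor w L (fun=> 0) fol).
  by rewrite Lv big1 // => i _; rewrite mulr0.
move=> i; have [j|g Eg] := @subst_divides _ _ L s _ (w 0 i).
  exists ((j == k)%:R * (l k)^-1)%:MP.
  by rewrite tnth_mktuple opprB addrC subrK scalerA mul_mpolyC.
exists g; rewrite -Eg [X in _ - X](_ : _ = 0) ?subr0 //.
apply: mpoly_eval_eq0 => v; rewrite comp_mpoly_meval.
apply: (lw (fun i => (tnth s i).@[v])).
have sv j : (tnth s j).@[v] = v j - (j == k)%:R * ((l k)^-1 * L.@[v]).
  by rewrite tnth_mktuple mevalB !mevalZ mevalXU.
under eq_bigr => j _ do rewrite sv mulrBr.
rewrite sumrB -Lv (bigD1 k) //= eqxx mul1r mulrA mulfV // mul1r big1.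
  by rewrite addr0 subrr.
by move=> j /negPf ->; rewrite mul0r mulr0.
Qed.

Lemma foliation_no_variable w k : foliation 2 w ->
  (forall i j l, tens w i j l != 0 -> (j == k) || (l == k)) -> False.
Proof.
move=> fol hk.
apply: (@foliation_no_line w (fun i => (i == k)%:R) k fol).
  by rewrite eqxx oner_eq0.
move=> x xk; have {}xk : x k = 0.
  move: xk; rewrite (bigD1 k) //= eqxx mul1r big1 ?addr0 // => j /negPf->.
  by rewrite mul0r.
have V0 i : vf (tens w) x i = 0.
  rewrite /vf big1 // => j _; rewrite big1 // => l _.
  have [->|/hk/orP[] /eqP->] := eqVneq (tens w i j l) 0.
  - by rewrite !mul0r.
  - by rewrite xk mulr0 mul0r.
  - by rewrite xk mulr0.
move=> i; rewrite -(form_of_tens (foliation_is_form fol)).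
apply: etrans (ev_form_of _ _ _) _.
by elim/ord3P: i; rewrite /fm /cross !t3E !V0; ring.
Qed.

(** Up to a factor, a, b, c are 1, j, j^2 with j a primitive cube root of unity,
    so a and b are linearly independent over the rationals. *)
Lemma cube_root_weights (a b c : C) (p q : int) :
  a + b + c = 0 -> a ^+ 2 + b ^+ 2 + c ^+ 2 = 0 -> a != 0 ->
  p%:~R * a + q%:~R * b = 0 -> p = 0 /\ q = 0.
Proof.
move=> e1 e2 a0 pq.
have ab : a ^+ 2 + a * b + b ^+ 2 = 0.
  apply: (@mulf_natI C 1).
  apply: (by_eq (eqD e2 (eqZ (a + b - c) e1))); ring.
have : (p ^+ 2 - p * q + q ^+ 2)%:~R * a ^+ 2 = 0 :> C.
  rewrite rmorphD rmorphB rmorphM !rmorphXn /=.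
  by apply: (by_eq (eqD (eqZ (q%:~R ^+ 2) ab) (eqZ (p%:~R * a - q%:~R * (a + b)) pq))); ring.
move/eqP; rewrite mulf_eq0 expf_eq0 (negPf a0) andbF orbF intr_eq0 => /eqP n0.
(* The norm form p^2 - p q + q^2 is positive definite. *)
have h : (2 * q - p) ^+ 2 + 3 * p ^+ 2 = 0 by apply: (by_eq (eqZ 4 n0)); ring.
have p0 : p = 0.
  apply/eqP; rewrite -sqrf_eq0 eq_le sqr_ge0 andbT.
  have := sqr_ge0 (2 * q - p); nia.
by split=> //; rewrite p0 in n0; apply/eqP; rewrite -sqrf_eq0; apply/eqP; lia.
Qed.

(** The weights of diag(a, b, - a - b) on the coordinates, in the basis a, b. *)
Definition wt (i : nat) : int * int := nth (0, 0) [:: (1, 0); (0, 1); (-1, -1)] i.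

Definition wt3 (i j l : nat) : int * int :=
  ((wt j).1 + (wt l).1 - (wt i).1, (wt j).2 + (wt l).2 - (wt i).2).

(** Any two monomial fields of the same weight share a variable, which can be
    chosen in terms of the first one only: x_k divides the monomial x_j x_l of
    the i-th component. *)
Lemma wt3_monomial (i j l i' j' l' : 'I_3) :
  wt3 i j l = wt3 i' j' l' ->
  let k := if i == j then l else j in (j' == k) || (l' == k).
Proof.
pose r := iota 0 3.
have H : all (fun i => all (fun j => all (fun l => all (fun i' => all (fun j' =>
   all (fun l' => (wt3 i j l == wt3 i' j' l') ==>
     let k := if i == j then l else j in (j' == k) || (l' == k)) r) r) r) r) r) r.
  by vm_compute.
move/allP: H => /(_ i); rewrite mem_iota ltn_ord => /(_ isT).
move=> /allP/(_ j); rewrite mem_iota ltn_ord => /(_ isT).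
move=> /allP/(_ l); rewrite mem_iota ltn_ord => /(_ isT).
move=> /allP/(_ i'); rewrite mem_iota ltn_ord => /(_ isT).
move=> /allP/(_ j'); rewrite mem_iota ltn_ord => /(_ isT).
move=> /allP/(_ l'); rewrite mem_iota ltn_ord => /(_ isT).
have -> : (i == j) = (i == j :> nat) by [].
by move=> /implyP h /eqP/h /=; case: (i == j :> nat).
Qed.

(** All monomials of the field have the same weight, hence a common variable. *)
Lemma diagonal_isotropy_not_foliation w (d : 'rV[C]_3) : foliation 2 w ->
  d 0 0 + d 0 1 + d 0 2 = 0 ->
  d 0 0 ^+ 2 + d 0 1 ^+ 2 + d 0 2 ^+ 2 = 0 -> d 0 0 != 0 ->
  inf_iso (tens w) (diag_mx d) -> False.
Proof.
move=> fol e1 e2 a0 [c Ec].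
have Dd i j : diag_mx d i j = (i == j)%:R * d 0 i.
  by rewrite mxE mulr_natl.
have E i j l : (d 0 j + d 0 l - d 0 i - c) * tens w i j l = 0.
  have := Ec i j l.
  have -> : \sum_m diag_mx d m j * tens w i m l = d 0 j * tens w i j l.
    under eq_bigr => m _ do rewrite Dd eq_sym -mulrA.
    by rewrite (sum_deltal (fun m => d 0 m * tens w i m l)).
  have -> : \sum_n tens w i j n * diag_mx d n l = d 0 l * tens w i j l.
    under eq_bigr => m _ do rewrite mulrC Dd eq_sym -mulrA.
    by rewrite (sum_deltal (fun m => d 0 m * tens w i j m)).
  have -> : \sum_m diag_mx d i m * tens w m j l = d 0 i * tens w i j l.
    under eq_bigr => m _ do rewrite Dd -mulrA.
    by rewrite (sum_deltal (fun m => d 0 i * tens w m j l)).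
  by move=> h; apply: (by_eq h); ring.
have dwt i : d 0 i = (wt i).1%:~R * d 0 0 + (wt i).2%:~R * d 0 1.
  elim/ord3P: i => /=; rewrite ?mulr0z ?mulr1z ?mulrN1z; try ring.
  by apply: (by_eq e1); ring.
have ewt (i j l : 'I_3) : d 0 j + d 0 l - d 0 i =
    (wt3 i j l).1%:~R * d 0 0 + (wt3 i j l).2%:~R * d 0 1.
  rewrite (dwt i) (dwt j) (dwt l) /wt3 /= !(rmorphB, rmorphD) /=; ring.
have [i [j [l T0]]] := tens_neq0 fol.
apply: (@foliation_no_variable w (if i == j then l else j) fol).
move=> i' j' l' T0'; apply: (@wt3_monomial i j l i' j' l').
have := E i j l; have := E i' j' l'; move/eqP.
rewrite mulf_eq0 (negPf T0') orbF => /eqP h' /eqP.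
rewrite mulf_eq0 (negPf T0) orbF => /eqP h.
move: h h'; rewrite !ewt; case: (wt3 i j l) (wt3 i' j' l') => p q [p' q'] /= h h'.
have [|p0 q0] := @cube_root_weights _ _ _ (p - p') (q - q') e1 e2 a0.
  by rewrite !rmorphB /=; apply: (by_eq (eqD h (eqZ (-1) h'))); ring.
by congr pair; apply/eqP; rewrite -subr_eq0 ?p0 ?q0.
Qed.

End Semisimple.

(** * Regular nilpotent elements *)

Section Nilpotent.
Variable C : numClosedFieldType.
Implicit Types (w u : oneform C 3) (M N A B P : 'M[C]_3) (T S : 'I_3 -> 'M[C]_3).

Lemma regular_nilpotent_eq T :
  inf_iso T (delta_mx 1 0 + delta_mx 2 1) -> exists c, forall i j k,
    c * T i j k = t3 (T i 1 k) (T i 2 k) 0 j + t3 (T i j 1) (T i j 2) 0 k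
                  - t3 0 (T 0 j k) (T 1 j k) i.
Proof.
move=> [c Ec]; exists c => i j k; rewrite -Ec !sum3 !mxE /=.
by elim/ord3P: i; elim/ord3P: j; elim/ord3P: k; rewrite !t3E /=; ring.
Qed.

Lemma rank_one_nilpotent_eq T :
  inf_iso T (delta_mx 2 0) -> exists c, forall i j k,
    c * T i j k = t3 (T i 2 k) 0 0 j + t3 (T i j 2) 0 0 k - t3 0 0 (T 0 j k) i.
Proof.
move=> [c Ec]; exists c => i j k; rewrite -Ec !sum3 !mxE /=.
by elim/ord3P: i; elim/ord3P: j; elim/ord3P: k; rewrite !t3E /=; ring.
Qed.

(** The eigenvalue c of the nilpotent N on T is zero, since N acts
    nilpotently on tensors.  The remaining linear equations leave the fields
    (0, b X^2, a X^2 + b XY + 4 s (Y^2 - 2 XZ)) modulo the radial field. *)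
Lemma regular_nilpotent_tensor T : normal T ->
  (exists i j k, T i j k != 0) -> inf_iso T (delta_mx 1 0 + delta_mx 2 1) ->
  [/\ T 0 0 0 = 2 * T 1 0 1, T 0 0 1 = 0 & T 0 0 2 = 0] /\
  [/\ T 0 1 1 = 0, T 0 1 2 = 0 & T 0 2 2 = 0] /\
  [/\ T 1 0 2 = 0, T 1 1 1 = 0, T 1 1 2 = 0 & T 1 2 2 = 0] /\
  [/\ 2 * T 2 0 1 = T 1 0 0, T 2 0 2 = -3 * T 1 0 1, T 2 1 1 = 4 * T 1 0 1,
      T 2 1 2 = 0 & T 2 2 2 = 0].
Proof.
move=> [sT tT] Tn0 /regular_nilpotent_eq[c E].
have t0 := tT 0; have t1 := tT 1; rewrite !sum3 in t0 t1.
rewrite (sT 1 1 0) (sT 2 2 0) in t0; rewrite (sT 2 2 1) in t1.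
have c0 : c = 0.
  apply: contraPeq Tn0 => c0 [i [j [k /eqP]]]; apply.
  have T022 : T 0 2 2 = 0.
    by apply: (mulfI c0); rewrite E !t3E; ring.
  have T012 : T 0 1 2 = 0.
    by apply: (mulfI c0); rewrite E !t3E T022; ring.
  have T011 : T 0 1 1 = 0.
    by apply: (mulfI c0); rewrite E !t3E (sT 0 2 1) T012; ring.
  have T002 : T 0 0 2 = 0.
    by apply: (mulfI c0); rewrite E !t3E T012; ring.
  have T001 : T 0 0 1 = 0.
    by apply: (mulfI c0); rewrite E !t3E T011 T002; ring.
  have T000 : T 0 0 0 = 0.
    by apply: (mulfI c0); rewrite E !t3E (sT 0 1 0) T001; ring.
  have T122 : T 1 2 2 = 0.
    by apply: (mulfI c0); rewrite E !t3E T022; ring.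
  have T112 : T 1 1 2 = 0.
    by apply: (mulfI c0); rewrite E !t3E T122 T012; ring.
  have T111 : T 1 1 1 = 0.
    by apply: (mulfI c0); rewrite E !t3E (sT 1 2 1) T112 T011; ring.
  have T102 : T 1 0 2 = 0.
    by apply: (mulfI c0); rewrite E !t3E T112 T002; ring.
  have T101 : T 1 0 1 = 0.
    by apply: (mulfI c0); rewrite E !t3E T111 T102 T001; ring.
  have T100 : T 1 0 0 = 0.
    by apply: (mulfI c0); rewrite E !t3E (sT 1 1 0) T101 T000; ring.
  have T222 : T 2 2 2 = 0.
    by apply: (mulfI c0); rewrite E !t3E T122; ring.
  have T212 : T 2 1 2 = 0.
    by apply: (mulfI c0); rewrite E !t3E T222 T112; ring.
  have T211 : T 2 1 1 = 0.
    by apply: (mulfI c0); rewrite E !t3E (sT 2 2 1) T212 T111; ring.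
  have T202 : T 2 0 2 = 0.
    by apply: (mulfI c0); rewrite E !t3E T212 T102; ring.
  have T201 : T 2 0 1 = 0.
    by apply: (mulfI c0); rewrite E !t3E T211 T202 T101; ring.
  have T200 : T 2 0 0 = 0.
    by apply: (mulfI c0); rewrite E !t3E (sT 2 1 0) T201 T100; ring.
  by elim/ord3P: i; elim/ord3P: j; elim/ord3P: k; rewrite // sT.
move: E; rewrite c0 => E.
have T022 : T 0 2 2 = 0.
  by have := E 0 1 2; rewrite !t3E => e; apply: (by_eq (eqZ (-1) e)); ring.
have T012 : T 0 1 2 = 0.
  apply: (@mulf_natI C 1); have := E 0 1 1; rewrite !t3E (sT 0 2 1) => e.
  by apply: (by_eq (eqZ (-1) e)); ring.
have e001 : T 0 1 1 + T 0 0 2 = 0.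
  by have := E 0 0 1; rewrite !t3E => e; apply: (by_eq (eqZ (-1) e)); ring.
have T001 : T 0 0 1 = 0.
  apply: (@mulf_natI C 1); have := E 0 0 0; rewrite !t3E (sT 0 1 0) => e.
  by apply: (by_eq (eqZ (-1) e)); ring.
have T122 : T 1 2 2 = 0.
  have := E 1 1 2; rewrite !t3E T012 => e.
  by apply: (by_eq (eqZ (-1) e)); ring.
have e111 : T 0 1 1 = 2 * T 1 1 2.
  have := E 1 1 1; rewrite !t3E (sT 1 2 1) => e.
  by apply: (by_eq e); ring.
have e102 : T 0 0 2 = T 1 1 2.
  by have := E 1 0 2; rewrite !t3E => e; apply: (by_eq e); ring.
have T112 : T 1 1 2 = 0.
  apply: (@mulf_natI C 2); move: e001; rewrite e111 e102 => e.
  by apply: (by_eq e); ring.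
rewrite T112 in e102; rewrite T112 mulr0 in e111.
have e101 : T 1 0 2 = - T 1 1 1.
  have := E 1 0 1; rewrite !t3E T001 => e.
  by apply: (by_eq (eqZ (-1) e)); ring.
have e100 : T 0 0 0 = 2 * T 1 0 1.
  by have := E 1 0 0; rewrite !t3E (sT 1 1 0) => e; apply: (by_eq e); ring.
have T222 : T 2 2 2 = 0.
  have := E 2 1 2; rewrite !t3E T112 => e.
  by apply: (by_eq (eqZ (-1) e)); ring.
have e211 : T 1 1 1 = 2 * T 2 1 2.
  by have := E 2 1 1; rewrite !t3E (sT 2 2 1) => e; apply: (by_eq e); ring.
have e202 : T 2 1 2 = T 1 0 2.
  have := E 2 0 2; rewrite !t3E => e.
  by apply: (by_eq (eqZ (-1) e)); ring.
have T111 : T 1 1 1 = 0.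
  apply: (@mulf_natI C 2); move: e211; rewrite e202 e101 => e.
  by apply: (by_eq e); ring.
rewrite T111 oppr0 in e101; rewrite e101 in e202.
have e201 : T 2 1 1 + T 2 0 2 = T 1 0 1.
  have := E 2 0 1; rewrite !t3E => e.
  by apply: (by_eq (eqZ (-1) e)); ring.
have e200 : 2 * T 2 0 1 = T 1 0 0.
  have := E 2 0 0; rewrite !t3E (sT 2 1 0) => e.
  by apply: (by_eq (eqZ (-1) e)); ring.
have T202 : T 2 0 2 = -3 * T 1 0 1.
  by apply: (by_eq (eqD t0 (eqZ (-1) e100))); ring.
by do !split=> //; apply: (by_eq (eqD e201 (eqZ (-1) T202))); ring.
Qed.

(** Of the parameters left by [regular_nilpotent_tensor], if s = 0 then X
    divides the field, and if b = 0 then V has, modulo the radial field, a single nonzero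
    component, which divides the form.  Otherwise the equations of the isotropy
    algebra have no solutions but the combinations of 1 and N. *)
Lemma regular_nilpotent_not_foliation w : foliation 2 w ->
  inf_iso (tens w) (delta_mx 1 0 + delta_mx 2 1) -> ~ big_iso (tens w).
Proof.
move=> fol iN gT; have nT := tens_normal w; have [sT _] := nT.
have := regular_nilpotent_tensor nT (tens_neq0 fol) iN.
have := form_of_tens (foliation_is_form fol).
have nov := foliation_no_variable fol.
move: (tens w) sT gT nov {iN nT} => T sT gT nov Ew.
case=> -[T000 T001 T002] [] [T011 T012 T022] [] [T102 T111 T112 T122].
move=> [T201 T202 T211 T212 T222].
move: T000 T202 T211 T201; set s := T 1 0 1; set b := T 1 0 0.
move=> T000 T202 T211 T201.
have {}T201 : T 2 0 1 = b / 2.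
  by apply: (@mulf_natI C 1); rewrite T201 mulrC divfK // pnatr_eq0.
have s0 : s != 0.
  apply/eqP => s0; apply: (nov 0) => i j k; apply: contraNT.
  rewrite negb_or; move: T000 T202 T211; rewrite s0 !mulr0 => T000 T202 T211.
  elim/ord3P: j => //; elim/ord3P: k => //= _;
  by elim/ord3P: i; rewrite ?(sT _ 2 1) ?T011 ?T012 ?T022 ?T111 ?T112 ?T122
    ?T211 ?T212 ?T222.
have b0 : b != 0.
  apply/eqP => b0; move: T201; rewrite b0 mul0r => T201.
  pose q : {mpoly C[3]} := T 2 0 0 *: 'X_0 ^+ 2 + (4 * s) *: 'X_1 ^+ 2
     - (8 * s) *: ('X_0 * 'X_2).
  apply: (@foliation_no_factor _ w q (fun=> 0) fol).
    by rewrite /q mevalB mevalD !mevalZ !mevalM !mevalXU; ring.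
  pose g : 'I_3 -> {mpoly C[3]} := t3 (- 'X_1) 'X_0 0.
  move=> i; exists (g i); rewrite -Ew; apply: mpoly_eval_eq => x.
  apply: (etrans (ev_form_of _ _ _)); rewrite mevalM.
  have -> : q.@[x] = T 2 0 0 * x 0 ^+ 2 + 4 * s * x 1 ^+ 2 - 8 * s * (x 0 * x 2).
    by rewrite /q mevalB mevalD !mevalZ !mevalM !mevalXU; ring.
  elim/ord3P: i; rewrite /fm /cross !t3E !vfE // ?T000 ?T001 ?T002 ?T011 ?T012 ?T022
    -/s -/b ?b0 ?T102 ?T111 ?T112 ?T122 ?T201 ?T202 ?T211 ?T212 ?T222
    ?mevalN ?mevalXU ?meval0; ring.
pose J : 'M[C]_3 := delta_mx 1 0 + delta_mx 2 1.
have [B [[c Ec] nB]] := gT J.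
have {}Ec i j k := Ec i j k.
have e001 := Ec 0 0 1; have e011 := Ec 0 1 1; have e111 := Ec 1 1 1.
have e100 := Ec 1 0 0; have e000 := Ec 0 0 0; have e211 := Ec 2 1 1.
have e201 := Ec 2 0 1; have e200 := Ec 2 0 0.
rewrite !sum3 ?(sT _ 1 0) ?(sT _ 2 0) ?(sT _ 2 1)
 ?T000 ?T001 ?T002 ?T011 ?T012 ?T022 -/s -/b
 ?T102 ?T111 ?T112 ?T122 ?T201 ?T202 ?T211 ?T212 ?T222
 in e001 e011 e111 e100 e000 e211 e201 e200.
have cancel (x y : C) : s * x = s * y -> x = y by move/(mulfI s0).
have B02 : B 0 2 = 0.
  by apply: (@mulf_natI C 3); apply: cancel; apply: (by_eq (eqZ (-1) e011)); ring.
have B01 : B 0 1 = 0.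
  by apply: cancel; apply: (by_eq e001); rewrite B02; ring.
have B12 : B 1 2 = 0.
  apply: (@mulf_natI C 3); apply: cancel; apply: (by_eq (eqZ (-1) e111)).
  by rewrite B01; ring.
have Bc : c = B 0 0.
  apply: (@mulf_natI C 1); apply: cancel; apply: (by_eq (eqZ (-1) e000)).
  by rewrite B01 B02; ring.
have B11 : B 1 1 = B 0 0.
  apply: (mulfI b0); apply: (by_eq (eqZ (-1) e100)).
  by rewrite B12 Bc; ring.
have B22 : B 2 2 = B 0 0.
  apply: (@mulf_natI C 3); apply: cancel; apply: (by_eq (eqZ (-1) e211)).
  by rewrite B01 B11 Bc; ring.
have B21 : B 2 1 = B 1 0.
  apply: (@mulf_natI C 3); apply: cancel; apply: (by_eq (eqZ (-1) e201)).
  by rewrite B01 B11 B22 Bc; field.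
have B20 : B 2 0 = 0.
  apply: (@mulf_natI C 7); apply: cancel; apply: (by_eq (eqZ (-1) e200)).
  by rewrite B21 B22 Bc; field.
apply: (nB (B 0 0) (B 1 0)); apply/matrixP => i j.
by elim/ord3P: i; elim/ord3P: j; rewrite !mxE /= ?mulr1n ?mulr0n; 
  rewrite ?(B01, B02, B11, B12, B20, B21, B22); ring.
Qed.

End Nilpotent.

(** * Nilpotent elements of rank one *)

Section RankOne.
Variable C : numClosedFieldType.
Implicit Types (w u : oneform C 3) (M N A B P L : 'M[C]_3) (T S : 'I_3 -> 'M[C]_3).
Implicit Types (x m : 'I_3 -> C).

Definition binary_form (a b c : C) : 'M[C]_3 :=
  \matrix_(i, j) t3 (t3 a b 0 j) (t3 b c 0 j) 0 i.

(** The field (0, q(X, Y), r(X, Y)). *)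
Definition planar (q0 q1 q2 r0 r1 r2 : C) : 'I_3 -> 'M[C]_3 :=
  t3 0 (binary_form q0 q1 q2) (binary_form r0 r1 r2).

Lemma vf_planar q0 q1 q2 r0 r1 r2 x :
  vf (planar q0 q1 q2 r0 r1 r2) x =1
  t3 0 (q0 * x 0 ^+ 2 + 2 * q1 * (x 0 * x 1) + q2 * x 1 ^+ 2)
       (r0 * x 0 ^+ 2 + 2 * r1 * (x 0 * x 1) + r2 * x 1 ^+ 2).
Proof.
by elim/ord3P; rewrite /vf !sum3 /planar !t3E !mxE ?t3E; ring.
Qed.

(** The added term is the field 2 (\sum_j m_j x_j) X, which is invisible in
    V x X. *)
Lemma fm_add_radial T S m x i :
  (forall i j k, T i j k = S i j k + (m j * (i == k)%:R + m k * (i == j)%:R)) ->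
  fm T x i = fm S x i.
Proof.
move=> ET.
have EV l : vf T x l = vf S x l + 2 * (\sum_j m j * x j) * x l.
  by elim/ord3P: l; rewrite /vf !sum3 !ET /=; ring.
by elim/ord3P: i; rewrite /fm /cross !t3E !EV; ring.
Qed.

Lemma inf_add_radial T S m B :
  (forall i j k, T i j k = S i j k + (m j * (i == k)%:R + m k * (i == j)%:R)) ->
  inf_iso T B -> exists c (l : 'I_3 -> C), forall i j k,
    \sum_m B m j * S i m k + \sum_n S i j n * B n k - \sum_l B i l * S l j k
      = c * S i j k + (l j * (i == k)%:R + l k * (i == j)%:R).
Proof.
move=> ET [c Ec]; exists c, (fun j => c * m j - \sum_a B a j * m a) => i j k.
apply: (by_eq (Ec i j k)); rewrite !sum3 !ET.
by elim/ord3P: i; elim/ord3P: j; elim/ord3P: k; rewrite /=; ring.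
Qed.

(** As in the regular case, c = 0, so that V commutes with N = X d/dZ.  This means
    that V_0 and V_1 do not depend on Z and that X dV_2/dZ = V_0.  Hence
    V_0 = X l and V_2 = Z l + r(X, Y) with l linear in X, Y, and subtracting l
    times the radial field leaves (0, q, r); the [t3] terms are the multiple of
    the radial field that makes the divergence zero again. *)
Lemma rank_one_nilpotent_tensor T : normal T ->
  (exists i j k, T i j k != 0) -> inf_iso T (delta_mx 2 0) ->
  exists q0 q1 q2 r0 r1 r2, forall i j k, T i j k =
    planar q0 q1 q2 r0 r1 r2 i j k + (t3 (- q1 / 4) (- q2 / 4) 0 j * (i == k)%:R
                                      + t3 (- q1 / 4) (- q2 / 4) 0 k * (i == j)%:R).
Proof.
move=> [sT tT] Tn0 /rank_one_nilpotent_eq[c E].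
have t0 := tT 0; have t1 := tT 1; rewrite !sum3 in t0 t1.
rewrite (sT 1 1 0) (sT 2 2 0) in t0; rewrite (sT 2 2 1) in t1.
have c0 : c = 0.
  apply: contraPeq Tn0 => c0 [i [j [k /eqP]]]; apply.
  have Z0 j' k' : j' != 0 -> k' != 0 -> T 0 j' k' = 0.
    move=> j0 k0; apply: (mulfI c0); rewrite E.
    by elim/ord3P: j' j0 => //; elim/ord3P: k' k0 => // _ _; rewrite !t3E; ring.
  have Z1 j' k' : j' != 0 -> k' != 0 -> T 1 j' k' = 0.
    move=> j0 k0; apply: (mulfI c0); rewrite E.
    by elim/ord3P: j' j0 => //; elim/ord3P: k' k0 => // _ _; rewrite !t3E; ring.
  have T001 : T 0 0 1 = 0.
    by apply: (mulfI c0); rewrite E !t3E (Z0 2 1) //; ring.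
  have T002 : T 0 0 2 = 0.
    by apply: (mulfI c0); rewrite E !t3E (Z0 2 2) //; ring.
  have T000 : T 0 0 0 = 0.
    by apply: (mulfI c0); rewrite E !t3E (sT 0 2 0) T002; ring.
  have T101 : T 1 0 1 = 0.
    by apply: (mulfI c0); rewrite E !t3E (Z1 2 1) //; ring.
  have T102 : T 1 0 2 = 0.
    by apply: (mulfI c0); rewrite E !t3E (Z1 2 2) //; ring.
  have T100 : T 1 0 0 = 0.
    by apply: (mulfI c0); rewrite E !t3E (sT 1 2 0) T102; ring.
  have Z2 j' k' : j' != 0 -> k' != 0 -> T 2 j' k' = 0.
    move=> j0 k0; apply: (mulfI c0); rewrite E.
    elim/ord3P: j' j0 => //; elim/ord3P: k' k0 => // _ _; rewrite !t3E Z0 //; ring.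
  have T201 : T 2 0 1 = 0.
    by apply: (mulfI c0); rewrite E !t3E (Z2 2 1) // T001; ring.
  have T202 : T 2 0 2 = 0.
    by apply: (mulfI c0); rewrite E !t3E (Z2 2 2) // T002; ring.
  have T200 : T 2 0 0 = 0.
    by apply: (mulfI c0); rewrite E !t3E (sT 2 2 0) T202 T000; ring.
  by elim/ord3P: i; elim/ord3P: j; elim/ord3P: k;
    rewrite ?(sT _ 1 0) ?(sT _ 2 0) // ?Z0 ?Z1 ?Z2.
move: E; rewrite c0 => E.
have T002 : T 0 0 2 = 0.
  apply: (@mulf_natI C 1); have := E 0 0 0; rewrite !t3E (sT 0 2 0) => e.
  by apply: (by_eq (eqZ (-1) e)); ring.
have T012 : T 0 1 2 = 0.
  have := E 0 0 1; rewrite !t3E (sT 0 2 1) => e.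
  by apply: (by_eq (eqZ (-1) e)); ring.
have T022 : T 0 2 2 = 0.
  by have := E 0 0 2; rewrite !t3E => e; apply: (by_eq (eqZ (-1) e)); ring.
have T102 : T 1 0 2 = 0.
  apply: (@mulf_natI C 1); have := E 1 0 0; rewrite !t3E (sT 1 2 0) => e.
  by apply: (by_eq (eqZ (-1) e)); ring.
have T112 : T 1 1 2 = 0.
  have := E 1 0 1; rewrite !t3E (sT 1 2 1) => e.
  by apply: (by_eq (eqZ (-1) e)); ring.
have T122 : T 1 2 2 = 0.
  by have := E 1 0 2; rewrite !t3E => e; apply: (by_eq (eqZ (-1) e)); ring.
have T000 : T 0 0 0 = 2 * T 2 0 2.
  have := E 2 0 0; rewrite !t3E (sT 2 2 0) => e.
  by apply: (by_eq e); ring.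
have T001 : T 0 0 1 = T 2 1 2.
  have := E 2 0 1; rewrite !t3E (sT 2 2 1) => e.
  by apply: (by_eq e); ring.
have T222 : T 2 2 2 = 0.
  have := E 2 0 2; rewrite !t3E T002 => e.
  by apply: (by_eq (eqZ (-1) e)); ring.
have T011 : T 0 1 1 = 0.
  by have := E 2 1 1; rewrite !t3E => e; apply: (by_eq e); ring.
have T101 : T 1 0 1 = -3 * T 2 0 2.
  by apply: (by_eq (eqD t0 (eqZ (-1) T000))); ring.
have T111 : T 1 1 1 = -2 * T 2 1 2.
  by apply: (by_eq (eqD t1 (eqZ (-1) T001))); ring.
exists (T 1 0 0), (4 / 3 * T 1 0 1), (2 * T 1 1 1), (T 2 0 0), (T 2 0 1), (T 2 1 1).
move=> i j k; elim/ord3P: i; elim/ord3P: j; elim/ord3P: k;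
  rewrite /planar !t3E !mxE ?t3E /= ?(sT _ 1 0) ?(sT _ 2 0) ?(sT _ 2 1)
    ?T000 ?T001 ?T002 ?T011 ?T012 ?T022 ?T101 ?T102 ?T111 ?T112 ?T122 ?T222;
  by field.
Qed.

(** If q and r have a common zero (u : v), the form is divisible by the line
    v X - u Y. *)
Lemma planar_common_point w q0 q1 q2 r0 r1 r2 (u v : C) :
  foliation 2 w -> (forall x i, ev w x i = fm (planar q0 q1 q2 r0 r1 r2) x i) ->
  (u != 0) || (v != 0) ->
  q0 * u ^+ 2 + 2 * q1 * (u * v) + q2 * v ^+ 2 = 0 ->
  r0 * u ^+ 2 + 2 * r1 * (u * v) + r2 * v ^+ 2 = 0 -> False.
Proof.
move=> fol Ew uv qz rz.
have key (a b c x0 x1 : C) : v * x0 = u * x1 ->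
    a * u ^+ 2 + 2 * b * (u * v) + c * v ^+ 2 = 0 ->
    a * x0 ^+ 2 + 2 * b * (x0 * x1) + c * x1 ^+ 2 = 0.
  move=> x01 abc; have [u0|v0] := orP uv.
    apply: (mulfI (expf_neq0 2 u0)); rewrite mulr0.
    apply: (by_eq (eqD (eqZ (x0 ^+ 2) abc)
      (eqZ (- (2 * b * u * x0 + c * (u * x1 + v * x0))) x01))); ring.
  apply: (mulfI (expf_neq0 2 v0)); rewrite mulr0.
  apply: (by_eq (eqD (eqZ (x1 ^+ 2) abc)
    (eqZ (2 * b * v * x1 + a * (v * x0 + u * x1)) x01))); ring.
have line x : \sum_i t3 v (- u) 0 i * x i = 0 -> v * x 0 = u * x 1.
  by rewrite sum3 !t3E => e; apply: (by_eq e); ring.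
have [k lk] : exists k, t3 v (- u) 0 k != 0.
  by case/orP: uv => h; [exists 1|exists 0]; rewrite !t3E ?oppr_eq0.
apply: (@foliation_no_line _ w (t3 v (- u) 0) k fol lk) => x /line x01 i.
rewrite Ew; elim/ord3P: i; rewrite /fm /cross !t3E !vf_planar !t3E !(key _ _ _ _ _ x01) //;
  ring.
Qed.

(** The quadratic form p divides the form when q = a p and r = b p. *)
Lemma planar_common_factor w p0 p1 p2 a b :
  foliation 2 w ->
  (forall x i, ev w x i =
     fm (planar (a * p0) (a * p1) (a * p2) (b * p0) (b * p1) (b * p2)) x i) ->
  False.
Proof.
move=> fol Ew; pose p : {mpoly C[3]} :=
  p0 *: 'X_0 ^+ 2 + (2 * p1) *: ('X_0 * 'X_1) + p2 *: 'X_1 ^+ 2.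
have Ep x : p.@[x] = p0 * x 0 ^+ 2 + 2 * p1 * (x 0 * x 1) + p2 * x 1 ^+ 2.
  by rewrite /p !mevalD !mevalZ !mevalM !mevalXU; ring.
apply: (@foliation_no_factor _ w p (fun=> 0) fol); first by rewrite Ep; ring.
pose g : 'I_3 -> {mpoly C[3]} :=
  t3 (a *: 'X_2 - b *: 'X_1) (b *: 'X_0) (- a *: 'X_0).
move=> i; exists (g i); apply: mpoly_eval_eq => x; apply: (etrans (Ew x i)).
rewrite mevalM Ep; elim/ord3P: i; rewrite /fm /cross !t3E !vf_planar !t3E
  ?mevalB !mevalZ !mevalXU; ring.
Qed.

(** Fields conjugate by a linear map give forms in the same orbit. *)
Lemma orbit_of_vf T S L : \det L != 0 ->
  (forall x i, vf T (mapv L x) i = mapv L (vf S x) i) ->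
  PGL3_orbit (form_of T) (form_of S).
Proof.
move=> dL ES; exists L; first by rewrite unitmxE unitfE.
exists (\det L)^-1; first by rewrite invr_eq0.
apply: ev_inj => x j.
transitivity ((\det L)^-1 * fm (act L T) x j); last first.
  rewrite pullback_form_of -ev_form_of /ev [in RHS]mxE mevalM mevalC //.
rewrite ev_form_of; apply: (mulfI dL); rewrite mulrA mulfV // mul1r.
have V i : vf (act L T) x i = \det L * vf S x i.
  rewrite vf_act -det3E -adj3_mapv; apply: eq_bigr => k _.
  by rewrite ES.
by elim/ord3P: j; rewrite /fm /cross !t3E !V; ring.
Qed.

End RankOne.

(** * Classification *)

Section RankOneClassification.
Variable C : numClosedFieldType.
Implicit Types (w u : oneform C 3) (M N A B P L : 'M[C]_3) (T S : 'I_3 -> 'M[C]_3).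
Implicit Types (x : 'I_3 -> C).

Definition field_F1 : 'I_3 -> 'M[C]_3 := planar 1 0 0 0 0 1.

(** A field defining F5; it is not of divergence zero, see [tensor_F5]. *)
Definition field_F5 : 'I_3 -> 'M[C]_3 :=
  t3 (binary_form (-1) 0 0) 0 (binary_form 0 0 1).

Lemma vf_field_F5 x : vf field_F5 x =1 t3 (- x 0 ^+ 2) 0 (x 1 ^+ 2).
Proof. by elim/ord3P; rewrite /vf !sum3 /field_F5 !t3E !mxE ?t3E; ring. Qed.

Lemma evD (u v : 'rV[{mpoly C[3]}]_3) x i : ev (u + v) x i = ev u x i + ev v x i.
Proof. by rewrite /ev mxE mevalD. Qed.

Lemma evB (u v : 'rV[{mpoly C[3]}]_3) x i : ev (u - v) x i = ev u x i - ev v x i.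
Proof. by rewrite /ev mxE [X in _ + X]mxE mevalB. Qed.

Lemma evZ p (u : 'rV[{mpoly C[3]}]_3) x i : ev (p *: u) x i = p.@[x] * ev u x i.
Proof. by rewrite /ev mxE mevalM. Qed.

Lemma ev_dX (i j : 'I_3) x : ev (dX C i) x j = (i == j)%:R.
Proof.
by rewrite /ev /dX mxE eqxx /= eq_sym; case: eqP => _; rewrite ?meval1 ?meval0.
Qed.

Lemma mevalX2 (n : nat) (i : 'I_n) (x : 'I_n -> C) :
  ('X_i ^+ 2 : {mpoly C[n]}).@[x] = x i ^+ 2.
Proof. by rewrite rmorphXn /= mevalXU. Qed.

Lemma ev_comb p q r p' q' r' (a b a' b' : 'rV[{mpoly C[3]}]_3) x i :
  ev (p *: (q *: a - r *: b) + p' *: (q' *: a' - r' *: b')) x i =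
  p.@[x] * (q.@[x] * ev a x i - r.@[x] * ev b x i)
  + p'.@[x] * (q'.@[x] * ev a' x i - r'.@[x] * ev b' x i).
Proof. by rewrite evD !evZ !evB !evZ. Qed.

Lemma ev_F1 x i :
  ev (F1 C) x i = t3 (x 0 ^+ 2 * x 2 - x 1 ^+ 3) (x 0 * x 1 ^+ 2) (- x 0 ^+ 3) i.
Proof.
apply: etrans (ev_comb _ _ _ _ _ _ _ _ _ _ x i) _.
rewrite !mevalX2 !mevalXU !ev_dX.
by elim/ord3P: i; rewrite !t3E /=; ring.
Qed.

Lemma ev_F5 x i :
  ev (F5 C) x i = t3 (- x 1 ^+ 3) (x 0 ^+ 2 * x 2 + x 0 * x 1 ^+ 2)
                     (- (x 0 ^+ 2 * x 1)) i.
Proof.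
apply: etrans (ev_comb _ _ _ _ _ _ _ _ _ _ x i) _.
rewrite !mevalX2 !mevalXU !ev_dX.
by elim/ord3P: i; rewrite !t3E /=; ring.
Qed.

Lemma F1E : F1 C = form_of field_F1.
Proof.
apply: ev_inj => x i; apply: etrans _ (esym (ev_form_of field_F1 x i)).
rewrite ev_F1; elim/ord3P: i; rewrite /fm /cross !t3E !vf_planar !t3E; ring.
Qed.

Lemma F5E : F5 C = form_of field_F5.
Proof.
apply: ev_inj => x i; apply: etrans _ (esym (ev_form_of field_F5 x i)).
rewrite ev_F5; elim/ord3P: i; rewrite /fm /cross !t3E !vf_field_F5 !t3E; ring.
Qed.

(** L is of the form (X, g X + b Y, e Y + d Z); its parameters are found by
    matching coefficients. *)
Lemma orbit_planar_F1 q0 r0 r1 r2 : q0 != 0 -> r2 != 0 ->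
  PGL3_orbit (form_of field_F1) (form_of (planar q0 0 0 r0 r1 r2)).
Proof.
move=> q00 r20; pose b := q0^-1; pose d := b ^+ 2 / r2; pose g := d * r1 / b.
pose e := (g ^+ 2 - d * r0) / q0.
pose L : 'M[C]_3 := \matrix_(i, j) t3 (t3 1 0 0 j) (t3 g b 0 j) (t3 0 e d j) i.
apply: (@orbit_of_vf _ _ _ L).
  rewrite -det3E /det3 sum3 /L !mxE /cross !t3E ?mxE ?ordE ?t3E.
  rewrite (_ : _ + _ + _ = b * d); last by ring.
  by rewrite /d /b !mulf_neq0 ?expf_neq0 ?invr_neq0.
move=> x i; rewrite (vf_planar _ _ _ _ _ _ _ i).
have LE y j : mapv L y j = t3 (y 0) (g * y 0 + b * y 1) (e * y 1 + d * y 2) j.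
  by elim/ord3P: j; rewrite /mapv sum3 !mxE ?t3E; ring.
rewrite !LE; elim/ord3P: i; rewrite !t3E !vf_planar !t3E ?LE ?t3E.
- by [].
- rewrite /b; by field.
by rewrite /e /g /d /b; field; rewrite ?r20 ?q00.
Qed.

(** Here q = q2 (s X + Y)^2 and r = p X^2 + (r2 / q2) q, so s X + Y and X
    are the new coordinates, and Z is changed to eliminate q from r. *)
Lemma orbit_planar_F5 s q2 p r2 : q2 != 0 -> p != 0 ->
  PGL3_orbit (form_of field_F5)
    (form_of (planar (s ^+ 2 * q2) (s * q2) q2 (p + s ^+ 2 * r2) (s * r2) r2)).
Proof.
move=> q20 p0; pose k := - q2; pose d := p^-1; pose e := - (d * r2 / q2).
pose L : 'M[C]_3 := \matrix_(i, j) t3 (t3 (k * s) k 0 j) (t3 1 0 0 j) (t3 0 e d j) i.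
apply: (@orbit_of_vf _ _ _ L).
  rewrite -det3E /det3 sum3 /L !mxE /cross !t3E ?mxE ?ordE ?t3E.
  rewrite (_ : _ + _ + _ = q2 * d); last by rewrite /k; ring.
  by rewrite /d mulf_neq0 ?invr_neq0.
move=> x i; rewrite (vf_field_F5 _ i).
have LE y j : mapv L y j = t3 (k * (s * y 0 + y 1)) (y 0) (e * y 1 + d * y 2) j.
  by elim/ord3P: j; rewrite /mapv sum3 !mxE ?t3E; ring.
rewrite !LE; elim/ord3P: i; rewrite !t3E !vf_planar !t3E ?LE ?t3E.
- rewrite /k; ring.
- by [].
by rewrite /e /d; field; rewrite ?q20 ?p0.
Qed.

(** Let B be in the isotropy algebra outside the span of 1 and N = E_20.
    The foliation hypothesis excludes common zeros and proportionality of q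
    and r, which first makes B lower triangular.  Then (q, r) is an eigenvector
    of a triangular matrix, up to the terms l coming from the radial field, which
    vanish.  If q is a multiple of X^2, the model is F1; otherwise q is the square
    of a linear form containing Y and r is, up to a multiple of q, a multiple
    of X^2, so the model is F5. *)
Lemma rank_one_classification w : foliation 2 w ->
  inf_iso (tens w) (delta_mx 2 0) -> big_iso (tens w) ->
  PGL3_orbit (form_of field_F1) w \/ PGL3_orbit (form_of field_F5) w.
Proof.
move=> fol iN gT; pose J : 'M[C]_3 := delta_mx 2 0.
have [q0 [q1 [q2 [r0 [r1 [r2 ET]]]]]] :=
  rank_one_nilpotent_tensor (tens_normal w) (tens_neq0 fol) iN.
have Ew x i : ev w x i = fm (planar q0 q1 q2 r0 r1 r2) x i.
  rewrite -(fm_add_radial _ _ ET) -ev_form_of.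
  by rewrite (form_of_tens (foliation_is_form fol)).
have w_planar : w = form_of (planar q0 q1 q2 r0 r1 r2).
  by apply: ev_inj => x i; rewrite Ew; symmetry; apply: ev_form_of.
have point := planar_common_point fol Ew.
have factor p0 p1 p2 a b : q0 = a * p0 -> q1 = a * p1 -> q2 = a * p2 ->
    r0 = b * p0 -> r1 = b * p1 -> r2 = b * p2 -> False.
  move=> h0 h1 h2 k0 k1 k2.
  apply: (@planar_common_factor _ w p0 p1 p2 a b fol).
  by rewrite -h0 -h1 -h2 -k0 -k1 -k2.
have [B [iB nB]] := gT J.
have [c [l E]] := inf_add_radial ET iB.
have e000 := E 0 0 0; have e001 := E 0 0 1; have e011 := E 0 1 1.
have e002 := E 0 0 2; have e102 := E 1 0 2; have e112 := E 1 1 2.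
have e202 := E 2 0 2; have e212 := E 2 1 2; have e100 := E 1 0 0.
have e101 := E 1 0 1; have e111 := E 1 1 1; have e200 := E 2 0 0.
have e201 := E 2 0 1; have e211 := E 2 1 1.
move: e000 e001 e011 e002 e102 e112 e202 e212 e100 e101 e111 e200 e201 e211.
rewrite !sum3 /planar !t3E !mxE ?t3E /= => e000 e001 e011 e002 e102 e112 e202 e212.
move=> e100 e101 e111 e200 e201 e211.
have l2 : l 2 = 0 by apply: (by_eq (eqZ (-1) e002)); ring.
(* Two combinations of the equations in which q and r cancel; they imply
   that (B_02 : B_12) would be a common zero of q and r. *)
have h1 : 3 * (B 0 2 * l 0) + B 1 2 * l 1 = 0.
  apply: (by_eq (eqD (eqZ (- B 0 2) e000) (eqD (eqZ (- B 1 2) e001)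
    (eqD (eqZ (- B 0 1) e102) (eqZ (- B 0 2) e202))))); ring.
have h2 : 2 * (B 0 2 * l 1) = 0.
  apply: (by_eq (eqD (eqZ (- B 0 2) e001) (eqD (eqZ (- B 1 2) e011)
    (eqD (eqZ (- B 0 1) e112) (eqZ (- B 0 2) e212))))); rewrite l2; ring.
have Bl : B 0 2 * l 0 + B 1 2 * l 1 = 0.
  have [B02|B02] := eqVneq (B 0 2) 0.
    by move: h1; rewrite B02 => h1; apply: (by_eq h1); ring.
  have l1 : l 1 = 0.
    by apply: (mulfI B02); apply: (@mulf_natI C 1); rewrite h2; ring.
  have l0 : l 0 = 0.
    apply: (mulfI B02); apply: (@mulf_natI C 2); move: h1; rewrite l1 => h1.
    by apply: (by_eq h1); ring.
  by rewrite l0 l1; ring.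
have [B02 B12] : B 0 2 = 0 /\ B 1 2 = 0.
  have [B02|B02] := eqVneq (B 0 2) 0; first have [B12|B12] := eqVneq (B 1 2) 0.
  - by [].
  - case: (point (B 0 2) (B 1 2)); first by rewrite B12 orbT.
      by apply: (by_eq (eqD (eqZ (B 0 2) e102) (eqZ (B 1 2) e112))); rewrite l2; ring.
    apply: (by_eq (eqD Bl (eqD (eqZ (B 0 2) e202) (eqZ (B 1 2) e212)))); ring.
  - case: (point (B 0 2) (B 1 2)); first by rewrite B02.
      by apply: (by_eq (eqD (eqZ (B 0 2) e102) (eqZ (B 1 2) e112))); rewrite l2; ring.
    apply: (by_eq (eqD Bl (eqD (eqZ (B 0 2) e202) (eqZ (B 1 2) e212)))); ring.
rewrite B02 B12 in e000 e001 e011 e100 e101 e111 e200 e201 e202 e211 e212.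
have l0 : l 0 = 0 by apply: (by_eq (eqZ (-1) e202)); ring.
have l1 : l 1 = 0 by apply: (by_eq (eqZ (-1) e212)); ring.
rewrite l0 l1 in e000 e001 e011 e100 e101 e111 e200 e201 e211.
have B01 : B 0 1 = 0.
  apply/eqP/negPn/negP => B01; apply: (@factor r0 r1 r2 0 1); rewrite ?mul1r // mul0r;
    apply: (mulfI B01); rewrite mulr0.
  - by apply: (by_eq (eqZ (-1) e000)); ring.
  - by apply: (by_eq (eqZ (-1) e001)); ring.
  - by apply: (by_eq (eqZ (-1) e011)); ring.
rewrite B01 in e100 e101 e111 e200 e201 e211.
(* B_00 is subtracted and B_20 does not occur, because 1 acts by a scalar
   and N by zero; z is the eigenvalue of B - B_00 on the field. *)
pose a := B 1 1 - B 0 0; pose s := B 1 0; pose e := B 2 1.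
pose d := B 2 2 - B 0 0; pose z := c - B 0 0.
have f1 : 2 * s * q1 - a * q0 = z * q0 by apply: (by_eq e100); rewrite /s /a /z; ring.
have f2 : s * q2 = z * q1 by apply: (by_eq e101); rewrite /s /z; ring.
have f3 : a * q2 = z * q2 by apply: (by_eq e111); rewrite /a /z; ring.
have f4 : 2 * s * r1 - e * q0 - d * r0 = z * r0.
  by apply: (by_eq e200); rewrite /s /e /d /z; ring.
have f5 : s * r2 + a * r1 - e * q1 - d * r1 = z * r1.
  by apply: (by_eq e201); rewrite /s /a /e /d /z; ring.
have f6 : 2 * a * r2 - e * q2 - d * r2 = z * r2.
  by apply: (by_eq e211); rewrite /a /e /d /z; ring.
(* Otherwise B would be in the span of 1 and N. *)
have nspan : ~ [/\ a = 0, s = 0, e = 0 & d = 0].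
  case=> a0 s0 e0 d0; apply: (nB (B 0 0) (B 2 0)); apply/matrixP => i j.
  have B11 : B 1 1 = B 0 0 by apply/eqP; rewrite -subr_eq0; apply/eqP.
  have B22 : B 2 2 = B 0 0 by apply/eqP; rewrite -subr_eq0; apply/eqP.
  elim/ord3P: i; elim/ord3P: j; rewrite !mxE /= ?mulr1n ?mulr0n
    ?(B01, B02, B11, B12, B22, s0, e0); rewrite -?/s -?/e ?s0 ?e0; ring.
have qn0 : ~ [/\ q0 = 0, q1 = 0 & q2 = 0].
  by case=> *; apply: (@factor r0 r1 r2 0 1); rewrite ?mul1r ?mul0r.
have to_F1 : q1 = 0 -> q2 = 0 -> PGL3_orbit (form_of field_F1) w.
  move=> q10 q20; rewrite w_planar q10 q20; apply: orbit_planar_F1.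
    by apply/eqP => q00; apply: qn0.
  apply/eqP => r20; apply: (point 0 1); first by rewrite oner_eq0 orbT.
    by rewrite q10 q20; ring.
  by rewrite r20; ring.
clearbody a s e d z; clear e000 e001 e011 e100 e101 e111 e200 e201 e202 e211 e212
  e002 e102 e112 h1 h2 Bl.
have [q20|q20] := eqVneq q2 0.
  left; apply: to_F1 => //; apply/eqP/negPn/negP => q10.
  have z0 : z = 0.
    by apply: (mulIf q10); rewrite mul0r -f2 q20 mulr0.
  rewrite z0 in f1 f4 f5 f6.
  have r20 : r2 != 0.
    apply/eqP => r20; apply: (point 0 1); first by rewrite oner_eq0 orbT.
      by rewrite q20; ring.
    by rewrite r20; ring.
  have d2a : d = 2 * a.
    by apply: (mulIf r20); apply: (by_eq (eqZ (-1) f6)); rewrite q20; ring.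
  have [a0|a0] := eqVneq a 0.
    have s0 : s = 0.
      apply: (mulIf q10); apply: (@mulf_natI C 1); apply: (by_eq f1).
      by rewrite a0; ring.
    apply: nspan; split=> //; last by rewrite d2a a0 mulr0.
    by apply: (mulIf q10); apply: (by_eq (eqZ (-1) f5)); rewrite s0 a0 d2a a0; ring.
  apply: (point a (- s)); first by rewrite a0.
    by rewrite q20; apply: (by_eq (eqZ (- a) f1)); ring.
  apply: (@mulf_natI C 1); move: f4 f5; rewrite d2a => f4 f5.
  apply: (by_eq (eqD (eqZ (- a) f4) (eqD (eqZ e f1) (eqZ (2 * s) f5)))); ring.
have za : z = a by apply: (mulIf q20).
rewrite za in f1 f2 f4 f5 f6.
have [a0|a0] := eqVneq a 0.
  rewrite a0 in f2 f4 f5 f6; exfalso.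
  have s0 : s = 0 by apply: (mulIf q20); rewrite f2; ring.
  rewrite s0 in f4 f5; have [d0|d0] := eqVneq d 0.
    apply: nspan; split=> //; apply: (mulIf q20).
    by apply: (by_eq (eqZ (-1) f6)); rewrite d0; ring.
  have kd : d * (- e / d) = - e by rewrite mulrC divfK.
  apply: (factor q0 q1 q2 1 (- e / d)); rewrite ?mul1r //; apply: (mulfI d0).
  - by rewrite [RHS]mulrA kd; apply: (by_eq (eqZ (-1) f4)); ring.
  - by rewrite [RHS]mulrA kd; apply: (by_eq (eqZ (-1) f5)); ring.
  - by rewrite [RHS]mulrA kd; apply: (by_eq (eqZ (-1) f6)); ring.
pose t := s / a; have st : s = t * a by rewrite /t divfK.
have eq1 : q1 = t * q2.
  by apply: (mulfI a0); apply: (by_eq (eqZ (-1) f2)); rewrite st; ring.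
have eq0 : q0 = t ^+ 2 * q2.
  apply: (mulfI a0); apply: (@mulf_natI C 1); apply: (by_eq (eqZ (-1) f1)).
  by rewrite eq1 st; ring.
have qz : q0 * a ^+ 2 + 2 * q1 * (a * - s) + q2 * (- s) ^+ 2 = 0.
  by rewrite eq0 eq1 st; ring.
have [d0|d0] := eqVneq d 0.
  exfalso; apply: (point a (- s) _ qz); first by rewrite a0.
  rewrite d0 in f4 f6.
  apply: (by_eq (eqD (eqZ (- a) f4) (eqZ (t ^+ 2 * a) f6))).
  by rewrite eq0 st; ring.
have er1 : r1 = t * r2.
  apply: (mulfI d0); apply: (by_eq (eqD (eqZ (-1) f5) (eqZ t f6))).
  by rewrite eq1 st; ring.
pose p := r0 - t ^+ 2 * r2.
have er0 : r0 = p + t ^+ 2 * r2 by rewrite /p subrK.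
right; rewrite w_planar er0 er1 eq0 eq1; apply: orbit_planar_F5 => //.
apply/eqP => p0; apply: (point a (- s) _ qz); first by rewrite a0.
by rewrite er0 er1 p0 st; ring.
Qed.

Lemma is_form_F1 : is_form (F1 C).
Proof. rewrite F1E; exact: form_of_is_form. Qed.

Lemma is_form_F5 : is_form (F5 C).
Proof. rewrite F5E; exact: form_of_is_form. Qed.

Lemma inf_iso_ext T T' A :
  (forall i j k, T i j k = T' i j k) -> inf_iso T A -> inf_iso T' A.
Proof.
move=> TT [c Ec]; exists c => i j k; rewrite -!TT -Ec.
by congr (_ + _ - _); apply: eq_bigr => l _; rewrite TT.
Qed.

Lemma inf_iso_pullback w A P : is_form w -> P \in unitmx -> inf_iso (tens w) A ->
  inf_iso (tens (pullback (linear_map P) w)) (invmx P *m A *m P).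
Proof.
move=> fw uP /(inf_iso_conj uP); apply: inf_iso_ext => i j k.
by rewrite (tens_pullback P i fw).
Qed.

Lemma big_iso_pullback w P : is_form w -> P \in unitmx -> big_iso (tens w) ->
  big_iso (tens (pullback (linear_map P) w)).
Proof.
move=> fw uP gT A; have [B [iB nB]] := gT (P *m A *m invmx P).
exists (invmx P *m B *m P); split; first exact: inf_iso_pullback.
move=> a b E; apply: (nB a b).
have -> : B = P *m (invmx P *m B *m P) *m invmx P.
  by rewrite !mulmxA mulmxV // mul1mx mulmxK.
rewrite E mulmxDr mulmxDl -scalemxAr -scalemxAl scalar_mxC mulmxK //.
Qed.

Lemma classification w : foliation 2 w -> big_iso (tens w) ->
  PGL3_orbit (F1 C) w \/ PGL3_orbit (F5 C) w.
Proof.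
move=> fol gT; have fw := foliation_is_form fol.
have [N [iN N0 t1 t2]] := big_iso_isotropic gT.
have [P uP hP] := isotropic_normal_form N0 t1 t2.
pose w' := pullback (linear_map P) w.
have fol' : foliation 2 w' by apply: foliation_pullback.
have gT' := big_iso_pullback fw uP gT.
have iN' := inf_iso_pullback fw uP iN.
have w'w : PGL3_orbit w' w by apply: orbit_sym => //; apply: orbit_pullback.
case: hP iN' => [[d [-> d1 d2 d3]]|->|->] iN'.
- by case: (diagonal_isotropy_not_foliation fol' d1 d2 d3 iN').
- by case: (regular_nilpotent_not_foliation fol' iN' gT').
rewrite F1E F5E.
have [h|h] := rank_one_classification fol' iN' gT'; [left|right];
  by apply: orbit_trans h w'w; apply: form_of_is_form.
Qed.

End RankOneClassification.

(** * The two models are foliations *)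

Section Models.
Variable C : numClosedFieldType.
Implicit Types (w u : oneform C 3) (M N A B P L : 'M[C]_3) (T S : 'I_3 -> 'M[C]_3).
Implicit Types (x : 'I_3 -> C).

Lemma mmap_horner (n : nat) (h : 'I_n -> {poly C}) (p : {mpoly C[n]}) t :
  (mmap polyC h p).[t] = p.@[fun i => (h i).[t]].
Proof.
elim/mpoly_ring_ind: p => [c|i|p q IHp IHq|p q IHp IHq].
- by rewrite mmapC hornerC mevalC.
- by rewrite mmapX mmap1U mevalXU.
- by rewrite mmapD hornerD mevalD IHp IHq.
- by rewrite rmorphM hornerM mevalM IHp IHq.
Qed.

(** A polynomial in one variable without zeros is constant. *)
Lemma nonvanishing_line (n : nat) (p : {mpoly C[n]}) (a b : 'I_n -> C) :
  (forall t, p.@[fun i => a i + t * (b i - a i)] != 0) -> p.@[a] = p.@[b].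
Proof.
move=> pn0; pose h i : {poly C} := (a i)%:P + (b i - a i) *: 'X.
have hE t : (mmap polyC h p).[t] = p.@[fun i => a i + t * (b i - a i)].
  rewrite mmap_horner; apply: meval_eq => i.
  by rewrite /h hornerD hornerC hornerZ hornerX mulrC.
have : size (mmap polyC h p) == 1%N.
  apply/negPn/negP => /closed_rootP[t /rootP]; rewrite hE => p0.
  by have := pn0 t; rewrite p0 eqxx.
case/size_poly1P => c _ hc.
have E0 : p.@[a] = c.
  rewrite -[RHS](hornerC c 0) -hc hE; apply: meval_eq => i.
  by rewrite mul0r addr0.
rewrite E0 -[LHS](hornerC c 1) -hc hE; apply: meval_eq => i.
by rewrite mul1r addrC subrK.
Qed.

(** A common factor p of the components vanishes only where w does.  By hypothesis
    it has then no zeros on the line from v to (1, v_1, 1) and on the line from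
    there to (1, 1, 1), as soon as v_1 <> 0; so p takes the same value at v and
    at (1, 1, 1). *)
Lemma foliation_of_zeros w : is_form w ->
  (forall x, (forall i, ev w x i = 0) -> x 1 = 0 /\ (x 0 = 0 \/ x 2 = 0)) ->
  foliation 2 w.
Proof.
move=> [hw w0] zw; split=> // p dp.
have pn0 x : p.@[x] = 0 -> x 1 = 0 /\ (x 0 = 0 \/ x 2 = 0).
  move=> px; apply: zw => i; have [q Eq] := dp i.
  by rewrite /ev Eq mevalM px mulr0.
have p111 : p.@[fun=> 1] != 0.
  by apply/eqP => /pn0[/eqP]; rewrite oner_eq0.
pose c := p.@[fun=> 1].
have X1 : 'X_1 != 0 :> {mpoly C[3]} by rewrite -msize_poly_eq0 msizeX.
suff -> : p = c%:MP by apply/rmorph_unit; rewrite unitfE.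
apply/eqP; rewrite -subr_eq0; apply/eqP/(mpoly_eval_dense X1) => v.
rewrite mevalXU mevalB mevalC => v1; apply/eqP; rewrite subr_eq0; apply/eqP.
transitivity (p.@[t3 1 (v 1) 1]).
  apply: nonvanishing_line => t; apply/eqP => /pn0[].
  by rewrite t3E subrr mulr0 addr0 => /eqP; rewrite (negPf v1).
apply: nonvanishing_line => t; apply/eqP => /pn0[_].
by rewrite !t3E subrr mulr0 addr0 => -[] /eqP; rewrite oner_eq0.
Qed.

Lemma foliation_F1 : foliation 2 (F1 C).
Proof.
apply: (foliation_of_zeros (is_form_F1 C)) => x x0.
have := x0 0; have := x0 2; rewrite !ev_F1 !t3E => /eqP.
rewrite oppr_eq0 expf_eq0 /= => /eqP-> /eqP.
by rewrite expr0n /= mul0r sub0r oppr_eq0 expf_eq0 /= => /eqP->; split; last left.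
Qed.

Lemma foliation_F5 : foliation 2 (F5 C).
Proof.
apply: (foliation_of_zeros (is_form_F5 C)) => x x0.
have := x0 0; have := x0 1; rewrite !ev_F5 !t3E => h /eqP.
rewrite oppr_eq0 expf_eq0 /= => /eqP x1; move: h; rewrite x1.
rewrite expr0n mulr0 addr0 => /eqP; rewrite mulf_eq0 expf_eq0 /=.
by case/orP => /eqP->; split; [|left| |right].
Qed.

Definition ev2 (u : oneform C 2) (y : 'I_2 -> C) j := (u 0 j).@[y].

Lemma ord2P (Q : 'I_2 -> Prop) : Q 0 -> Q 1 -> forall i, Q i.
Proof.
by move=> Q0 Q1 [[|[|//]] Hi]; [move: Q0|move: Q1]; congr Q; apply/val_inj.
Qed.

Lemma mderivXU (n : nat) (i j : 'I_n) :
  ('X_i : {mpoly C[n]})^`M(j) = (i == j)%:R.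
Proof.
rewrite mderivX mnmE; case: eqP => [->|_]; last by rewrite scale0r.
rewrite scale1r (_ : (U_(j) - U_(j))%MM = 0%MM) ?mpolyX0 //.
by apply/mnmP => l; rewrite !mnmE subnn.
Qed.

Lemma affine_chart_eval w y j : ev2 (affine_chart w) y j =
  ev w (t3 (y 0) (y 1) 1) 0 * (j == 0)%:R + ev w (t3 (y 0) (y 1) 1) 1 * (j == 1)%:R.
Proof.
rewrite /ev2 /affine_chart mxE raddf_sum sum3 /=.
have d1 : (1 : {mpoly C[2]})^`M(j) = 0 by rewrite -mpolyC1 mderivC.
rewrite !(tnth_nth 0) /= d1 mulr0 meval0 addr0 !mevalM !mderivXU.
have E i : (w 0 i \mPo [tuple 'X_0; 'X_1; 1]).@[y] = ev w (t3 (y 0) (y 1) 1) i.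
  rewrite comp_mpoly_meval; apply: meval_eq => k.
  by elim/ord3P: k; rewrite (tnth_nth 0) /= ?mevalXU ?meval1 ?t3E.
rewrite !E; congr (_ * _ + _ * _); rewrite eq_sym;
  by case: (j == _); rewrite ?meval1 ?meval0.
Qed.

Lemma ev2_inj (u v : oneform C 2) : (forall y j, ev2 u y j = ev2 v y j) -> u = v.
Proof.
by move=> uv; apply/rowP => j; apply: mpoly_eval_eq => y; apply: uv.
Qed.

Lemma ev2_comb p q r s (u v v' : 'rV[{mpoly C[2]}]_2) y j :
  ev2 (p *: u + q *: (r *: v - s *: v')) y j =
  p.@[y] * ev2 u y j + q.@[y] * (r.@[y] * ev2 v y j - s.@[y] * ev2 v' y j).
Proof.
by rewrite /ev2 mxE ![in X in _ + X]mxE [in LHS]mxE !(mevalD, mevalM, mevalN).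
Qed.

Lemma ev2_dX (i j : 'I_2) y : ev2 (dX C i) y j = (i == j)%:R.
Proof.
by rewrite /ev2 /dX mxE eqxx /= eq_sym; case: eqP => _; rewrite ?meval1 ?meval0.
Qed.

Lemma affine_chart_F1 : affine_chart (F1 C) = omega1 C.
Proof.
apply: ev2_inj => y j; rewrite affine_chart_eval !ev_F1 !t3E.
apply: etrans _ (esym (ev2_comb _ _ _ _ _ _ _ _ _)).
rewrite !mevalX2 !mevalXU !ev2_dX.
by elim/ord2P: j; rewrite /=; ring.
Qed.

Lemma affine_chart_F5 : affine_chart (F5 C) = omega5 C.
Proof.
apply: ev2_inj => y j; rewrite affine_chart_eval !ev_F5 !t3E.
apply: etrans _ (esym (ev2_comb _ _ _ _ _ _ _ _ _)).
rewrite !mevalX2 !mevalXU !ev2_dX.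
by elim/ord2P: j; rewrite /=; ring.
Qed.

End Models.

(** * Isotropy groups of the two models *)

Section IsoGroups.
Variable C : numClosedFieldType.
Implicit Types (w u : oneform C 3) (M N A B P L : 'M[C]_3) (T S : 'I_3 -> 'M[C]_3).
Implicit Types (x : 'I_3 -> C).

(** The divergence-free field that differs from (- X^2, 0, Y^2) by a multiple of
    the radial field. *)
Definition tensor_F5 : 'I_3 -> 'M[C]_3 :=
  t3 (\matrix_(i, j) t3 (t3 (- (1 / 2)) 0 0 j) 0 0 i)
     (\matrix_(i, j) t3 (t3 0 (1 / 4) 0 j) (t3 (1 / 4) 0 0 j) 0 i)
     (\matrix_(i, j) t3 (t3 0 0 (1 / 4) j) (t3 0 1 0 j) (t3 (1 / 4) 0 0 j) i).

Lemma normal_field_F1 : normal (field_F1 C).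
Proof.
split=> [i j k|k]; last first.
  by rewrite sum3; elim/ord3P: k; rewrite /field_F1 /planar !t3E !mxE ?t3E; ring.
by elim/ord3P: i; elim/ord3P: j; elim/ord3P: k; rewrite /field_F1 /planar !t3E !mxE ?t3E.
Qed.

Lemma normal_tensor_F5 : normal tensor_F5.
Proof.
split=> [i j k|k]; last first.
  by rewrite sum3; elim/ord3P: k; rewrite /tensor_F5 !t3E !mxE ?t3E; field.
by elim/ord3P: i; elim/ord3P: j; elim/ord3P: k; rewrite /tensor_F5 !t3E !mxE ?t3E.
Qed.

Lemma F5_tensorE : F5 C = form_of tensor_F5.
Proof.
rewrite F5E; apply: ev_inj => x i.
apply: (etrans (ev_form_of _ x i)); apply: (etrans _ (esym (ev_form_of tensor_F5 x i))).
symmetry; apply: (@fm_add_radial C tensor_F5 (field_F5 C) (t3 (1 / 4) 0 0)) => a b c.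
elim/ord3P: a; elim/ord3P: b; elim/ord3P: c; rewrite /tensor_F5 /field_F5 !t3E !mxE ?t3E /=;
  by field.
Qed.

Lemma tens_F1 i j k : tens (F1 C) i j k = field_F1 C i j k.
Proof. by rewrite F1E tens_form_of //; apply: normal_field_F1. Qed.

Lemma tens_F5 i j k : tens (F5 C) i j k = tensor_F5 i j k.
Proof. by rewrite F5_tensorE tens_form_of //; apply: normal_tensor_F5. Qed.

Lemma Iso_unit w M : Iso w M -> M \in unitmx. Proof. by case. Qed.

Lemma Iso_mul w M N : Iso w M -> Iso w N -> Iso w (M *m N).
Proof.
move=> [uM [c c0 Mw]] [uN [d d0 Nw]]; split; first by rewrite unitmx_mul uM.
exists (c * d); first by rewrite mulf_neq0.
by rewrite -pullback_comp Mw pullback_scale Nw scalerA -mpolyCM.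
Qed.

Lemma Iso_one w : Iso w 1%:M.
Proof.
split; first exact: unitmx1.
by exists 1; rewrite ?oner_eq0 // pullback1 mpolyC1 scale1r.
Qed.

Lemma Iso_inv w M : Iso w M -> Iso w (invmx M).
Proof.
move=> [uM [c c0 Mw]]; split; first by rewrite unitmx_inv.
exists c^-1; first by rewrite invr_eq0.
have := pullback_comp M (invmx M) w; rewrite mulmxV // pullback1 => Ew.
rewrite -[in RHS]Ew Mw pullback_scale scalerA -mpolyCM mulVf //.
by rewrite mpolyC1 scale1r.
Qed.

(** Contraction of the invariance equation of T with M eliminates the adjugate;
    up to the factor det M, the equations are quadratic in M on one side and
    linear on the other. *)
Lemma Iso_tensor w M : is_form w -> Iso w M ->
  exists2 c, c != 0 & forall k i j,
    \det M * (\sum_m \sum_n M m i * tens w k m n * M n j)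
      = c * \sum_l M k l * tens w l i j.
Proof.
move=> fw [uM [c c0 Mw]]; exists c => // k i j.
have act_c l : act M (tens w) l i j = c * tens w l i j.
  by rewrite -tens_pullback // Mw tensZ.
pose X m := \sum_a \sum_b M a i * tens w m a b * M b j.
transitivity (\sum_m (M *m adj3 M) k m * X m).
  rewrite mul_adj3 det3E [RHS](bigD1 k) //= mxE eqxx mulr1n -[LHS]addr0.
  congr (_ + _); apply/esym/big1 => m /negPf mk.
  by rewrite mxE eq_sym mk mulr0n mul0r.
transitivity (\sum_l M k l * act M (tens w) l i j); last first.
  by rewrite mulr_sumr; apply: eq_bigr => l _; rewrite act_c mulrCA.
transitivity (\sum_l \sum_m M k l * (adj3 M l m * X m)); last first.
  by apply: eq_bigr => l _; rewrite actE mulr_sumr.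
rewrite exchange_big; apply: eq_bigr => m _ /=; rewrite mxE mulr_suml.
by apply: eq_bigr => l _; rewrite mulrA.
Qed.

Definition lower_F1 M := [/\ M 0 1 = 0, M 0 2 = 0, M 1 0 = 0, M 1 2 = 0 & M 2 1 = 0].
Definition lower_F5 M := [/\ M 0 1 = 0, M 0 2 = 0, M 1 0 = 0, M 1 2 = 0 & M 2 0 = 0].

Lemma det_lower M : M 0 1 = 0 -> M 0 2 = 0 -> M 1 2 = 0 ->
  \det M = M 0 0 * M 1 1 * M 2 2.
Proof.
by move=> h1 h2 h3; rewrite -det3E /det3 sum3 !mxE /cross !t3E !ordE h1 h2 h3; ring.
Qed.

Lemma unit_lower M : M 0 1 = 0 -> M 0 2 = 0 -> M 1 2 = 0 ->
  (M \in unitmx) = [&& M 0 0 != 0, M 1 1 != 0 & M 2 2 != 0].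
Proof.
by move=> h1 h2 h3; rewrite unitmxE unitfE det_lower // !mulf_eq0 !negb_or andbA.
Qed.

(** Diagonal matrices scale the two terms of omega1 by factors whose equality is
    the last condition. *)
Lemma Iso_F1P M : Iso (F1 C) M <->
  [/\ lower_F1 M, M \in unitmx & M 0 0 ^+ 2 * M 2 2 = M 1 1 ^+ 3].
Proof.
split=> [iM|[[h1 h2 h3 h4 h5] uM rel]]; last first.
  split=> //; exists (M 0 0 * M 1 1 ^+ 3).
    by move: uM; rewrite unit_lower // => /and3P[*]; rewrite mulf_neq0 ?expf_neq0.
  apply: ev_inj => x j; rewrite ev_pullback.
  apply: etrans _ (esym (evZ _ _ _ _)); rewrite mevalC ev_F1.
  have E : mapv M x =1 t3 (M 0 0 * x 0) (M 1 1 * x 1) (M 2 0 * x 0 + M 2 2 * x 2).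
    by elim/ord3P; rewrite /mapv sum3 ?h1 ?h2 ?h3 ?h4 ?h5 !t3E; ring.
  rewrite sum3 !ev_F1 !E !t3E; elim/ord3P: j; rewrite !t3E ?h1 ?h2 ?h3 ?h4 ?h5.
  - by apply: (by_eq (eqZ (M 0 0 * x 0 ^+ 2 * x 2) rel)); ring.
  - by ring.
  - by apply: (by_eq (eqZ (- M 0 0 * x 0 ^+ 3) rel)); ring.
have uM := Iso_unit iM; have dM : \det M != 0 by rewrite -unitfE -unitmxE.
have [c c0 E] := Iso_tensor (is_form_F1 C) iM.
have {}E k i j : \det M * (\sum_m \sum_n M m i * field_F1 C k m n * M n j)
      = c * \sum_l M k l * field_F1 C l i j.
  have := E k i j; under eq_bigr => m _ do under eq_bigr => n _ do rewrite tens_F1.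
  by under [in RHS]eq_bigr => l _ do rewrite tens_F1.
have e011 := E 0 1 1; have e000 := E 0 0 0; have e111 := E 1 1 1.
have e100 := E 1 0 0; have e201 := E 2 0 1; have e211 := E 2 1 1.
have e200 := E 2 0 0; have e222 := E 2 2 2.
move: e011 e000 e111 e100 e201 e211 e200 e222 {E}.
rewrite !sum3 /field_F1 /planar !t3E !mxE ?t3E; set D := \det M in dM *.
move=> e011 e000 e111 e100 e201 e211 e200 e222.
have M01 : M 0 1 = 0 by apply: (mulfI c0); apply: (by_eq (eqZ (-1) e000)); ring.
have M02 : M 0 2 = 0 by apply: (mulfI c0); apply: (by_eq (eqZ (-1) e011)); ring.
have M12 : M 1 2 = 0.
  by apply: (mulfI c0); apply: (by_eq (eqZ (-1) e111)); rewrite M01; ring.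
have : \det M != 0 := dM; rewrite det_lower // !mulf_eq0 !negb_or.
move=> /andP[/andP[M00 M11] M22].
have M10 : M 1 0 = 0.
  by apply: (mulfI M11); apply: (mulfI dM); apply: (by_eq e201); ring.
have M21 : M 2 1 = 0.
  by apply: (mulfI c0); apply: (by_eq (eqZ (-1) e200)); rewrite M10; ring.
split=> //; apply: (mulfI c0); apply: (mulfI dM).
apply: (by_eq (eqD (eqZ (c * M 2 2) e100) (eqZ (- c * M 1 1) e211))).
ring.
Qed.

Lemma Iso_F5P M : Iso (F5 C) M <->
  [/\ lower_F5 M, M \in unitmx & M 0 0 * M 2 2 = M 1 1 ^+ 2].
Proof.
split=> [iM|[[h1 h2 h3 h4 h5] uM rel]]; last first.
  split=> //; exists (M 0 0 ^+ 2 * M 1 1 * M 2 2).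
    by move: uM; rewrite unit_lower // => /and3P[*]; rewrite !mulf_neq0 ?expf_neq0.
  apply: ev_inj => x j; rewrite ev_pullback.
  apply: etrans _ (esym (evZ _ _ _ _)); rewrite mevalC ev_F5.
  have E : mapv M x =1 t3 (M 0 0 * x 0) (M 1 1 * x 1) (M 2 1 * x 1 + M 2 2 * x 2).
    by elim/ord3P; rewrite /mapv sum3 ?h1 ?h2 ?h3 ?h4 ?h5 !t3E; ring.
  rewrite sum3 !ev_F5 !E !t3E; elim/ord3P: j; rewrite !t3E ?h1 ?h2 ?h3 ?h4 ?h5.
  - by apply: (by_eq (eqZ (M 0 0 * M 1 1 * x 1 ^+ 3) rel)); ring.
  - by apply: (by_eq (eqZ (- M 0 0 * M 1 1 * x 0 * x 1 ^+ 2) rel)); ring.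
  - by ring.
have uM := Iso_unit iM; have dM : \det M != 0 by rewrite -unitfE -unitmxE.
have [c c0 E] := Iso_tensor (is_form_F5 C) iM.
have {}E k i j : \det M * (\sum_m \sum_n M m i * tensor_F5 k m n * M n j)
      = c * \sum_l M k l * tensor_F5 l i j.
  have := E k i j; under eq_bigr => m _ do under eq_bigr => n _ do rewrite tens_F5.
  by under [in RHS]eq_bigr => l _ do rewrite tens_F5.
have e022 := E 0 2 2; have e011 := E 0 1 1; have e000 := E 0 0 0.
have e111 := E 1 1 1; have e100 := E 1 0 0; have e200 := E 2 0 0.
have e211 := E 2 1 1.
move: e022 e011 e000 e111 e100 e200 e211 {E}.
rewrite !sum3 /tensor_F5 !t3E !mxE ?t3E; set D := \det M in dM *.
move=> e022 e011 e000 e111 e100 e200 e211.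
have M02 : M 0 2 = 0.
  apply/eqP; rewrite -sqrf_eq0; apply/eqP; apply: (mulfI dM).
  by apply: (by_eq (eqZ (-2) e022)); field.
have M01 : M 0 1 = 0.
  apply/eqP; rewrite -sqrf_eq0; apply/eqP; apply: (mulfI dM).
  by apply: (by_eq (eqZ (-2) e011)); rewrite M02; field.
have M12 : M 1 2 = 0.
  by apply: (mulfI c0); apply: (by_eq (eqZ (-1) e111)); rewrite M01; field.
have : \det M != 0 := dM; rewrite det_lower // !mulf_eq0 !negb_or.
move=> /andP[/andP[M00 M11] M22].
have Dc : D * M 0 0 = c.
  by apply: (mulfI M00); apply: (by_eq (eqZ (-2) e000)); rewrite M02 M01; field.
have M10 : M 1 0 = 0.
  apply: (mulfI c0); apply: (by_eq (eqD e100 (eqZ (- (1 / 2) * M 1 0) Dc))).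
  by rewrite M12; field.
have M20 : M 2 0 = 0.
  apply: (mulfI c0); apply: (by_eq (eqD e200 (eqZ (- (1 / 2) * M 2 0) Dc))).
  by rewrite M10; field.
split=> //; apply: (mulfI dM).
by apply: (by_eq (eqD (eqZ (M 2 2) Dc) (eqZ (-1) e211))); rewrite M01; field.
Qed.

End IsoGroups.

(** * Generators, and non-conjugacy *)

Section GeneratedGroups.
Variable C : numClosedFieldType.
Implicit Types (M N P : 'M[C]_3).

(** Two lines have a dense complement, so the polynomial vanishes everywhere; its
    coefficients are then read off at a few points. *)
Lemma quadratic_coefs (l m : 'I_3 -> C) (c c1 c2 c11 c12 c22 : C) :
  (exists i, l i != 0) -> (exists i, m i != 0) ->
  (forall x y, l 0 * x + l 1 * y + l 2 != 0 -> m 0 * x + m 1 * y + m 2 != 0 ->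
     c + c1 * x + c2 * y + c11 * x ^+ 2 + c12 * x * y + c22 * y ^+ 2 = 0) ->
  [/\ c = 0, c1 = 0, c2 = 0, c11 = 0 & c12 = 0] /\ c22 = 0.
Proof.
move=> l0 m0 vanish; pose v x y (i : 'I_2) := if i == 0 then x else y : C.
pose aff (k : 'I_3 -> C) : {mpoly C[2]} := k 0 *: 'X_0 + k 1 *: 'X_1 + (k 2)%:MP.
have affE k x : (aff k).@[x] = k 0 * x 0 + k 1 * x 1 + k 2.
  by rewrite !mevalD !mevalZ !mevalXU mevalC.
have aff_neq0 k : (exists i, k i != 0) -> aff k != 0.
  move=> ki; apply/eqP => k0; have E x y : k 0 * x + k 1 * y + k 2 = 0.
    by have := affE k (v x y); rewrite k0 meval0.
  case: ki => i /eqP[]; have k2 : k 2 = 0 by rewrite -[RHS](E 0 0); ring.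
  have k10 : k 0 = 0 by rewrite -[RHS](E 1 0) k2; ring.
  by have k01 : k 1 = 0 by [rewrite -[RHS](E 0 1) k2; ring]; elim/ord3P: i.
pose q : {mpoly C[2]} := c%:MP + c1 *: 'X_0 + c2 *: 'X_1 + c11 *: ('X_0 * 'X_0)
  + c12 *: ('X_0 * 'X_1) + c22 *: ('X_1 * 'X_1).
have qE x : q.@[x] = c + c1 * x 0 + c2 * x 1 + c11 * x 0 ^+ 2
    + c12 * x 0 * x 1 + c22 * x 1 ^+ 2.
  by rewrite !mevalD !mevalZ !mevalM !mevalXU mevalC -!mulrA.
have q0 : q = 0.
  apply: (@mpoly_eval_dense _ _ (aff l * aff m)) => [|x].
    by rewrite mulf_neq0 ?aff_neq0.
  by rewrite mevalM !affE mulf_eq0 negb_or qE => /andP[lx mx]; apply: vanish.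
have {qE}E x y : c + c1 * x + c2 * y + c11 * x ^+ 2 + c12 * x * y + c22 * y ^+ 2 = 0.
  by have := qE (v x y); rewrite q0 meval0.
have E0 : c = 0 by rewrite -[RHS](E 0 0); ring.
have E1 : c1 = 0.
  by apply: (@mulf_natI C 1); apply: (by_eq (eqD (E 1 0) (eqZ (-1) (E (-1) 0)))); ring.
have E2 : c2 = 0.
  by apply: (@mulf_natI C 1); apply: (by_eq (eqD (E 0 1) (eqZ (-1) (E 0 (-1))))); ring.
have E11 : c11 = 0 by apply: (by_eq (E 1 0)); rewrite E0 E1; ring.
have E22 : c22 = 0 by apply: (by_eq (E 0 1)); rewrite E0 E2; ring.
by split=> //; split=> //; apply: (by_eq (E 1 1)); rewrite E0 E1 E2 E11 E22; ring.
Qed.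

Lemma unitmx_row_neq0 P i : P \in unitmx -> exists j, P i j != 0.
Proof.
move=> uP; apply/existsP; apply: contraT; rewrite negb_exists => /forallP P0.
have := congr1 (fun Q : 'M[C]_3 => Q i i) (mulmxV uP); rewrite !mxE eqxx big1.
  by move=> /esym/eqP; rewrite oner_eq0.
by move=> j _; have := P0 j; rewrite negbK => /eqP->; rewrite mul0r.
Qed.

(** The generators of both groups are of this form, with s = t = 0 or
    with a = b = 1; comparing numerators after clearing denominators is an identity
    between quadratic polynomials, valid where both denominators are nonzero. *)
Lemma representsP P (a b s t : C) : a != 0 ->
  represents P (fun x y => (a * x / (1 + s * x + t * y), b * y / (1 + s * x + t * y)))
  <-> [/\ P \in unitmx, P 0 1 = 0 /\ P 0 2 = 0, P 1 0 = 0 /\ P 1 2 = 0,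
          P 0 0 = a * P 2 2 /\ P 1 1 = b * P 2 2 & P 2 0 = s * P 2 2 /\ P 2 1 = t * P 2 2].
Proof.
move=> a0; split=> [[uP Pf]|[uP [P01 P02] [P10 P12] [P00 P11] [P20 P21]]]; last first.
  split=> // x y /=; rewrite P20 P21 P01 P02 P10 P12 P00 P11.
  have -> : s * P 2 2 * x + t * P 2 2 * y + P 2 2 = P 2 2 * (1 + s * x + t * y) by ring.
  rewrite mulf_eq0 negb_or => /andP[P22 den].
  by congr (_, _); field; rewrite P22 den.
pose m : 'I_3 -> C := t3 s t 1.
have m0 : exists i, m i != 0 by exists 2; rewrite /m t3E oner_eq0.
have E x y : P 2 0 * x + P 2 1 * y + P 2 2 != 0 -> 1 + s * x + t * y != 0 ->
    a * x * (P 2 0 * x + P 2 1 * y + P 2 2)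
      = (P 0 0 * x + P 0 1 * y + P 0 2) * (1 + s * x + t * y) /\
    b * y * (P 2 0 * x + P 2 1 * y + P 2 2)
      = (P 1 0 * x + P 1 1 * y + P 1 2) * (1 + s * x + t * y).
  by move=> den den'; case: (Pf x y den) => /eqP + /eqP; rewrite !eqr_div // => /eqP + /eqP.
have den_m x y : m 0 * x + m 1 * y + m 2 = 1 + s * x + t * y by rewrite /m !t3E; ring.
have [|[P02 EP00 P01 e20 e21] _] := @quadratic_coefs (P 2) m
  (- P 0 2) (a * P 2 2 - P 0 0 - s * P 0 2) (- P 0 1 - t * P 0 2)
  (a * P 2 0 - P 0 0 * s) (a * P 2 1 - P 0 0 * t - P 0 1 * s) (- P 0 1 * t)
  (unitmx_row_neq0 2 uP) m0.
  move=> x y den; rewrite den_m => den'; have [e _] := E x y den den'.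
  by apply: (by_eq e); ring.
have [|[P12 P10 EP11 _ _] _] := @quadratic_coefs (P 2) m
  (- P 1 2) (- P 1 0 - s * P 1 2) (b * P 2 2 - P 1 1 - t * P 1 2)
  (- P 1 0 * s) (b * P 2 0 - P 1 0 * t - P 1 1 * s) (b * P 2 1 - P 1 1 * t)
  (unitmx_row_neq0 2 uP) m0.
  move=> x y den; rewrite den_m => den'; have [_ e] := E x y den den'.
  by apply: (by_eq e); ring.
have {}P02 : P 0 2 = 0 by apply: oppr_inj; rewrite P02 oppr0.
have {}P12 : P 1 2 = 0 by apply: oppr_inj; rewrite P12 oppr0.
have {}P01 : P 0 1 = 0 by apply: (by_eq (eqZ (-1) P01)); rewrite P02; ring.
have {}P10 : P 1 0 = 0 by apply: (by_eq (eqZ (-1) P10)); rewrite P12; ring.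
have {}EP00 : P 0 0 = a * P 2 2 by apply: (by_eq (eqZ (-1) EP00)); rewrite P02; ring.
have {}EP11 : P 1 1 = b * P 2 2 by apply: (by_eq (eqZ (-1) EP11)); rewrite P12; ring.
split=> //; split; apply: (mulfI a0).
  by apply: (by_eq e20); rewrite EP00; ring.
by apply: (by_eq e21); rewrite EP00 P01; ring.
Qed.

Lemma represents_ext P f g :
  (forall x y, f x y = g x y) -> represents P f <-> represents P g.
Proof. by move=> fg; split=> -[uP Pf]; split=> // x y den h;
  have := Pf x y h; rewrite fg. Qed.

Lemma generated_by_Iso (w : oneform C 3) (S : 'M[C]_3 -> Prop) M :
  (forall P, S P -> Iso w P) -> generated_by S M -> Iso w M.
Proof.
move=> SI; elim=> [P SP||P Q _ IP _ IQ|P _ IP]; first exact: SI.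
- exact: Iso_one.
- exact: Iso_mul.
exact: Iso_inv.
Qed.

Definition diagonal (a b c : C) : 'M[C]_3 :=
  \matrix_(i, j) t3 (t3 a 0 0 j) (t3 0 b 0 j) (t3 0 0 c j) i.

Definition shear (s t : C) : 'M[C]_3 :=
  \matrix_(i, j) t3 (t3 1 0 0 j) (t3 0 1 0 j) (t3 s t 1 j) i.

Lemma lower_factor M : M 0 1 = 0 -> M 0 2 = 0 -> M 1 0 = 0 -> M 1 2 = 0 ->
  M 2 2 != 0 ->
  M = diagonal (M 0 0) (M 1 1) (M 2 2) *m shear (M 2 0 / M 2 2) (M 2 1 / M 2 2).
Proof.
move=> h1 h2 h3 h4 h5; apply/matrixP => i j; rewrite mxE sum3 !mxE.
by elim/ord3P: i; elim/ord3P: j; rewrite !t3E ?h1 ?h2 ?h3 ?h4; field.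
Qed.

Lemma represents_diagonal (a b c : C) : a != 0 -> b != 0 -> c != 0 ->
  represents (diagonal a b c) (fun x y => (a / c * x, b / c * y)).
Proof.
move=> a0 b0 c0.
apply: (iffLR (represents_ext _ _)) (iffRL (@representsP _ (a / c) (b / c) 0 0 _) _).
- by move=> x y; rewrite !mul0r !addr0 !divr1.
- by rewrite mulf_neq0 ?invr_eq0.
rewrite unit_lower ?mxE ?t3E // a0 b0 c0.
by split; rewrite ?mxE ?t3E ?mul0r ?divfK //; split; rewrite ?mxE ?t3E.
Qed.

Lemma represents_shear (s t : C) :
  represents (shear s t)
    (fun x y => (x / (1 + s * x + t * y), y / (1 + s * x + t * y))).
Proof.
apply: (iffLR (represents_ext _ _)) (iffRL (@representsP _ 1 1 s t _) _).
- by move=> x y; rewrite !mul1r.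
- exact: oner_neq0.
rewrite unit_lower ?mxE ?t3E // oner_eq0.
by split; rewrite ?mxE ?t3E ?mulr1.
Qed.

Lemma Iso_F1_generated M :
  Iso (F1 C) M <->
  generated_by (fun P : 'M[C]_3 =>
    (exists2 alpha : C, alpha != 0
       & represents P (fun x y => (alpha ^+ 3 * x, alpha ^+ 2 * y))) \/
    (exists beta : C,
       represents P (fun x y => (x / (1 + beta * x), y / (1 + beta * x)))))
    M.
Proof.
split=> [/Iso_F1P[[h1 h2 h3 h4 h5] uM rel]|].
  have : M \in unitmx := uM; rewrite unit_lower // => /and3P[M00 M11 M22].
  rewrite (lower_factor h1 h2 h3 h4 M22) h5 mul0r.
  apply: gen_mul; apply: gen_base; [left|right].
    exists (M 0 0 / M 1 1); first by rewrite mulf_neq0 ?invr_eq0.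
    apply: (iffLR (represents_ext _ _)) (represents_diagonal M00 M11 M22) => x y.
    congr (_ * x, _ * y); apply: (mulfI (expf_neq0 3 M11)); apply: (mulfI M22).
      by apply: (by_eq (eqZ (- M 0 0) rel)); field; rewrite M11 M22.
    by apply: (by_eq (eqZ (- M 1 1) rel)); field; rewrite M11 M22.
  exists (M 2 0 / M 2 2).
  apply: (iffLR (represents_ext _ _)) (represents_shear _ _) => x y.
  by rewrite mul0r addr0.
apply: generated_by_Iso => P [[a a0 Pf]|[b Pf]].
  have : represents P (fun x y => (a ^+ 3 * x / (1 + 0 * x + 0 * y), a ^+ 2 * y / (1 + 0 * x + 0 * y))).
    by apply: (iffLR (represents_ext _ _)) Pf => x y; rewrite !mul0r !addr0 !divr1.
  move=> /(iffLR (representsP _ _ _ _ (expf_neq0 3 a0))).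
  move=> [uP [P01 P02] [P10 P12] [P00 P11] [P20 P21]].
  apply/Iso_F1P; split=> //; first by split=> //; rewrite P21 mul0r.
  by rewrite P00 P11; ring.
have : represents P (fun x y => (1 * x / (1 + b * x + 0 * y), 1 * y / (1 + b * x + 0 * y))).
  by apply: (iffLR (represents_ext _ _)) Pf => x y; rewrite !mul0r !addr0 !mul1r.
move=> /(iffLR (representsP _ _ _ _ (oner_neq0 C))).
move=> [uP [P01 P02] [P10 P12] [P00 P11] [P20 P21]].
apply/Iso_F1P; split=> //; first by split=> //; rewrite P21 mul0r.
by rewrite P00 P11; ring.
Qed.

Lemma Iso_F5_generated M :
  Iso (F5 C) M <->
  generated_by (fun P : 'M[C]_3 =>
    (exists2 alpha : C, alpha != 0
       & represents P (fun x y => (alpha ^+ 2 * x, alpha * y))) \/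
    (exists beta : C,
       represents P (fun x y => (x / (1 + beta * y), y / (1 + beta * y)))))
    M.
Proof.
split=> [/Iso_F5P[[h1 h2 h3 h4 h5] uM rel]|].
  have : M \in unitmx := uM; rewrite unit_lower // => /and3P[M00 M11 M22].
  rewrite (lower_factor h1 h2 h3 h4 M22) h5 mul0r.
  apply: gen_mul; apply: gen_base; [left|right].
    exists (M 1 1 / M 2 2); first by rewrite mulf_neq0 ?invr_eq0.
    apply: (iffLR (represents_ext _ _)) (represents_diagonal M00 M11 M22) => x y.
    congr (_ * x, _ * y); apply: (mulfI M22); apply: (mulfI M22).
    by apply: (by_eq rel); field.
  exists (M 2 1 / M 2 2).
  apply: (iffLR (represents_ext _ _)) (represents_shear _ _) => x y.
  by rewrite mul0r addr0.
apply: generated_by_Iso => P [[a a0 Pf]|[b Pf]].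
  have : represents P (fun x y => (a ^+ 2 * x / (1 + 0 * x + 0 * y), a * y / (1 + 0 * x + 0 * y))).
    by apply: (iffLR (represents_ext _ _)) Pf => x y; rewrite !mul0r !addr0 !divr1.
  move=> /(iffLR (representsP _ _ _ _ (expf_neq0 2 a0))).
  move=> [uP [P01 P02] [P10 P12] [P00 P11] [P20 P21]].
  apply/Iso_F5P; split=> //; first by split=> //; rewrite P20 mul0r.
  by rewrite P00 P11; ring.
have : represents P (fun x y => (1 * x / (1 + 0 * x + b * y), 1 * y / (1 + 0 * x + b * y))).
  by apply: (iffLR (represents_ext _ _)) Pf => x y; rewrite !mul0r !addr0 !mul1r.
move=> /(iffLR (representsP _ _ _ _ (oner_neq0 C))).
move=> [uP [P01 P02] [P10 P12] [P00 P11] [P20 P21]].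
apply/Iso_F5P; split=> //; first by split=> //; rewrite P20 mul0r.
by rewrite P00 P11; ring.
Qed.

(** The matrix diag(8, 4, 1) preserves F1.  A conjugate of it in the isotropy
    group of F5 would have eigenvalues a, b, c with a c = b^2, sum 13, sum of
    squares 81 and product 32; the first three give 13 b = 44, the first and the
    last b^3 = 32, and 44^3 = 85184 differs from 32 * 13^3 = 70304. *)
Lemma Iso_F1_F5_not_conjugate : ~ PGL3_conjugate (Iso (F1 C)) (Iso (F5 C)).
Proof.
case=> P uP PI; pose D := diagonal 8 4 1.
have n0 k : k.+1%:R != 0 :> C by rewrite pnatr_eq0.
have /PI/Iso_F5P[] : Iso (F1 C) D.
  apply/Iso_F1P; split; first by split; rewrite !mxE !t3E.
    by rewrite unit_lower !mxE !t3E // oner_eq0 !n0.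
  by rewrite !mxE !t3E; ring.
set N := P *m D *m invmx P => -[h1 h2 h3 h4 h5] _ rel.
have trN : \tr N = 13 by rewrite mxtrace_mulC mulKmx // /mxtrace sum3 !mxE !t3E; ring.
have trNN : \tr (N *m N) = 81.
  rewrite /N !mulmxA mulmxKV // mxtrace_mulC !mulmxA mulVmx // mul1mx.
  by rewrite /mxtrace sum3 !mxE !sum3 !mxE !t3E; ring.
have detN : \det N = 32.
  rewrite !det_mulmx mulrAC -det_mulmx mulmxV // det1 mul1r det_lower ?mxE ?t3E //.
  by ring.
clearbody N; move: trN trNN detN; rewrite det_lower // /mxtrace !sum3 !mxE !sum3 h1 h2 h3 h4 h5.
move=> e1 e2 e3.
have e4 : 13 * N 1 1 = 44.
  by apply: (@mulf_natI C 1); apply: (by_eq (eqD (eqD (eqZ (-1) e2) (eqZ (-2) rel))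
      (eqZ (N 0 0 + N 2 2 - N 1 1 + 13) e1))); ring.
have e5 : N 1 1 ^+ 3 = 32 by apply: (by_eq (eqD e3 (eqZ (- N 1 1) rel))); ring.
have : (14880%:R : C) = 0.
  apply: (by_eq (eqD (eqZ (13 ^+ 3) e5) (eqZ (- ((13 * N 1 1) ^+ 2 + 13 * N 1 1 * 44 + 44 ^+ 2)) e4))).
  by ring.
by move/eqP; rewrite pnatr_eq0.
Qed.

End GeneratedGroups.

(** * Dimension and closedness of the two orbits *)

Section OrbitsOfF1AndF5.
Variable C : numClosedFieldType.
Implicit Types (w u : oneform C 3) (M N A R : 'M[C]_3) (T : 'I_3 -> 'M[C]_3).

Local Notation Nc := #|coef_index 2|.
Local Notation coefs w := (@form_coef C 2 w).

Lemma dact_eq A T T' i j k : (forall i j k, T i j k = T' i j k) ->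
  dact A T i j k = dact A T' i j k.
Proof. by move=> TT'; rewrite /dact !sum3 !TT'. Qed.

(** The two matrices span the stabilizer of the tensor itself in gl_3, which has
    dimension 2 = 9 - 7; the first one is 4 diag(3, 2, 0) - 9. *)
Lemma rank_jac_F1 : (7 <= \rank (jac (tens (F1 C))))%N.
Proof.
apply: (@rank_jac_ge _ _ (diagonal 3 (-1) (-9)) (delta_mx 2 0)) => A A0.
have {}A0 i j k : dact A (field_F1 C) i j k = 0.
  by rewrite -(A0 i j k); apply: dact_eq => a b c; rewrite tens_F1.
have := A0 0 0 0; have := A0 0 1 1; have := A0 1 1 1; have := A0 2 0 1.
have := A0 2 0 0; have := A0 1 0 0; have := A0 2 1 1.
rewrite /dact /mxtrace !sum3 /field_F1 /planar !t3E !mxE ?t3E.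
move=> e211 e100 e200 e201 e111 e011 e000.
have A01 : A 0 1 = 0 by apply: (by_eq (eqZ (-1) e000)); ring.
have A02 : A 0 2 = 0 by apply: (by_eq (eqZ (-1) e011)); ring.
have A12 : A 1 2 = 0 by apply: (by_eq (eqZ (-1) e111)); rewrite ?A01; ring.
have A10 : A 1 0 = 0 by apply: (by_eq e201); ring.
have A21 : A 2 1 = 0 by apply: (by_eq (eqZ (-1) e200)); rewrite ?A10; ring.
have A00 : A 0 0 = -3 * A 1 1 by apply: (by_eq e211); rewrite ?A21 ?A12; ring.
have A22 : A 2 2 = 9 * A 1 1.
  by apply: (by_eq e100); rewrite A00; ring.
exists (- A 1 1), (A 2 0); apply/matrixP => i j; rewrite !mxE.
elim/ord3P: i; elim/ord3P: j; rewrite !t3E ?A01 ?A02 ?A12 ?A10 ?A21 ?A00 ?A22 /=;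
  by ring.
Qed.

(** Here the diagonal matrix is 4 diag(2, 1, 0) - 5. *)
Lemma rank_jac_F5 : (7 <= \rank (jac (tens (F5 C))))%N.
Proof.
apply: (@rank_jac_ge _ _ (diagonal 3 (-1) (-5)) (delta_mx 2 1)) => A A0.
have {}A0 i j k : dact A (tensor_F5 C) i j k = 0.
  by rewrite -(A0 i j k); apply: dact_eq => a b c; rewrite tens_F5.
have := A0 0 1 1; have := A0 0 0 1; have := A0 0 0 0; have := A0 1 1 1.
have := A0 1 0 0; have := A0 2 0 0; have := A0 2 1 1.
rewrite /dact /mxtrace !sum3 /tensor_F5 !t3E !mxE ?t3E.
move=> e211 e200 e100 e111 e000 e001 e011.
have A02 : A 0 2 = 0 by apply: (by_eq (eqZ (-1) e011)); field.
have A01 : A 0 1 = 0 by apply: (by_eq (eqZ (- (4 / 3)) e001)); rewrite A02; field.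
have A12 : A 1 2 = 0 by apply: (by_eq (eqZ (-1) e111)); rewrite A01; field.
have A10 : A 1 0 = 0 by apply: (by_eq e100); rewrite A12; field.
have A20 : A 2 0 = 0 by apply: (by_eq e200); rewrite A10; field.
have A22 : A 2 2 = - 2 * A 0 0 - A 1 1.
  by apply: (by_eq (eqZ (-2) e000)); rewrite A01 A02; field.
have A00 : A 0 0 = -3 * A 1 1.
  by apply: (by_eq e211); rewrite ?A12; field.
exists (- A 1 1), (A 2 1); apply/matrixP => i j; rewrite !mxE.
elim/ord3P: i; elim/ord3P: j; rewrite !t3E ?A01 ?A02 ?A12 ?A10 ?A20 ?A22 ?A00 /=;
  by ring.
Qed.

(** Matrices with first column proportional to (1, 1, 0): the parameters are the
    factor and the six entries of the other columns. *)
Definition slice_mx : 'M[{mpoly C[7]}]_3 :=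
  \matrix_(i, j) t3 (t3 'X_0 'X_1 'X_2 j) (t3 'X_0 'X_3 'X_4 j) (t3 0 'X_5 'X_6 j) i.

Lemma slice_mx_eval N : N 1 0 = N 0 0 -> N 2 0 = 0 ->
  exists v, forall k, (mxvec slice_mx 0 k).@[v] = pt N k.
Proof.
move=> N10 N20.
exists (fun k : 'I_7 =>
  nth 0 [:: N 0 0; N 0 1; N 0 2; N 1 1; N 1 2; N 2 1; N 2 2] k) => k.
case/mxvec_indexP: k => i j; rewrite /pt !mxvecE mxE.
by elim/ord3P: i; elim/ord3P: j; rewrite !t3E ?mevalXU ?meval0 ?N10 ?N20.
Qed.

(** The matrices of [slice_mx] meet the coset of almost every M modulo the
    isotropy group of [w]; a fourth root of the factor c makes the pullbacks
    equal and not only proportional. *)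
Lemma alg_dependent_orbit w : is_form w ->
  (forall M, M 0 0 != 0 -> M 1 0 != 0 ->
     exists R, [/\ Iso w R, (R *m M) 1 0 = (R *m M) 0 0 & (R *m M) 2 0 = 0]) ->
  alg_dependent_on (PGL3_orbit w) 8.
Proof.
(* The matrices R below exist when the first two entries of the first column
   of M are nonzero. *)
move=> fw hR; pose h := generic_mx C 0 0 * generic_mx C 1 0.
have hE M : h.@[pt M] = M 0 0 * M 1 0.
  by rewrite mevalM !mxE !mevalXU /pt !mxvecE.
apply: (@alg_dependent_slice _ w 7 8 [tuple mxvec slice_mx 0 k | k < 3 * 3] h) => //.
  apply/eqP => /(congr1 (meval (pt (const_mx 1)))).
  by rewrite hE meval0 !mxE mul1r => /eqP; rewrite oner_eq0.
move=> M uM; rewrite hE mulf_eq0 negb_or => /andP[M00 M10].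
have [R [[uR [c c0 Rw]] RM1 RM2]] := hR M M00 M10.
pose t : C := 4.-root c^-1; have t4 : t ^+ 4 = c^-1 by rewrite rootCK.
have EN i j : (R *m t%:M *m M) i j = t * (R *m M) i j.
  by rewrite mul_mx_scalar -scalemxAl mxE.
have [v Ev] : exists v, forall k, (mxvec slice_mx 0 k).@[v] = pt (R *m t%:M *m M) k.
  by apply: slice_mx_eval; rewrite !EN ?RM1 // RM2 mulr0.
exists v, (R *m t%:M *m M); split; last by move=> k; rewrite tnth_mktuple Ev.
rewrite -!pullback_comp Rw !pullback_scale pullback_scalar // t4.
by rewrite pullback_scale scalerA -mpolyCM mulfV // mpolyC1 scale1r.
Qed.

Definition lower_mx (a b c s t : C) : 'M[C]_3 :=
  \matrix_(i, j) t3 (t3 a 0 0 j) (t3 0 b 0 j) (t3 s t c j) i.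

Lemma alg_dependent_F1 : alg_dependent_on (PGL3_orbit (F1 C)) 8.
Proof.
apply: alg_dependent_orbit (is_form_F1 C) _ => M M00 M10.
(* R equalizes the first two entries of the first column of M and clears the
   third; r is imposed by the relation between the diagonal entries. *)
pose r := M 0 0 ^+ 3 / M 1 0 ^+ 2.
exists (lower_mx (M 1 0) (M 0 0) r (- r * M 2 0 / M 0 0) 0).
have r0 : r != 0 by rewrite mulf_neq0 ?invr_eq0 ?expf_neq0.
split; rewrite ?mxE ?sum3 ?mxE ?t3E; last first.
- by field.
- by ring.
apply/Iso_F1P; split; first by split; rewrite mxE !t3E.
  by rewrite unit_lower !mxE !t3E // M10 M00.
by rewrite !mxE !t3E /r; field.
Qed.

Lemma alg_dependent_F5 : alg_dependent_on (PGL3_orbit (F5 C)) 8.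
Proof.
apply: alg_dependent_orbit (is_form_F5 C) _ => M M00 M10.
(* As for F1, with the relation between the diagonal entries of Iso F5. *)
pose r := M 0 0 ^+ 2 / M 1 0.
exists (lower_mx (M 1 0) (M 0 0) r 0 (- r * M 2 0 / M 1 0)).
have r0 : r != 0 by rewrite mulf_neq0 ?invr_eq0 ?expf_neq0.
split; rewrite ?mxE ?sum3 ?mxE ?t3E; last first.
- by field.
- by ring.
apply/Iso_F5P; split; first by split; rewrite mxE !t3E.
  by rewrite unit_lower !mxE !t3E // M10 M00.
by rewrite !mxE !t3E /r; field.
Qed.

(** The polynomial is the trace of J^2, where J_ij = T_i0j is half the derivative of
    the field at the first basis vector.  On the orbit of F1, J is similar, up
    to a factor, to half the derivative of (0, X^2, Y^2) at some point, which is
    strictly triangular.  For F5 it is diag(-1/2, 1/4, 1/4). *)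
Lemma separating_form : exists h : {mpoly C[Nc]},
  vanishes_on (PGL3_orbit (F1 C)) h /\ h.@[coefs (F5 C)] != 0.
Proof.
have [p Ep] := tens_coord C.
pose h := \sum_i \sum_j p i 0 j * p j 0 i; exists h.
have hE w : is_form w ->
    h.@[coefs w] = \sum_i \sum_j tens w i 0 j * tens w j 0 i.
  move=> fw; rewrite raddf_sum; apply: eq_bigr => i _.
  by rewrite raddf_sum; apply: eq_bigr => j _; rewrite /= mevalM !Ep.
split; last first.
  rewrite hE; last exact: is_form_F5.
  move: (tens _) (@tens_F5 C) => T ET; rewrite !sum3 !ET /tensor_F5 !t3E !mxE !t3E.
  rewrite (_ : _ + _ + _ = 3 / 8); last by field.
  by rewrite mulf_neq0 ?invr_eq0 ?pnatr_eq0.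
move=> _ /(PGL3_orbitE _ (is_form_F1 C))[M uM ->].
rewrite hE; last exact/is_form_pullback/is_form_F1.
pose K : 'M[C]_3 := \matrix_(l, n) \sum_m M m 0 * tens (F1 C) l m n.
have E i j : tens (pullback (linear_map M) (F1 C)) i 0 j = (adj3 M *m K *m M) i j.
  rewrite tens_pullback; last exact: is_form_F1.
  rewrite actE -mulmxA [RHS]mxE; apply: eq_bigr => l _; congr (_ * _).
  rewrite mxE exchange_big; apply: eq_bigr => n _ /=; rewrite mxE mulr_suml.
  by [].
transitivity (\tr (adj3 M *m K *m M *m (adj3 M *m K *m M))).
  apply: eq_bigr => i _; rewrite mxE; apply: eq_bigr => j _.
  by rewrite !E.
have -> : adj3 M *m K *m M *m (adj3 M *m K *m M) = \det M *: (adj3 M *m (K *m K *m M)).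
  rewrite -det3E -mulmxA (mulmxA M) (mulmxA M) mul_adj3 mul_scalar_mx -!scalemxAl.
  by rewrite -!scalemxAr !mulmxA.
rewrite mxtraceZ mxtrace_mulC -(mulmxA _ M) mul_adj3 mul_mx_scalar mxtraceZ.
suff -> : \tr (K *m K) = 0 by rewrite !mulr0.
rewrite /K; move: (tens _) (@tens_F1 C) => T ET.
rewrite /mxtrace sum3 !mxE !sum3 !mxE !sum3 !ET /field_F1 /planar !t3E !mxE ?t3E.
by ring.
Qed.

Lemma dependent_orbit_classification w : foliation 2 w ->
  ~ (exists f, @alg_independent_on C 2 (PGL3_orbit w) 8 f) ->
  PGL3_orbit (F1 C) w \/ PGL3_orbit (F5 C) w.
Proof.
move=> fol dep; apply: classification (fol) _; apply: big_iso_rank.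
  by have [i [j [k T0]]] := tens_neq0 fol; exists i, j, k.
rewrite leqNgt; apply/negP => r8; apply: dep.
exact: alg_independent_rank (foliation_is_form fol) r8.
Qed.

Lemma closure_classification w0 w : is_form w0 ->
  alg_dependent_on (PGL3_orbit w0) 8 -> in_closure w0 w -> foliation 2 w ->
  PGL3_orbit (F1 C) w \/ PGL3_orbit (F5 C) w.
Proof.
move=> fw0 dep cl fol; apply: dependent_orbit_classification => // -[f].
exact/alg_dependent_not_independent/(alg_dependent_closure fw0 (foliation_is_form fol) cl dep).
Qed.

(** The homogeneous equations of the orbit define its closure. *)
Lemma zariski_closed_orbit w0 : is_form w0 ->
  (forall w, foliation 2 w -> in_closure w0 w -> PGL3_orbit w0 w) ->
  zariski_closed 2 (PGL3_orbit w0).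
Proof.
move=> fw0 cl; exists (fun P => (exists d, P \is d.-homog) /\ vanishes_on (PGL3_orbit w0) P).
split=> [P []//|w fol]; split=> [ww0 P [_ P0]|P0]; first exact: P0.
by apply: cl => //; apply: homog_in_closure => P hP vP; apply: P0.
Qed.

Lemma zariski_closed_F1 : zariski_closed 2 (PGL3_orbit (F1 C)).
Proof.
have fF1 := is_form_F1 C; have fF5 := is_form_F5 C.
apply: (zariski_closed_orbit fF1) => w fol cl.
case: (closure_classification fF1 alg_dependent_F1 cl fol) => [|wF5]; first by apply.
have [h [h0 /eqP[]]] := separating_form.
exact: (in_closure_orbit fF1 (foliation_is_form fol) cl (orbit_sym fF5 wF5) h0).
Qed.

Lemma alg_independent_F1 :
  exists f, @alg_independent_on C 2 (PGL3_orbit (F1 C)) 7 f.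
Proof. exact: alg_independent_rank (is_form_F1 C) rank_jac_F1. Qed.

Lemma alg_independent_F5 :
  exists f, @alg_independent_on C 2 (PGL3_orbit (F5 C)) 7 f.
Proof. exact: alg_independent_rank (is_form_F5 C) rank_jac_F5. Qed.

Lemma zariski_closed_F5 : zariski_closed 2 (PGL3_orbit (F5 C)).
Proof.
have fF1 := is_form_F1 C; have fF5 := is_form_F5 C.
apply: (zariski_closed_orbit fF5) => w fol cl.
case: (closure_classification fF5 alg_dependent_F5 cl fol) => [wF1|]; last by apply.
have [h [h0 hF5]] := separating_form; have [f] := alg_independent_F1.
have clF1 := in_closure_orbit fF5 (foliation_is_form fol) cl (orbit_sym fF1 wF1).
move=> indf; case: (closure_dimension fF5 fF1 clF1 h0 _ alg_dependent_F5 indf).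
by move=> hv; case/eqP: hF5; apply: hv; apply: orbit_refl.
Qed.

Lemma proj_dim_eq (W W' : oneform C 3 -> Prop) d : (forall G, W G <-> W' G) ->
  proj_dim 2 W d -> proj_dim 2 W' d.
Proof.
move=> WW'; have E m f : @alg_independent_on C 2 W m f <-> @alg_independent_on C 2 W' m f.
  by split=> ind Q Q0; apply: ind => u Wu; apply: Q0; apply/WW'.
by move=> [[f /E indf] dep]; split=> [|[g /E]]; [exists f | move=> indg; apply: dep; exists g].
Qed.

Lemma proj_dim_orbit_F1 : proj_dim 2 (PGL3_orbit (F1 C)) 6.
Proof.
split=> [|[f]]; first exact: alg_independent_F1.
exact: alg_dependent_not_independent alg_dependent_F1.
Qed.

Lemma proj_dim_orbit_F5 : proj_dim 2 (PGL3_orbit (F5 C)) 6.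
Proof.
split=> [|[f]]; first exact: alg_independent_F5.
exact: alg_dependent_not_independent alg_dependent_F5.
Qed.

Lemma proj_dim_orbitP w : foliation 2 w ->
  proj_dim 2 (PGL3_orbit w) 6 <->
  (forall G, PGL3_orbit w G <-> PGL3_orbit (F1 C) G) \/
  (forall G, PGL3_orbit w G <-> PGL3_orbit (F5 C) G).
Proof.
move=> fol; split=> [[_ dep]|[E|E]].
- case: (dependent_orbit_classification fol dep) => ww0; [left|right].
    exact: orbit_eqP (is_form_F1 C) ww0.
  exact: orbit_eqP (is_form_F5 C) ww0.
- exact: (proj_dim_eq (fun G => iff_sym (E G)) proj_dim_orbit_F1).
- exact: (proj_dim_eq (fun G => iff_sym (E G)) proj_dim_orbit_F5).
Qed.

End OrbitsOfF1AndF5.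


Theorem proposition2p7 (R : realType) :
  let C : fieldType := R[i] in
  (foliation 2 (F1 C) /\ affine_chart (F1 C) = omega1 C) /\
  (foliation 2 (F5 C) /\ affine_chart (F5 C) = omega5 C) /\
  (forall F : oneform C 3, foliation 2 F -> dim_iso F 2 ->
     PGL3_orbit (F1 C) F \/ PGL3_orbit (F5 C) F) /\
  (forall F : oneform C 3, foliation 2 F ->
     (proj_dim 2 (PGL3_orbit F) 6 <->
      (forall G : oneform C 3, PGL3_orbit F G <-> PGL3_orbit (F1 C) G) \/
      (forall G : oneform C 3, PGL3_orbit F G <-> PGL3_orbit (F5 C) G))) /\
  zariski_closed 2 (PGL3_orbit (F1 C)) /\
  zariski_closed 2 (PGL3_orbit (F5 C)) /\
  (forall M : 'M[C]_3,
     Iso (F1 C) M <->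
     generated_by (fun P : 'M[C]_3 =>
       (exists2 alpha : C, alpha != 0
          & represents P (fun x y => (alpha ^+ 3 * x, alpha ^+ 2 * y))) \/
       (exists beta : C,
          represents P (fun x y => (x / (1 + beta * x), y / (1 + beta * x)))))
       M) /\
  (forall M : 'M[C]_3,
     Iso (F5 C) M <->
     generated_by (fun P : 'M[C]_3 =>
       (exists2 alpha : C, alpha != 0
          & represents P (fun x y => (alpha ^+ 2 * x, alpha * y))) \/
       (exists beta : C,
          represents P (fun x y => (x / (1 + beta * y), y / (1 + beta * y)))))
       M) /\
  ~ PGL3_conjugate (Iso (F1 C)) (Iso (F5 C)).
Proof.
move=> C; pose K : numClosedFieldType := R[i].
split; first by split; [apply: (foliation_F1 K)|apply: (affine_chart_F1 K)].
split; first by split; [apply: (foliation_F5 K)|apply: (affine_chart_F5 K)].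
split=> [F fol dimF|].
  exact: (@classification K F fol (big_iso_dim_iso fol dimF)).
split; first exact: (@proj_dim_orbitP K).
split; first exact: (zariski_closed_F1 K).
split; first exact: (zariski_closed_F5 K).
split; first exact: (@Iso_F1_generated K).
split; first exact: (@Iso_F5_generated K).
exact: (@Iso_F1_F5_not_conjugate K).
Qed.
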